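(* Let $N\ge3$ and let $\mathbf c:[a,b]\to\mathbb R^{N+1}$ be an (open) mildly smoothly turning curve at order $j+1$, for some $1\le j\le N$. Then there exists a sequence $\{P_n\}$ of polygonals inscribed in $\mathbf c$, with $\operatorname{mesh}P_n\to0$, such that $$\lim_{n\to\infty}\mathcal L_{\mathbb{RP}^N}([\mathbf n_j](P_n))=\int_a^b\|\dot{\mathbf n}_j(s)\|\,ds,$$ where $\mathbf n_j$ is the smooth $j$-th normal of the mildly smoothly turning curve $\mathbf c$.
   Context: Mildly smoothly turning curves. Let $\mathbf c:[a,b]\to\mathbb R^{N+1}$ be an open rectifiable curve parameterized by arc-length. It is mildly smoothly turning at order $j+1$, $j\in\{1,\dots,N\}$, if for each $s\in[a,b]$ the function $\mathbf c$ is of class $C^m$ in a neighborhood of $s$, for some integer $m\ge j+2$, and there exist $j$ integers $1<i_2<\dots<i_{j+1}<m$ such that the $(j+1)$-vector $(\dot{\mathbf c}\wedge\mathbf c^{(i_2)}\wedge\cdots\wedge\mathbf c^{(i_{j+1})})(s)$ is non-trivial. When $j=N$ the curve is called mildly smoothly turning. Smooth normals: if $j<N$ and $1<i_2<\dots<i_{j+1}$ are the smallest such integers at $s$, $\mathbf n_j(s)$ is the last vector in the Gram–Schmidt procedure applied to the ordered list $\dot{\mathbf c}(s),\mathbf c^{(i_2)}(s),\dots,\mathbf c^{(i_{j+1})}(s)$; if $\mathbf c$ is mildly smoothly turning, $\mathbf n_N:=\ast(\mathbf t\wedge\mathbf n_1\wedge\cdots\wedge\mathbf n_{N-1})$, $\mathbf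 t=\dot{\mathbf c}$, $\ast$ the Hodge operator in $\mathbb R^{N+1}$. ($\mathbf n_j$ is of class $C^1$ outside a finite set of points of $]a,b[$.) $\mathbb{RP}^N=\mathbb S^N/\{y\sim-y\}$ has the metric $d_{\mathbb{RP}^N}([y],[\tilde y])=\min\{d_{\mathbb S^N}(y,\tilde y),d_{\mathbb S^N}(y,-\tilde y)\}$, and $\mathcal L_{\mathbb{RP}^N}$ is the corresponding length. Polygonals. A polygonal $P$ in $\mathbb R^{N+1}$ has ordered, oriented, non-trivial segments $\sigma_1,\dots,\sigma_m$; $v_i:=\sigma_i/\mathcal L(\sigma_i)\in\mathbb S^N$; $\operatorname{mesh}P:=\sup_i\mathcal L(\sigma_i)$. $P$ is inscribed in $\mathbf c$ if its vertices are consecutive points of $\mathbf c$, including the end points. Discrete normals. Let $1\le j\le N-1$ and let $P$ not be contained in an affine subspace of dimension lower than $j+1$. For each $i$, $v_i^1$ is the first $v_h$ with $h>i$ and $[v_h]\ne[v_i]$; inductively for $k=2,\dots,j$, if $v_i^{k-1}=v_l$, then $v_i^k$ is the first $v_h$ with $h>l$ such that $v_i,v_i^1,\dots,v_i^k$ are linearly independent. Put $\Pi^{j+1}(P,v_i)=\mathrm{span}(v_i,v_i^1,\dots,v_i^j)$, and let $\mathbf n_j(P,i)\in\mathbb S^N$ be the unit vector (up to sign) of $\Pi^{j+1}(P,v_i)$ orthogonal to $v_i^1,\dots,v_i^j$. For $j=N$, let $P$ not be contained in an affine subspace of dimension lower than $N$; then $[\mathbf n_N(P,i)]$ is the class of the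 unit vectors orthogonal to the hyperplane $\Pi^N(P,v_i)$. If $P$ is closed the $v_i$ are listed cyclically; if $P$ is not closed and for some $i>1$ the required vectors do not exist, put $[\mathbf n_j(P,i)]:=[\mathbf n_j(P,i-1)]$. The discrete $j$-th normal $[\mathbf n_j](P)$ is the curve in $\mathbb{RP}^N$ obtained by connecting $[\mathbf n_j(P,i)]$ with $[\mathbf n_j(P,i+1)]$ by a minimal geodesic arc, for each $i$ (and $[\mathbf n_j(P,m)]$ with $[\mathbf n_j(P,1)]$ if $P$ is closed). *)

(* Defs.v *)
From HB Require Import structures.
From mathcomp Require Export all_boot all_order all_algebra.
From mathcomp Require Export all_classical all_reals all_analysis.

Set Implicit Arguments.
Unset Strict Implicit.
Unset Printing Implicit Defensive.

Export Order.TTheory GRing.Theory Num.Theory.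
Export numFieldNormedType.Exports.

Local Open Scope classical_set_scope.
Local Open Scope ring_scope.

Section Euclidean.
Context {R : realType}.

(* The norm `|u| that the library puts on row vectors is the sup norm. It
   induces the right topology, but lengths and angles need the Euclidean one. *)
Definition dot n (u v : 'rV[R]_n) : R := (u *m v^T) 0 0.

Definition enorm n (u : 'rV[R]_n) : R := Num.sqrt (dot u u).

Definition euclid_dist n (u v : 'rV[R]_n) : R := enorm (v - u).

Definition normalize n (u : 'rV[R]_n) : 'rV[R]_n := (enorm u)^-1 *: u.

Definition gram_schmidt n (vs : seq 'rV[R]_n) : seq 'rV[R]_n :=
  foldl (fun es v => rcons es (normalize (v - \sum_(e <- es) dot v e *: e)))
    [::] vs.

(* v_0 /\ ... /\ v_(k-1), given by its components as an antisymmetric tensor: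
   the entry at f is the coefficient of e_(f 0) /\ ... /\ e_(f (k-1)). *)
Definition wedge k n (v : 'I_k -> 'rV[R]_n) : {ffun {ffun 'I_k -> 'I_n} -> R} :=
  [ffun f : {ffun 'I_k -> 'I_n} => \det (\matrix_(p, q) v p 0 (f q))].

(* The Hodge operator from n-vectors to vectors of R^(n+1):
   e_0 /\ .. omit e_k .. /\ e_n is sent to (-1)^(n+k) e_k, because
   (e_0 /\ .. omit e_k .. /\ e_n) /\ e_k = (-1)^(n-k) e_0 /\ ... /\ e_n. *)
Definition hodge n (w : {ffun {ffun 'I_n -> 'I_n.+1} -> R}) : 'rV[R]_n.+1 :=
  \row_(k < n.+1) ((-1) ^+ (n + k) * w [ffun q : 'I_n => lift k q]).

(* Length, for a distance d on T, of the curve g restricted to [a, b]. *)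
Definition curve_length (T : Type) (d : T -> T -> R) (a b : R) (g : R -> T) :
    \bar R :=
  ereal_sup [set (\sum_(0 <= k < size s)
      d (g (nth b (a :: s) k)) (g (nth b (a :: s) k.+1)))%:E
    | s in [set s | itv_partition a b s]].

Definition sphere_dist n (y z : 'rV[R]_n) : R := acos (dot y z).

(* A point [y] of RP^N is represented by either of the unit vectors y, -y;
   rp_eq and rp_dist depend only on the classes. *)
Definition rp_eq n (y z : 'rV[R]_n) : bool := (y == z) || (y == - z).

Definition rp_dist n (y z : 'rV[R]_n) : R :=
  Num.min (sphere_dist y z) (sphere_dist y (- z)).

(* A minimal geodesic arc of RP^N from [y] (t = 0) to [z] (t = 1), with
   constant speed: the arc of great circle from y to the one of z, -z that is
   closest to y. *)
Definition rp_arc n (y z : 'rV[R]_n) (t : R) : 'rV[R]_n :=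
  let z' := if sphere_dist y z <= sphere_dist y (- z) then z else - z in
  let theta := sphere_dist y z' in
  if theta == 0 then y else
  (sin theta)^-1 *: (sin ((1 - t) * theta) *: y + sin (t * theta) *: z').

End Euclidean.

Section SmoothNormals.
Context {R : realType} (N : nat) (a b : R) (c : R -> 'rV[R]_N.+1).
Implicit Types (f : R -> 'rV[R]_N.+1) (j k m : nat) (i : seq nat) (s t : R).

(* Derivatives are taken within [a, b]: one-sided at a and b, the usual ones
   in between. Values outside [a, b] are never used. *)
Definition diff_quotient f t (u : R) : 'rV[R]_N.+1 := (u - t)^-1 *: (f u - f t).

Definition derivable_itv f t : Prop :=
  cvg (diff_quotient f t @ within `[a, b] t^').

Definition deriv_itv f t : 'rV[R]_N.+1 :=
  lim (diff_quotient f t @ within `[a, b] t^').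

Definition derivn_itv k f : R -> 'rV[R]_N.+1 := iter k deriv_itv f.

Definition arclength_parameterized : Prop :=
  forall s t, a <= s -> s <= t -> t <= b ->
    curve_length (@euclid_dist R N.+1) s t c = (t - s)%:E.

Definition class_C_near m s : Prop :=
  \forall t \near within `[a, b] (nbhs s),
    (forall k, (k < m)%N -> derivable_itv (derivn_itv k c) t) /\
    derivn_itv m c @ within `[a, b] (nbhs t) --> derivn_itv m c t.

(* The vectors c'(s), c^(i_2)(s), ..., c^(i_(j+1))(s), for
   i = [:: i_2; ...; i_(j+1)]. *)
Definition derivs_at s i : seq 'rV[R]_N.+1 :=
  [seq derivn_itv k c s | k <- 1%N :: i].

Definition admissible j s i : Prop :=
  exists m, [/\ (j + 2 <= m)%N, class_C_near m s,
    size i = j, path ltn 1 i && all (fun k => k < m)%N i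
    & wedge (fun p : 'I_j.+1 => nth 0 (derivs_at s i) p) != 0].

(* "at order j + 1" *)
Definition mildly_smoothly_turning j : Prop :=
  forall s, a <= s <= b -> exists i, admissible j s i.

Definition smallest_admissible j s i : Prop :=
  admissible j s i /\
  forall i', admissible j s i' -> forall k, (nth 0 i k <= nth 0 i' k)%N.

Definition gs_normal j s : 'rV[R]_N.+1 :=
  last 0 (gram_schmidt
    (derivs_at s (xget [::] [set i | smallest_admissible j s i]))).

Definition smooth_normal j s : 'rV[R]_N.+1 :=
  if (j < N)%N then gs_normal j s
  else hodge (wedge (fun k : 'I_N =>
         if k == 0%N :> nat then deriv_itv c s else gs_normal k s)).

End SmoothNormals.

Section Polygonals.
Context {R : realType} (N : nat).

(* A polygonal is given by the list P of its vertices; all indices below start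
   at 0, so that the segments are sigma_0, ..., sigma_(nseg P - 1). *)
Implicit Types (P : seq 'rV[R]_N.+1) (i j k l h : nat).

Definition nseg P : nat := (size P).-1.

Definition segment P k : 'rV[R]_N.+1 := nth 0 P k.+1 - nth 0 P k.

Definition polygonal P : Prop :=
  (0 < nseg P)%N /\ forall k, (k < nseg P)%N -> segment P k != 0.

Definition mesh P : R := \big[Num.max/0]_(k < nseg P) enorm (segment P k).

Definition inscribed (a b : R) (c : R -> 'rV[R]_N.+1) P : Prop :=
  exists2 s : seq R, itv_partition a b s & P = map c (a :: s).

(* P lies in an affine subspace of dimension lower than d. *)
Definition in_affine_lt P (d : nat) : Prop :=
  exists (p0 : 'rV[R]_N.+1) (W : {vspace 'rV[R]_N.+1}),
    (\dim W < d)%N /\ forall p, p \in P -> p - p0 \in W.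

Definition closed_polygonal P : bool := head 0 P == last 0 P.

(* The vector v_h; for a closed P the list is repeated periodically. *)
Definition dir P h : 'rV[R]_N.+1 :=
  normalize (segment P (if closed_polygonal P then (h %% nseg P)%N else h)).

(* The first h > l such that v_h is in the list and Q h holds; for a closed P
   one turn around P exhausts all the possible vectors v_h. *)
Definition first_after P l (Q : pred nat) : option nat :=
  ohead [seq h <- iota l.+1 (nseg P) |
         (closed_polygonal P || (h < nseg P)%N) && Q h].

(* The indices of v_i, v_i^1, ..., v_i^k, if these vectors exist. *)
Fixpoint pick_indices P i k : option (seq nat) :=
  if k is k'.+1 then
    if pick_indices P i k' is Some ls then
      omap (rcons ls) (first_after P (last i ls) (fun h =>
        if k' is 0 then ~~ rp_eq (dir P h) (dir P i)
        else free [seq dir P l | l <- rcons ls h]))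
    else None
  else Some [:: i].

(* Number of vectors v_i^k needed for n_j(P, i): j if j < N, N - 1 if j = N. *)
Definition npicks j : nat := minn j N.-1.

(* The domain of definition of the discrete j-th normal. *)
Definition has_discrete_normal j P : Prop := ~ in_affine_lt P (npicks j).+1.

(* w is one of the two unit vectors in the class [n_j(P, i)], where ls are the
   indices of v_i, v_i^1, .... *)
Definition is_normal_at j P (ls : seq nat) (w : 'rV[R]_N.+1) : Prop :=
  enorm w = 1 /\
  if (j < N)%N then
    w \in <<[seq dir P l | l <- ls]>>%VS /\
    forall l, l \in behead ls -> dot w (dir P l) = 0
  else forall l, l \in ls -> dot w (dir P l) = 0.

Fixpoint normal_at j P i : 'rV[R]_N.+1 :=
  if pick_indices P i (npicks j) is Some ls then xget 0 (is_normal_at j P ls)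
  else if i is i'.+1 then normal_at j P i' else 0.

(* The curve [n_j](P), parameterized on [0, discrete_normal_end P] so that it
   is at [n_j(P, i)] at time i; for a closed P, normal_at is periodic and the
   last arc goes back to the starting point. *)
Definition discrete_normal_end P : R :=
  (if closed_polygonal P then nseg P else (nseg P).-1)%:R.

Definition discrete_normal j P (t : R) : 'rV[R]_N.+1 :=
  let i := Num.truncn t in
  rp_arc (normal_at j P i) (normal_at j P i.+1) (t - i%:R).

Definition discrete_normal_length j P : \bar R :=
  curve_length (@rp_dist R N.+1) 0 (discrete_normal_end P) (discrete_normal j P).

End Polygonals.

(* Main.v *)
Require Import Defs.
From mathcomp Require Import measurable_realfun ring lra zify.

Set Implicit Arguments.
Unset Strict Implicit.
Unset Printing Implicit Defensive.

Local Open Scope classical_set_scope.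
Local Open Scope ring_scope.

(** Why the theorem holds.

   The discrete normals turn along geodesic arcs, so the length of [n_j](P) is
   the sum of the projective distances between consecutive normals
   (discrete_normal_lengthE), and it is the sum over the polygonal of small
   rotations of these normals. To get rid of the signs, a unit vector y is
   replaced by the matrix y^T y. Suppose that the sides in each window of P are
   independent; then the discrete normal at i is orthogonal to j consecutive
   sides inside the span of j + 1 of them, whence y^T y is a difference of two
   orthogonal projectors (normal_atP). The Gram-Schmidt procedure, and the
   Hodge operator when j = N, give the same formula for the smooth normal with
   the osculating spaces of the curve in place of the spans of sides
   (smooth_normal_spec). Projectors depend on spans only, and smoothly on a
   basis of them, and the Frobenius norm of a difference of two such matrices is
   sqrt 2 times the sine of the projective distance.

   Call a point of the curve good if its first derivatives c', c'', ..., as many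
   as a window has sides, are independent there. Every point of [a, b] has a
   punctured neighbourhood of good points (near_osc), so by compactness all
   points but finitely many are good (good_partition). On a uniform grid of step
   h near a good point t, the divided differences of the vertices converge to
   the derivatives of c, and their increments divided by h to the next
   derivatives. The derivative of the difference of projectors is then given by
   one formula along the grid and along the curve (strict_diff_nproj), so
   consecutive discrete normals are at distance h |n'(t)| + o(h), uniformly on
   compact sets of good points (window_dist, inner_uniform). Compared with an
   antiderivative of |n'|, these distances telescope.

   Around an exceptional point e there are boundedly many windows, but for a
   careless choice of the vertices they may degenerate: three equidistant points
   around an inflection point can be aligned. The vertices are the exceptional
   points e_k themselves and uniform grids from e_k + d' to e_(k+1) - d. Let k_1 < k_2 < ... be the orders at which the span of the
   derivatives at e grows. By Taylor expansion, p consecutive derivatives of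
   c - c(e) at a point close to e span, modulo the first q vectors
   c^(k_1)(e), ..., c^(k_q)(e), nearly the same space as the next p of them
   (jets_cvg): after rescaling, the matrix of coefficients tends to a confluent
   Vandermonde matrix, which is invertible (ffact_mx_unit). A window with p sides
   before e and q sides after e has, as the step tends to 0, the span of the
   derivatives of c - c(e) of order 0 to p - 1 at e - d and of those of order 0
   to q - 1 at e + d'. Letting d' and then d
   tend to 0, its span approaches that of c^(k_1)(e), ..., c^(k_(p+q))(e),
   whatever p is (near_jets, window_straddle). So all the windows of one size
   around e have nearly the same span, and the arcs between their normals are
   short (arc_near).

   Hence, for each positive eps, one takes d, then d', and at last the step small
   enough: the length is within eps of the integral of |n'| over the intervals
   [e_k + d', e_(k+1) - d] (approximation), and these integrals tend to the one
   over [a, b] by monotone convergence (gap_integral_cvg). *)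

(** * Euclidean norm and Frobenius norm *)

Section EuclideanAlgebra.
Context {R : realType}.

Lemma dotE n (u v : 'rV[R]_n) : dot u v = \sum_i u 0 i * v 0 i.
Proof. by rewrite /dot mxE; apply: eq_bigr => i _; rewrite mxE. Qed.

Lemma dotC n (u v : 'rV[R]_n) : dot u v = dot v u.
Proof. by rewrite !dotE; apply: eq_bigr => i _; rewrite mulrC. Qed.

Lemma dotDl n (u v w : 'rV[R]_n) : dot (u + v) w = dot u w + dot v w.
Proof. by rewrite /dot mulmxDl mxE. Qed.

Lemma dotZl n (x : R) (u v : 'rV[R]_n) : dot (x *: u) v = x * dot u v.
Proof. by rewrite /dot -scalemxAl mxE. Qed.

Lemma dotNl n (u v : 'rV[R]_n) : dot (- u) v = - dot u v.
Proof. by rewrite -scaleN1r dotZl mulN1r. Qed.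

Lemma dotDr n (u v w : 'rV[R]_n) : dot w (u + v) = dot w u + dot w v.
Proof. by rewrite dotC dotDl !(dotC w). Qed.

Lemma dotZr n (x : R) (u v : 'rV[R]_n) : dot u (x *: v) = x * dot u v.
Proof. by rewrite dotC dotZl dotC. Qed.

Lemma dotNr n (u v : 'rV[R]_n) : dot u (- v) = - dot u v.
Proof. by rewrite dotC dotNl dotC. Qed.

Lemma dot_ge0 n (u : 'rV[R]_n) : 0 <= dot u u.
Proof. by rewrite dotE sumr_ge0 // => i _; rewrite -expr2 sqr_ge0. Qed.

Lemma dot_eq0 n (u : 'rV[R]_n) : (dot u u == 0) = (u == 0).
Proof.
apply/eqP/eqP => [|->]; last by rewrite /dot mul0mx mxE.
rewrite dotE => /eqP; rewrite psumr_eq0; last by move=> i _; rewrite -expr2 sqr_ge0.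
move=> /allP h; apply/rowP => i; rewrite mxE.
by have := h i (mem_index_enum _); rewrite /= mulf_eq0 orbb => /eqP.
Qed.

Lemma dot_gt0 n (u : 'rV[R]_n) : (0 < dot u u) = (u != 0).
Proof. by rewrite lt0r dot_ge0 andbT dot_eq0. Qed.

Lemma enorm_ge0 n (u : 'rV[R]_n) : 0 <= enorm u.
Proof. exact: sqrtr_ge0. Qed.

Lemma sqr_enorm n (u : 'rV[R]_n) : enorm u ^+ 2 = dot u u.
Proof. by rewrite sqr_sqrtr // dot_ge0. Qed.

Lemma enorm_eq0 n (u : 'rV[R]_n) : (enorm u == 0) = (u == 0).
Proof. by rewrite -(@sqrf_eq0 _ (enorm u)) sqr_enorm dot_eq0. Qed.

Lemma enorm_gt0 n (u : 'rV[R]_n) : (0 < enorm u) = (u != 0).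
Proof. by rewrite lt0r enorm_ge0 andbT enorm_eq0. Qed.

Lemma enorm1P n (u : 'rV[R]_n) : enorm u = 1 <-> dot u u = 1.
Proof.
split=> h; first by rewrite -sqr_enorm h expr1n.
by rewrite /enorm h sqrtr1.
Qed.

Lemma enormZ n (x : R) (u : 'rV[R]_n) : enorm (x *: u) = `|x| * enorm u.
Proof.
by rewrite /enorm dotZl dotZr mulrA -expr2 sqrtrM ?sqr_ge0 // sqrtr_sqr.
Qed.

Lemma enormN n (u : 'rV[R]_n) : enorm (- u) = enorm u.
Proof. by rewrite /enorm dotNl dotNr opprK. Qed.

Lemma enorm0 n : enorm (0 : 'rV[R]_n) = 0.
Proof. by apply/eqP; rewrite enorm_eq0. Qed.

Lemma enorm_normalize n (u : 'rV[R]_n) : u != 0 -> enorm (normalize u) = 1.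
Proof.
move=> u0; rewrite /normalize enormZ ger0_norm ?invr_ge0 ?enorm_ge0 //.
by rewrite mulVf // enorm_eq0.
Qed.

Lemma cauchy_schwarz n (u v : 'rV[R]_n) : dot u v ^+ 2 <= dot u u * dot v v.
Proof.
have [->|v0] := eqVneq v 0.
  by rewrite /dot trmx0 !mulmx0 !mxE expr0n mulr0.
have vv : 0 < dot v v by rewrite dot_gt0.
have := dot_ge0 (dot v v *: u - dot u v *: v).
rewrite !(dotDl, dotDr, dotZl, dotZr, dotNl, dotNr) (dotC v u).
rewrite [X in 0 <= X](_ : _ = dot v v * (dot u u * dot v v - dot u v ^+ 2)).
  by rewrite pmulr_rge0 // subr_ge0.
by ring.
Qed.

Lemma norm_dot_le n (u v : 'rV[R]_n) : `|dot u v| <= enorm u * enorm v.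
Proof.
rewrite -(@ler_pXn2r _ 2) ?nnegrE ?mulr_ge0 ?enorm_ge0 // exprMn !sqr_enorm.
by rewrite real_normK ?num_real // cauchy_schwarz.
Qed.

Definition frob2 m n (M : 'M[R]_(m, n)) : R := \sum_i \sum_j M i j ^+ 2.

Lemma frob2E m n (M : 'M[R]_(m, n)) : frob2 M = \tr (M *m M^T).
Proof.
apply: eq_bigr => i _; rewrite mxE; apply: eq_bigr => j _.
by rewrite mxE expr2.
Qed.

(** The left side measures the angle of two lines: it is twice the square of its
   sine. *)
Lemma frob2_rank1B n (y z : 'rV[R]_n) : dot y y = 1 -> dot z z = 1 ->
  frob2 (y^T *m y - z^T *m z) = 2 * (1 - dot y z ^+ 2).
Proof.
have tr (u v : 'rV[R]_n) : \tr (u^T *m v) = dot v u.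
  by rewrite mxtrace_mulC /mxtrace big_ord1.
have E (u v : 'rV[R]_n) : \tr ((u^T *m u) *m (v^T *m v)) = dot u v ^+ 2.
  rewrite !mulmxA -(mulmxA u^T).
  have -> : u *m v^T = (dot u v)%:M by apply/matrixP => i j; rewrite !ord1 [RHS]mxE eqxx mulr1n.
  by rewrite mul_mx_scalar -scalemxAl mxtraceZ tr (dotC v) expr2.
move=> y1 z1.
rewrite frob2E linearB /= !trmx_mul !trmxK mulmxBl !mulmxBr !raddfB /= !E.
rewrite y1 z1 (dotC z y); ring.
Qed.

End EuclideanAlgebra.

(** * Orthogonal projectors *)

Section Projector.
Context {R : realType}.
Variable n : nat.

Definition gram k (M : 'M[R]_(k, n)) := M *m M^T.

(** The orthogonal projector on the row space of M. *)
Definition proj k (M : 'M[R]_(k, n)) : 'M[R]_n := M^T *m invmx (gram M) *m M.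

Lemma gram_unit k (M : 'M[R]_(k, n)) : (gram M \in unitmx) = row_free M.
Proof.
rewrite -row_free_unit -!kermx_eq0; apply/eqP/eqP => h.
  apply/eqP; rewrite -submx0 -h; apply/sub_kermxP.
  by rewrite /gram mulmxA mulmx_ker mul0mx.
apply/eqP; rewrite -submx0 -h; apply/sub_kermxP.
apply/row_matrixP => i; rewrite row0 row_mul.
set x := row i _; have /eqP := mulmx_ker (gram M).
move=> /eqP /(congr1 (row i)); rewrite row_mul row0 -/x /gram mulmxA => e.
by apply/eqP; rewrite -dot_eq0 /dot trmx_mul mulmxA e mul0mx mxE.
Qed.

Lemma mul_proj k (M : 'M[R]_(k, n)) : row_free M -> M *m proj M = M.
Proof.
move=> fM; rewrite /proj !mulmxA -/(gram M) mulmxV ?mul1mx //.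
by rewrite gram_unit.
Qed.

Lemma proj_tr k (M : 'M[R]_(k, n)) : (proj M)^T = proj M.
Proof.
rewrite /proj !trmx_mul trmxK trmx_inv /gram trmx_mul trmxK mulmxA.
by [].
Qed.

Lemma proj_submx k (M : 'M[R]_(k, n)) : (proj M <= M)%MS.
Proof. by rewrite /proj submxMl. Qed.

Lemma submx_proj k p (M : 'M[R]_(k, n)) (v : 'M[R]_(p, n)) : row_free M ->
  (v <= M)%MS -> v *m proj M = v.
Proof. by move=> fM /submxP[D ->]; rewrite -mulmxA mul_proj. Qed.

Lemma proj_ortho k p (M : 'M[R]_(k, n)) (v : 'M[R]_(p, n)) :
  v *m M^T = 0 -> v *m proj M = 0.
Proof. by move=> h; rewrite /proj !mulmxA h !mul0mx. Qed.

(** As its rows lie in that space, Q = Q proj M; transposing, Q = proj M Q, which is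
   proj M because Q fixes M. *)
Lemma proj_unique k (M : 'M[R]_(k, n)) (Q : 'M[R]_n) : row_free M ->
  Q^T = Q -> M *m Q = M -> (Q <= M)%MS -> Q = proj M.
Proof.
move=> fM sQ MQ QM; rewrite -[LHS](submx_proj fM QM).
rewrite -[LHS]trmxK trmx_mul sQ proj_tr -[RHS]proj_tr; congr trmx.
by rewrite /proj -(mulmxA _ M) MQ.
Qed.

(** As many independent vectors as B has rows force B to span the same space. *)
Lemma row_free_sub k l (A : 'M[R]_(k, n)) (B : 'M[R]_(l, n)) :
  row_free A -> (A <= B)%MS -> (l <= k)%N -> row_free B /\ (B <= A)%MS.
Proof.
move=> fA AB lk.
have rA : \rank A = k by apply/eqP.
have rB : \rank B = k.
  apply/anti_leq; rewrite (leq_trans (rank_leq_row B) lk) /= -{1}rA.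
  exact: mxrankS.
have kl : k = l by apply/anti_leq; rewrite lk -{1}rB rank_leq_row.
split; first by rewrite /row_free rB kl.
by have := (mxrank_leqif_sup AB).2; rewrite rA rB eqxx => /esym.
Qed.

Lemma proj_eqspan k (A B : 'M[R]_(k, n)) :
  row_free A -> (A <= B)%MS -> proj A = proj B.
Proof.
move=> fA AB; have [fB BA] := row_free_sub fA AB (leqnn k).
apply: proj_unique => //; first exact: proj_tr.
  by rewrite submx_proj.
exact: (submx_trans (proj_submx A) AB).
Qed.

Lemma row_mulmxtr0 k (w : 'rV[R]_n) (B : 'M[R]_(k, n)) :
  (forall i, dot w (row i B) = 0) <-> w *m B^T = 0.
Proof.
split=> h.
  apply/rowP => i; have := h i; rewrite /dot !mxE => e; rewrite -[RHS]e.
  by apply: eq_bigr => l _; rewrite !mxE.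
move=> i; move/rowP/(_ i): h; rewrite /dot !mxE => e; rewrite -[RHS]e.
by apply: eq_bigr => l _; rewrite !mxE.
Qed.

Lemma dot_mx (x y : 'rV[R]_n) : x *m y^T = (dot x y)%:M.
Proof. by apply/matrixP => i j; rewrite !ord1 [RHS]mxE eqxx mulr1n. Qed.

(** Adding to B a unit vector orthogonal to it adds its rank-one projector. *)
Lemma proj_col_mx k (w : 'rV[R]_n) (B : 'M[R]_(k, n)) :
  dot w w = 1 -> w *m B^T = 0 -> row_free B ->
  row_free (col_mx w B) /\ proj (col_mx w B) = w^T *m w + proj B.
Proof.
move=> w1 wB fB.
have BwT : B *m w^T = 0 by rewrite -[LHS]trmxK trmx_mul trmxK wB trmx0.
have fC : row_free (col_mx w B).
  rewrite -gram_unit /gram tr_col_mx mul_col_row wB BwT dot_mx w1.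
  by rewrite unitmxE det_ublock det1 mul1r -unitmxE gram_unit.
split=> //; symmetry; apply: proj_unique => //.
- by rewrite linearD /= trmx_mul trmxK proj_tr.
- rewrite mul_col_mx !mulmxDr mulmxA dot_mx w1 mul1mx (proj_ortho wB) addr0.
  by rewrite mulmxA BwT mul0mx add0r mul_proj.
- apply: addmx_sub.
    by apply: (submx_trans (submxMl _ _)); rewrite -addsmxE addsmxSl.
  by apply: (submx_trans (proj_submx _)); rewrite -addsmxE addsmxSr.
Qed.

Lemma proj_full k (M : 'M[R]_(k, n)) : row_free M -> (n <= k)%N -> proj M = 1%:M.
Proof.
move=> fM nk; symmetry; apply: proj_unique => //; rewrite ?trmx1 ?mulmx1 //.
apply: (submx_trans (submx1 _)).
by rewrite sub1mx /row_full eqn_leq rank_leq_col /=; move/eqP: fM => ->.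
Qed.

(** If w is the unit normal of B inside A, or inside the whole space when B is
   a hyperplane, its sign-free description is a difference of projectors. *)
Definition nproj (full : bool) k l (A : 'M[R]_(k, n)) (B : 'M[R]_(l, n)) : 'M[R]_n :=
  (if full then 1%:M else proj A) - proj B.

Lemma rank1_nproj full k (A : 'M[R]_(k.+1, n)) (B : 'M[R]_(k, n)) (w : 'rV[R]_n) :
  dot w w = 1 -> w *m B^T = 0 -> row_free B ->
  (if full then (n <= k.+1)%N else (w <= A)%MS && (B <= A)%MS) ->
  w^T *m w = nproj full A B.
Proof.
move=> w1 wB fB h; have [fC pC] := proj_col_mx w1 wB fB.
have -> : w^T *m w = proj (col_mx w B) - proj B by rewrite pC addrK.
rewrite /nproj; congr (_ - _); case: full h => h; first exact: proj_full.
have/andP[wA BA] := h; have CA : (col_mx w B <= A)%MS by rewrite col_mx_sub wA.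
exact: (@proj_eqspan k.+1 (col_mx w B) A fC CA).
Qed.

(** Any vector of the ambient space outside B has a component normal to B. *)
Lemma unit_normal_exists full k (A : 'M[R]_(k.+1, n)) (B : 'M[R]_(k, n)) :
  row_free B ->
  (if full then (k < n)%N else row_free A && (B <= A)%MS) ->
  exists w : 'rV[R]_n, [/\ dot w w = 1, w *m B^T = 0 & ~~ full -> (w <= A)%MS].
Proof.
move=> fB h.
have [v [vB vA]] : exists v : 'rV[R]_n, ~~ (v <= B)%MS /\ (~~ full -> (v <= A)%MS).
  case: full h => [kn|/andP[fA BA]].
    have : ~~ (1%:M <= B)%MS.
      apply/negP => /mxrankS; rewrite mxrank1; move/eqP: fB => -> ; lia.
    move=> /row_subPn[i hi]; exists (row i 1%:M); split=> //.
  have : ~~ (A <= B)%MS.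
    apply/negP => /mxrankS; move/eqP: fB => ->; move/eqP: fA => ->; lia.
  move=> /row_subPn[i hi]; exists (row i A); split=> // _; exact: row_sub.
pose u := v - v *m proj B.
have u0 : u != 0.
  apply: contra vB; rewrite subr_eq0 => /eqP ->.
  by apply: (submx_trans (submxMl _ _)); exact: proj_submx.
exists (normalize u); split.
- by apply/enorm1P; exact: enorm_normalize.
- rewrite /normalize -scalemxAl /u mulmxBl.
  rewrite -mulmxA -[proj B]proj_tr -trmx_mul mul_proj // subrr scaler0 //.
- move=> nf; move: h; rewrite (negbTE nf) => /andP[_ BA].
  rewrite /normalize scalemx_sub // addmx_sub ?vA // eqmx_opp.
  apply: (submx_trans (submxMl _ _)); exact: (submx_trans (proj_submx _)).
Qed.

End Projector.

(** * Limits and difference quotients of matrices *)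

Section MatrixLimits.
Context {R : realType} {T : Type} (F : set_system T) {FF : Filter F}.

Lemma cvgr_sum (I : Type) (r : seq I) (P : pred I) (f : I -> T -> R) (a : I -> R) :
  (forall i, P i -> f i @ F --> a i) ->
  (fun t => \sum_(i <- r | P i) f i t) @ F --> \sum_(i <- r | P i) a i.
Proof. by move=> h; apply: cvg_big => //; exact: add_continuous. Qed.

Lemma cvgr_prod (I : Type) (r : seq I) (P : pred I) (f : I -> T -> R) (a : I -> R) :
  (forall i, P i -> f i @ F --> a i) ->
  (fun t => \prod_(i <- r | P i) f i t) @ F --> \prod_(i <- r | P i) a i.
Proof. by move=> h; apply: cvg_big => //; exact: mul_continuous. Qed.

(** Convergence is taken entry by entry, which makes sense for every filter and
   every dimension, 0 included, and reduces limits of products, determinants and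
   inverses to those of real functions. *)
Definition mxcvg m n (M : T -> 'M[R]_(m, n)) (A : 'M[R]_(m, n)) : Prop :=
  forall i j, (fun t => M t i j) @ F --> A i j.

Lemma mxcvg_cst m n (A : 'M[R]_(m, n)) : mxcvg (fun=> A) A.
Proof. by move=> i j; exact: cvg_cst. Qed.

Lemma mxcvg_eq m n (M M' : T -> 'M[R]_(m, n)) A :
  (\forall t \near F, M t = M' t) -> mxcvg M A -> mxcvg M' A.
Proof.
move=> e h i j; apply: cvg_trans (h i j); apply: near_eq_cvg.
by apply: filterS e => t ->.
Qed.

Lemma mxcvgD m n (M M' : T -> 'M[R]_(m, n)) A A' :
  mxcvg M A -> mxcvg M' A' -> mxcvg (fun t => M t + M' t) (A + A').
Proof.
move=> h h' i j; rewrite mxE; under eq_fun do rewrite mxE.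
exact: cvgD.
Qed.

Lemma mxcvgN m n (M : T -> 'M[R]_(m, n)) A : mxcvg M A -> mxcvg (fun t => - M t) (- A).
Proof.
move=> h i j; rewrite mxE; under eq_fun do rewrite mxE.
exact: cvgN.
Qed.

Lemma mxcvgB m n (M M' : T -> 'M[R]_(m, n)) A A' :
  mxcvg M A -> mxcvg M' A' -> mxcvg (fun t => M t - M' t) (A - A').
Proof. by move=> h h'; apply: mxcvgD => //; exact: mxcvgN. Qed.

Lemma mxcvgZ m n (x : T -> R) (M : T -> 'M[R]_(m, n)) (y : R) A :
  x @ F --> y -> mxcvg M A -> mxcvg (fun t => x t *: M t) (y *: A).
Proof.
move=> h h' i j; rewrite mxE; under eq_fun do rewrite mxE.
exact: cvgM.
Qed.

Lemma mxcvgM m n p (M : T -> 'M[R]_(m, n)) (M' : T -> 'M[R]_(n, p)) A A' :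
  mxcvg M A -> mxcvg M' A' -> mxcvg (fun t => M t *m M' t) (A *m A').
Proof.
move=> h h' i j; rewrite mxE; under eq_fun do rewrite mxE.
by apply: cvgr_sum => k _; exact: cvgM.
Qed.

Lemma mxcvg_tr m n (M : T -> 'M[R]_(m, n)) A :
  mxcvg M A -> mxcvg (fun t => (M t)^T) A^T.
Proof. by move=> h i j; rewrite mxE; under eq_fun do rewrite mxE; exact: h. Qed.

Lemma mxcvg_col_mx m m' n (M : T -> 'M[R]_(m, n)) (M' : T -> 'M[R]_(m', n)) A A' :
  mxcvg M A -> mxcvg M' A' -> mxcvg (fun t => col_mx (M t) (M' t)) (col_mx A A').
Proof.
move=> h h' i j; rewrite mxE; under eq_fun do rewrite mxE.
by case: (fintype.split i) => k; [exact: h | exact: h'].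
Qed.

Lemma mxcvg_det n (M : T -> 'M[R]_n) A : mxcvg M A -> (fun t => \det (M t)) @ F --> \det A.
Proof.
move=> h; apply: cvgr_sum => s _; apply: cvgM; first exact: cvg_cst.
by apply: cvgr_prod => i _; exact: h.
Qed.

Lemma mxcvg_dot n (u v : T -> 'rV[R]_n) a b : mxcvg u a -> mxcvg v b ->
  (fun t => dot (u t) (v t)) @ F --> dot a b.
Proof. by move=> h h'; apply: mxcvgM => //; exact: mxcvg_tr. Qed.

Lemma mxcvg_enorm n (u : T -> 'rV[R]_n) a : mxcvg u a ->
  (fun t => enorm (u t)) @ F --> enorm a.
Proof.
move=> h; apply: (cvg_comp (fun t => dot (u t) (u t)) Num.sqrt (mxcvg_dot h h)).
exact: (@sqrt_continuous R (dot a a)).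
Qed.

Lemma mxcvg_frob2 m n (M : T -> 'M[R]_(m, n)) A : mxcvg M A ->
  (fun t => frob2 (M t)) @ F --> frob2 A.
Proof.
move=> h; apply: cvgr_sum => i _; apply: cvgr_sum => j _.
by rewrite expr2; under eq_fun do rewrite expr2; apply: cvgM; exact: h.
Qed.

Lemma near_neq0 (f : T -> R) (a : R) : f @ F --> a -> a != 0 -> \forall t \near F, f t != 0.
Proof.
move=> h a0; have /cvgrPdist_lt/(_ `|a|) := h; rewrite normr_gt0 => /(_ a0).
apply: filterS => t; apply: contraTneq => ->; by rewrite subr0 ltxx.
Qed.

Lemma near_unitmx n (M : T -> 'M[R]_n) A : mxcvg M A -> A \in unitmx ->
  \forall t \near F, M t \in unitmx.
Proof.
move=> h; rewrite unitmxE unitfE => A0.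
by apply: filterS (near_neq0 (mxcvg_det h) A0) => t; rewrite unitmxE unitfE.
Qed.

Lemma mxcvg_inv n (M : T -> 'M[R]_n) A : mxcvg M A -> A \in unitmx ->
  mxcvg (fun t => invmx (M t)) (invmx A).
Proof.
move=> h Au; have Mu := near_unitmx h Au.
rewrite /invmx Au; apply: (@mxcvg_eq _ _ (fun t => (\det (M t))^-1 *: \adj (M t))).
  by apply: filterS Mu => t ->.
apply: mxcvgZ.
  by apply: cvgV; [move: Au; rewrite unitmxE unitfE | exact: mxcvg_det].
move=> i j; rewrite mxE; under eq_fun do rewrite mxE.
apply: cvgM; first exact: cvg_cst.
apply: mxcvg_det => k l; rewrite !mxE; under eq_fun do rewrite !mxE.
exact: h.
Qed.

Lemma mxcvg_gram k n (M : T -> 'M[R]_(k, n)) A : mxcvg M A ->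
  mxcvg (fun t => gram (M t)) (gram A).
Proof. by move=> h; apply: mxcvgM => //; exact: mxcvg_tr. Qed.

Lemma near_row_free k n (M : T -> 'M[R]_(k, n)) A : mxcvg M A -> row_free A ->
  \forall t \near F, row_free (M t).
Proof.
move=> h; rewrite -gram_unit => Au.
by apply: filterS (near_unitmx (mxcvg_gram h) Au) => t; rewrite gram_unit.
Qed.

Lemma mxcvg_proj k n (M : T -> 'M[R]_(k, n)) A : mxcvg M A -> row_free A ->
  mxcvg (fun t => proj (M t)) (proj A).
Proof.
move=> h fA; apply: mxcvgM => //; apply: mxcvgM; first exact: mxcvg_tr.
by apply: mxcvg_inv; [exact: mxcvg_gram | rewrite gram_unit].
Qed.

(** Only the row spaces of the W t matter, so it is enough to know some vectors
   of them that converge to independent ones. *)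
Lemma mxcvg_span k n (D W : T -> 'M[R]_(k, n)) A :
  (\forall t \near F, (D t <= W t)%MS) -> mxcvg D A -> row_free A ->
  (\forall t \near F, row_free (W t)) /\ mxcvg (fun t => proj (W t)) (proj A).
Proof.
move=> DW h fA; have Df := near_row_free h fA; split.
  by apply: filterS2 DW Df => t s f; case: (row_free_sub f s (leqnn k)).
apply: mxcvg_eq (mxcvg_proj h fA).
by apply: filterS2 DW Df => t ? ?; exact: proj_eqspan.
Qed.

(** The pairs M, M' of increments h whose difference quotients converge. The
   limit of the quotient of a function of M is then the same for every such
   pair, whence one formula for discrete and for continuous derivatives. *)
Definition strict_diff (h : T -> R) m n (M M' : T -> 'M[R]_(m, n)) A A' : Prop :=
  [/\ mxcvg M A, mxcvg M' A & mxcvg (fun t => (h t)^-1 *: (M' t - M t)) A'].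

Context (h : T -> R).

Lemma strict_diff_cst m n (A : 'M[R]_(m, n)) : strict_diff h (fun=> A) (fun=> A) A 0.
Proof.
split; try exact: mxcvg_cst.
by under eq_fun do rewrite subrr scaler0; exact: mxcvg_cst.
Qed.

Lemma strict_diffB m n (M M' N N' : T -> 'M[R]_(m, n)) A A' B B' :
  strict_diff h M M' A A' -> strict_diff h N N' B B' ->
  strict_diff h (fun t => M t - N t) (fun t => M' t - N' t) (A - B) (A' - B').
Proof.
move=> [h1 h2 h3] [k1 k2 k3]; split; try exact: mxcvgB.
apply: mxcvg_eq (mxcvgB h3 k3); apply: nearW => t.
by apply/matrixP => i j; rewrite !mxE; ring.
Qed.

Lemma strict_diffM m n p (M M' : T -> 'M[R]_(m, n)) (N N' : T -> 'M[R]_(n, p)) A A' B B' :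
  strict_diff h M M' A A' -> strict_diff h N N' B B' ->
  strict_diff h (fun t => M t *m N t) (fun t => M' t *m N' t)
    (A *m B) (A' *m B + A *m B').
Proof.
move=> [h1 h2 h3] [k1 k2 k3]; split; try exact: mxcvgM.
apply: mxcvg_eq (mxcvgD (mxcvgM h3 k2) (mxcvgM h1 k3)); apply: nearW => t.
by rewrite -scalemxAl -scalemxAr -scalerDr mulmxBl mulmxBr addrA subrK.
Qed.

Lemma strict_diff_tr m n (M M' : T -> 'M[R]_(m, n)) A A' :
  strict_diff h M M' A A' ->
  strict_diff h (fun t => (M t)^T) (fun t => (M' t)^T) A^T A'^T.
Proof.
move=> [h1 h2 h3]; split; try exact: mxcvg_tr.
apply: mxcvg_eq (mxcvg_tr h3); apply: nearW => t.
by rewrite linearZ /= linearB.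
Qed.

(** M'^-1 - M^-1 = - M'^-1 (M' - M) M^-1. *)
Lemma strict_diff_inv n (M M' : T -> 'M[R]_n) A A' :
  strict_diff h M M' A A' -> A \in unitmx ->
  strict_diff h (fun t => invmx (M t)) (fun t => invmx (M' t)) (invmx A)
    (- (invmx A *m A' *m invmx A)).
Proof.
move=> [h1 h2 h3] Au; split; try exact: mxcvg_inv.
have Mu := near_unitmx h1 Au; have Mu' := near_unitmx h2 Au.
apply: mxcvg_eq (mxcvgN (mxcvgM (mxcvgM (mxcvg_inv h2 Au) h3) (mxcvg_inv h1 Au))).
apply: filterS2 Mu Mu' => t u u'.
rewrite -scalemxAr -scalemxAl -scalerN mulmxBr mulVmx // mulmxBl mul1mx.
by rewrite -(mulmxA _ (M t)) mulmxV // mulmx1 opprB.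
Qed.

(** The derivative of proj at A in the direction A', by the product rule. *)
Definition dproj k n (A A' : 'M[R]_(k, n)) : 'M[R]_n :=
  (A'^T *m invmx (gram A) +
   A^T *m - (invmx (gram A) *m (A' *m A^T + A *m A'^T) *m invmx (gram A))) *m A
  + A^T *m invmx (gram A) *m A'.

Lemma strict_diff_proj k n (M M' : T -> 'M[R]_(k, n)) A A' :
  strict_diff h M M' A A' -> row_free A ->
  strict_diff h (fun t => proj (M t)) (fun t => proj (M' t)) (proj A) (dproj A A').
Proof.
move=> d fA; apply: strict_diffM => //; apply: strict_diffM; first exact: strict_diff_tr.
apply: strict_diff_inv; last by rewrite gram_unit.
by apply: strict_diffM => //; exact: strict_diff_tr.
Qed.

Definition dnproj (full : bool) k l n (A A' : 'M[R]_(k, n)) (B B' : 'M[R]_(l, n)) :=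
  (if full then 0 else dproj A A') - dproj B B'.

Lemma strict_diff_nproj full k l n (M M' : T -> 'M[R]_(k, n)) A A'
    (N N' : T -> 'M[R]_(l, n)) B B' :
  strict_diff h M M' A A' -> strict_diff h N N' B B' ->
  (~~ full -> row_free A) -> row_free B ->
  strict_diff h (fun t => nproj full (M t) (N t)) (fun t => nproj full (M' t) (N' t))
    (nproj full A B) (dnproj full A A' B B').
Proof.
move=> dM dN fA fB; apply: strict_diffB; last exact: strict_diff_proj.
case: full fA => fA; first exact: strict_diff_cst.
exact: (strict_diff_proj dM (fA isT)).
Qed.

Lemma cvg_mxcvg m n (M : T -> 'M[R]_(m, n)) (A : 'M[R]_(m, n)) : M @ F --> A -> mxcvg M A.
Proof.
move=> cM i j; apply: (cvg_comp M (fun B : 'M[R]_(m, n) => B i j) cM).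
exact: coord_continuous.
Qed.

Lemma mxcvg_cvg m n (M : T -> 'M[R]_(m, n)) (A : 'M[R]_(m, n)) : mxcvg M A -> M @ F --> A.
Proof.
move=> cM U [P nP PU].
apply: (@filterS _ _ _ [set t | forall i j, P i j (M t i j)]); first by move=> t ?; exact: PU.
do 2 apply: filter_forall => ?; exact: cM (nP _ _).
Qed.

Definition mxclose m n (e : R) (A B : 'M[R]_(m, n)) : Prop :=
  forall i j, `|A i j - B i j| <= e.

Lemma mxcvg_close m n (M : T -> 'M[R]_(m, n)) A e : mxcvg M A -> 0 < e ->
  \forall t \near F, mxclose e (M t) A.
Proof.
move=> cM e0; apply: filter_forall => i; apply: filter_forall => j.
by have /cvgrPdist_le/(_ e e0) := cM i j; apply: filterS => t; rewrite distrC.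
Qed.

End MatrixLimits.

Section Close.
Context {R : realType}.

Lemma mxclose_trans m n (e e' : R) (A B C : 'M[R]_(m, n)) :
  mxclose e A B -> mxclose e' B C -> mxclose (e + e') A C.
Proof.
move=> h k i j; apply: le_trans (lerD (h i j) (k i j)).
by apply: le_trans (ler_normD _ _); rewrite addrA subrK.
Qed.

Lemma mxclose_sym m n (e : R) (A B : 'M[R]_(m, n)) : mxclose e A B -> mxclose e B A.
Proof. by move=> h i j; rewrite distrC. Qed.

Lemma mxclose_le m n (e e' : R) (A B : 'M[R]_(m, n)) : e <= e' ->
  mxclose e A B -> mxclose e' A B.
Proof. by move=> ee h i j; exact: le_trans (h i j) ee. Qed.

Lemma mxclose_refl m n (e : R) (A : 'M[R]_(m, n)) : 0 <= e -> mxclose e A A.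
Proof. by move=> e0 i j; rewrite subrr normr0. Qed.

Lemma mxcloseB m n (e e' : R) (A A' B B' : 'M[R]_(m, n)) :
  mxclose e A A' -> mxclose e' B B' -> mxclose (e + e') (A - B) (A' - B').
Proof.
move=> h k i j; rewrite !mxE opprB.
apply: le_trans (lerD (h i j) (k i j)); rewrite (distrC (B i j)).
rewrite [X in `|X| <= _](_ : _ = (A i j - A' i j) + (B' i j - B i j)); last by ring.
exact: ler_normD.
Qed.

Lemma frob2_close m n (e : R) (A B : 'M[R]_(m, n)) : mxclose e A B ->
  frob2 (A - B) <= (m * n)%:R * e ^+ 2.
Proof.
move=> h; have -> : (m * n)%:R * e ^+ 2 = \sum_(i < m) \sum_(j < n) e ^+ 2.
  by rewrite !sumr_const !card_ord -mulrnA mulr_natl mulnC.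
apply: ler_sum => i _; apply: ler_sum => j _; rewrite !mxE -(real_normK (num_real _)).
by rewrite ler_pXn2r ?nnegrE //; apply: le_trans (h i j).
Qed.

End Close.

(** * Lengths of curves *)

Section Lengths.
Context {R : realType}.

(** L plays the part of an arclength: its increments dominate the distances, and
   along a partition they telescope. *)
Lemma partition_sum_le (T : Type) (d : T -> T -> R) (g : R -> T) (L : R -> R) a b s :
  (forall x y, a <= x -> x <= y -> y <= b -> d (g x) (g y) <= L y - L x) ->
  itv_partition a b s ->
  \sum_(0 <= k < size s) d (g (nth b (a :: s) k)) (g (nth b (a :: s) k.+1)) <= L b - L a.
Proof.
elim: s a => [|x s IH] a hd hp.
  by rewrite big_nil (itv_partition_nil hp) subrr.
have hp' := itv_partition_cons hp.
have ax : a <= x by case: hp => /= /andP[/ltW].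
have xb : x <= b := itv_partition_le hp'.
have h1 := hd a x (lexx a) ax xb.
have h2 : \sum_(0 <= k < size s)
    d (g (nth b (x :: s) k)) (g (nth b (x :: s) k.+1)) <= L b - L x.
  by apply: IH hp' => u v xu; apply: hd; exact: le_trans xu.
by rewrite big_nat_recl //=; lra.
Qed.

Lemma curve_length_le (T : Type) (d : T -> T -> R) (g : R -> T) (L : R -> R) a b :
  (forall x y, a <= x -> x <= y -> y <= b -> d (g x) (g y) <= L y - L x) ->
  (curve_length d a b g <= (L b - L a)%:E)%E.
Proof.
move=> hd; rewrite /curve_length; apply/ge_ereal_sup => x [s hs <-].
by rewrite lee_fin; exact: (partition_sum_le hd hs).
Qed.

Lemma curve_length_chord (T : Type) (d : T -> T -> R) (g : R -> T) a b : a < b ->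
  ((d (g a) (g b))%:E <= curve_length d a b g)%E.
Proof.
move=> ab; rewrite /curve_length; apply: ereal_sup_ubound => /=; exists [:: b]; first exact: (itv_partition1 ab).
by rewrite /= big_nat1.
Qed.

End Lengths.

(** * The distance of the projective space *)

Section ProjectiveDistance.
Context {R : realType} {n : nat}.
Implicit Types x y z : 'rV[R]_n.

Lemma dot_unit y z : dot y y = 1 -> dot z z = 1 -> -1 <= dot y z <= 1.
Proof.
move=> y1 z1; have := cauchy_schwarz y z; rewrite y1 z1 mulr1 => h.
by rewrite -ler_norml -(@ler_pXn2r _ 2) ?nnegrE // expr1n real_normK ?num_real.
Qed.

Lemma ler_cos (u v : R) : 0 <= u <= pi -> 0 <= v <= pi -> (cos u <= cos v) = (v <= u).
Proof. by move=> hu hv; rewrite !leNgt ltr_cos. Qed.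

Lemma ler_acos (u v : R) : -1 <= u -> u <= v -> v <= 1 -> acos v <= acos u.
Proof.
move=> u1 uv v1.
have bu : -1 <= u <= 1 by rewrite u1 (le_trans uv).
have bv : -1 <= v <= 1 by rewrite v1 (le_trans u1).
rewrite -ler_cos ?acos_ge0 ?acos_lepi //.
by rewrite !acosK.
Qed.

(** The nearer of z and - z has a nonnegative product with y. *)
Lemma rp_distE y z : dot y y = 1 -> dot z z = 1 -> rp_dist y z = acos `|dot y z|.
Proof.
move=> y1 z1; have /andP[h1 h2] := dot_unit y1 z1.
rewrite /rp_dist /sphere_dist dotNr; have [d0|d0] := leP 0 (dot y z).
  by rewrite ger0_norm //; apply/min_idPl; apply: ler_acos; lra.
by rewrite ltr0_norm //; apply/min_idPr; apply: ler_acos; lra.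
Qed.

Lemma rp_distC y z : dot y y = 1 -> dot z z = 1 -> rp_dist y z = rp_dist z y.
Proof. by move=> y1 z1; rewrite !rp_distE // dotC. Qed.

Lemma rp_dist_xx y : dot y y = 1 -> rp_dist y y = 0.
Proof. by move=> y1; rewrite rp_distE // y1 normr1 acos1. Qed.

Lemma norm_dot_unit y z : dot y y = 1 -> dot z z = 1 -> -1 <= `|dot y z| <= 1.
Proof.
move=> y1 z1; have /andP[h1 h2] := dot_unit y1 z1; apply/andP; split.
  by apply: le_trans (normr_ge0 _); lra.
by rewrite ler_norml h1 h2.
Qed.

Lemma rp_dist_ge0 y z : dot y y = 1 -> dot z z = 1 -> 0 <= rp_dist y z.
Proof. by move=> y1 z1; rewrite rp_distE // acos_ge0 // norm_dot_unit. Qed.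

Lemma cos_rp_dist y z : dot y y = 1 -> dot z z = 1 -> cos (rp_dist y z) = `|dot y z|.
Proof. by move=> y1 z1; rewrite rp_distE // acosK // in_itv /= norm_dot_unit. Qed.

Lemma rp_dist_le_pi2 y z : dot y y = 1 -> dot z z = 1 -> rp_dist y z <= pi / 2.
Proof.
move=> y1 z1; rewrite rp_distE // -acos0.
have /andP[h1 h2] := norm_dot_unit y1 z1.
by apply: ler_acos => //; lra.
Qed.

Lemma sin_rp_dist_ge0 y z : dot y y = 1 -> dot z z = 1 -> 0 <= sin (rp_dist y z).
Proof.
move=> y1 z1; apply: sin_ge0_pi; rewrite rp_dist_ge0 //=.
by apply: le_trans (rp_dist_le_pi2 y1 z1) _; have := pi_gt0 R; lra.
Qed.

Lemma frob2_rp_dist y z : dot y y = 1 -> dot z z = 1 ->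
  frob2 (y^T *m y - z^T *m z) = 2 * sin (rp_dist y z) ^+ 2.
Proof.
move=> y1 z1; rewrite frob2_rank1B // sin2cos2 cos_rp_dist //.
by rewrite real_normK ?num_real.
Qed.

(** By the mean value theorem, as cos decreases on [0, pi / 2]. *)
Lemma sin_le_id (d : R) : 0 <= d -> d <= pi / 2 -> d * cos d <= sin d <= d.
Proof.
rewrite le_eqVlt => /predU1P[<-|d0] dpi; first by rewrite mul0r sin0 lexx.
have [u /= hu] : exists2 u, u \in `]0, d[ & sin d - sin 0 = cos u * (d - 0).
  by apply: (@MVT R sin cos 0 d) => //; exact/continuous_subspaceT/continuous_sin.
rewrite sin0 !subr0 => ->; move: hu; rewrite in_itv /= => /andP[u0 ud].
rewrite mulrC; apply/andP; split; last first.
  by rewrite ger_pMl // cos_le1.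
rewrite ler_pM2r // ler_cos; have := pi_gt0 R; lra.
Qed.

(** If sin d ^ 2 <= 1 / 2 then d is at most sqrt 2 times sin d. *)
Lemma rp_dist_le_frob y z : dot y y = 1 -> dot z z = 1 ->
  frob2 (y^T *m y - z^T *m z) <= 1 ->
  rp_dist y z ^+ 2 <= 2 * frob2 (y^T *m y - z^T *m z).
Proof.
move=> y1 z1; rewrite frob2_rp_dist //; set d := rp_dist y z => hs.
have d0 : 0 <= d := rp_dist_ge0 y1 z1.
have /andP[h1 h2] := sin_le_id d0 (rp_dist_le_pi2 y1 z1).
have c0 : 0 <= cos d by rewrite cos_rp_dist.
have s0 : 0 <= sin d := sin_rp_dist_ge0 y1 z1.
move: hs h1 h2 c0 s0 (cos2Dsin2 d); move: (sin d) (cos d) => s c hs h1 h2 c0 s0 hcs.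
have h3 : (d * c) ^+ 2 <= s ^+ 2 by rewrite ler_pXn2r ?nnegrE // mulr_ge0.
rewrite exprMn in h3; have h4 : 1 / 2 <= c ^+ 2 by lra.
have h5 : d ^+ 2 * (1/2) <= d ^+ 2 * c ^+ 2 by rewrite ler_wpM2l ?sqr_ge0.
have := sqr_ge0 s; lra.
Qed.

(** The Cauchy-Schwarz inequality for the parts of x and z orthogonal to y bounds
   dot x z from below by the cosine of the sum of the two angles. *)
Lemma sphere_triangle x y z : dot x x = 1 -> dot y y = 1 -> dot z z = 1 ->
  acos (dot x z) <= acos (dot x y) + acos (dot y z).
Proof.
move=> x1 y1 z1.
have bxz := dot_unit x1 z1; have bxy := dot_unit x1 y1; have byz := dot_unit y1 z1.
have [h|h] := leP pi (acos (dot x y) + acos (dot y z)).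
  by apply: le_trans h; exact: acos_lepi.
rewrite -[leRHS]cosK; last first.
  by rewrite in_itv /= addr_ge0 ?acos_ge0 //= ltW.
apply: ler_acos; [exact: cos_geN1| |by case/andP: bxz].
rewrite cosD !acosK ?in_itv //= !sin_acos //.
set p := dot x y; set q := dot y z.
have := cauchy_schwarz (x - p *: y) (z - q *: y).
rewrite !(dotDl, dotDr, dotZl, dotZr, dotNl, dotNr) x1 y1 z1 (dotC y x) (dotC z y) -/p -/q.
set r := dot x z.
rewrite [X in X ^+ 2](_ : _ = r - p * q); last by ring.
rewrite [X in _ <= X * _](_ : _ = 1 - p ^+ 2); last by ring.
rewrite [X in _ <= _ * X](_ : _ = 1 - q ^+ 2); last by ring.
move=> hcs; rewrite lerBlDr -lerBlDl.
have p2 : 0 <= 1 - p ^+ 2.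
  by rewrite subr_ge0 -real_normK ?num_real // expr_le1 // ler_norml.
have q2 : 0 <= 1 - q ^+ 2.
  by rewrite subr_ge0 -real_normK ?num_real // expr_le1 // ler_norml.
apply: le_trans (ler_norm _) _.
rewrite -(@ler_pXn2r _ 2) ?nnegrE ?mulr_ge0 ?sqrtr_ge0 //.
by rewrite exprMn !sqr_sqrtr // real_normK ?num_real // -sqrrN opprB.
Qed.

Definition flip (b : bool) y := if b then y else - y.

Lemma dot_flip b y : dot (flip b y) (flip b y) = dot y y.
Proof. by case: b; rewrite //= dotNl dotNr opprK. Qed.

Lemma flip_dot y z : exists b, dot y (flip b z) = `|dot y z|.
Proof.
have [h|h] := leP 0 (dot y z); first by exists true; rewrite ger0_norm.
by exists false; rewrite /= dotNr ltr0_norm.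
Qed.

Lemma norm_flip_dotr b y z : `|dot y (flip b z)| = `|dot y z|.
Proof. by case: b => //=; rewrite dotNr normrN. Qed.

Lemma norm_flip_dotl b y z : `|dot (flip b y) z| = `|dot y z|.
Proof. by rewrite dotC norm_flip_dotr dotC. Qed.

(** Signs can be chosen successively so that the two distances on the right are
   those of the sphere. *)
Lemma rp_triangle x y z : dot x x = 1 -> dot y y = 1 -> dot z z = 1 ->
  rp_dist x z <= rp_dist x y + rp_dist y z.
Proof.
move=> x1 y1 z1; rewrite !rp_distE //.
have [b hb] := flip_dot x y; have [b' hb'] := flip_dot (flip b y) z.
rewrite -hb -(norm_flip_dotl b y z) -hb'.
apply: le_trans (sphere_triangle x1 _ _); rewrite ?dot_flip //.
have /andP[? ?] : -1 <= dot x (flip b' z) <= 1 by rewrite dot_unit ?dot_flip.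
rewrite -(norm_flip_dotr b' x z); apply: ler_acos => //; first exact: ler_norm.
by rewrite ler_norml; apply/andP.
Qed.

(** A minimal arc in terms of a unit vector u tangent to it at y. *)
Lemma rp_arcE y z : dot y y = 1 -> dot z z = 1 ->
  exists u b, [/\ rp_dist y z = 0 \/ dot u u = 1, dot y u = 0,
    forall t, rp_arc y z t = cos (t * rp_dist y z) *: y + sin (t * rp_dist y z) *: u &
    rp_arc y z 1 = flip b z].
Proof.
move=> y1 z1; rewrite /rp_arc.
have bN : dot (- z) (- z) = 1 by rewrite dotNl dotNr opprK.
have [b [E1 E2]] : exists b, (if sphere_dist y z <= sphere_dist y (- z) then z else - z)
    = flip b z /\ sphere_dist y (flip b z) = rp_dist y z.
  rewrite /rp_dist; case: leP => h; [exists true | exists false] => //=.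
rewrite E1 E2; set th := rp_dist y z; set z' := flip b z.
have z'1 : dot z' z' = 1 by rewrite dot_flip.
have cth : dot y z' = cos th.
  by rewrite /th -E2 /sphere_dist acosK // in_itv /= dot_unit.
have [th0|th0] := eqVneq th 0.
  exists 0, b; split=> //; first by left.
  - by rewrite dotC /dot mul0mx mxE.
  - by move=> t; rewrite th0 mulr0 cos0 sin0 scale1r scaler0 addr0.
  - have : dot (y - z') (y - z') = 0.
      by rewrite !(dotDl, dotDr, dotNl, dotNr) (dotC z') cth y1 z'1 th0 cos0; lra.
    by move/eqP; rewrite dot_eq0 subr_eq0 => /eqP.
have s0 : 0 < sin th.
  apply: sin_gt0_pi; rewrite lt0r th0 rp_dist_ge0 //=.
  by apply: le_lt_trans (rp_dist_le_pi2 y1 z1) _; have := pi_gt0 R; lra.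
have sn0 : sin th != 0 by rewrite gt_eqF.
pose u := (sin th)^-1 *: (z' - cos th *: y).
exists u, b; split.
- right; rewrite /u !(dotDl, dotDr, dotZl, dotZr, dotNl, dotNr) (dotC z') cth y1 z'1.
  rewrite [LHS](_ : _ = (sin th)^-1 ^+ 2 * (1 - cos th ^+ 2)); last by ring.
  by rewrite -sin2cos2 -exprMn mulVf // expr1n.
- rewrite /u !(dotDl, dotDr, dotZl, dotZr, dotNl, dotNr) cth y1; ring.
- move=> t; rewrite mulrBl mul1r sinB /u.
  apply/rowP => i; rewrite !mxE; field; exact: sn0.
- rewrite subrr mul0r sin0 scale0r add0r mul1r scalerA mulVf // scale1r //.
Qed.

Lemma rp_arc0 y z : dot y y = 1 -> dot z z = 1 -> rp_arc y z 0 = y.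
Proof.
move=> y1 z1; have [u [b [_ _ E _]]] := rp_arcE y1 z1.
by rewrite E mul0r cos0 sin0 scale1r scale0r addr0.
Qed.

Lemma dot_rp_arc y z s t : dot y y = 1 -> dot z z = 1 ->
  dot (rp_arc y z s) (rp_arc y z t) = cos ((t - s) * rp_dist y z).
Proof.
move=> y1 z1; have [u [b [h yu E _]]] := rp_arcE y1 z1; rewrite !E.
rewrite !(dotDl, dotDr, dotZl, dotZr) (dotC u y) yu y1 mulrBl cosB.
case: h => [->|->]; last by ring.
by rewrite !mulr0 sin0; ring.
Qed.

Lemma rp_arc_unit y z t : dot y y = 1 -> dot z z = 1 ->
  dot (rp_arc y z t) (rp_arc y z t) = 1.
Proof. by move=> y1 z1; rewrite dot_rp_arc // subrr mul0r cos0. Qed.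

Lemma rp_dist_arc y z s t : dot y y = 1 -> dot z z = 1 -> 0 <= s -> s <= t -> t <= 1 ->
  rp_dist (rp_arc y z s) (rp_arc y z t) <= (t - s) * rp_dist y z.
Proof.
move=> y1 z1 s0 st t1; rewrite {1}/rp_dist ge_min; apply/orP; left.
have d0 := rp_dist_ge0 y1 z1; have d1 := rp_dist_le_pi2 y1 z1; have pi0 := pi_gt0 R.
rewrite /sphere_dist dot_rp_arc // cosK // in_itv /= mulr_ge0 ?subr_ge0 //=.
by apply: (@le_trans _ _ (1 * rp_dist y z)); [apply: ler_wpM2r => //; lra | lra].
Qed.

Section ProjectivePolygonal.
Variable w : nat -> 'rV[R]_n.
Hypothesis w1 : forall k, dot (w k) (w k) = 1.

Definition geodesic_polygonal (t : R) : 'rV[R]_n :=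
  let i := Num.truncn t in rp_arc (w i) (w i.+1) (t - i%:R).

Let th k := rp_dist (w k) (w k.+1).
(* the length of the polygonal up to time t *)
Let L (t : R) : R := \sum_(k < Num.truncn t) th k
  + (t - (Num.truncn t)%:R) * th (Num.truncn t).

Lemma rp_chain p q : (p <= q)%N -> rp_dist (w p) (w q) <= \sum_(p <= k < q) th k.
Proof.
move=> pq; rewrite -(subnKC pq); elim: (q - p)%N => [|m IH].
  by rewrite addn0 big_geq // rp_dist_xx.
rewrite addnS big_nat_recr ?leq_addr //=.
by apply: le_trans (rp_triangle (w1 _) (w1 (p + m)) (w1 _)) _; rewrite lerD2r.
Qed.

Lemma geodesic_polygonal_dist s t : 0 <= s -> s <= t ->
  rp_dist (geodesic_polygonal s) (geodesic_polygonal t) <= L t - L s.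
Proof.
move=> s0 st; have t0 := le_trans s0 st.
rewrite /geodesic_polygonal /L /=.
have /andP[hs1 hs2] := truncn_itv s0; have /andP[ht1 ht2] := truncn_itv t0.
set p := Num.truncn s in hs1 hs2 *; set q := Num.truncn t in ht1 ht2 *.
rewrite -natr1 in hs2; rewrite -natr1 in ht2.
have pq : (p <= q)%N.
  by rewrite -ltnS -(ltr_nat R) -natr1; lra.
have ths := rp_dist_ge0.
move: pq; rewrite leq_eqVlt => /predU1P[pq|pq].
  rewrite -pq in ht1 ht2 *; apply: le_trans (rp_dist_arc _ _ _ _ _) _ => //; try lra.
  by rewrite -/(th p); lra.
have Ep : rp_dist (rp_arc (w p) (w p.+1) (s - p%:R)) (w p.+1) <= (1 - (s - p%:R)) * th p.
  have [u [b [_ _ _ E]]] := rp_arcE (w1 p) (w1 p.+1).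
  have := rp_dist_arc (w1 p) (w1 p.+1) (_ : 0 <= s - p%:R) (_ : s - p%:R <= 1) (lexx 1).
  rewrite E -/(th p) => h; apply: le_trans (h _ _); try lra.
  by rewrite !rp_distE ?dot_flip ?rp_arc_unit // norm_flip_dotr.
have Eq : rp_dist (w q) (rp_arc (w q) (w q.+1) (t - q%:R)) <= (t - q%:R) * th q.
  rewrite -{1}(rp_arc0 (w1 q) (w1 q.+1)) -[X in X * _]subr0.
  by apply: rp_dist_arc => //; rewrite ?subr0; lra.
have Em := rp_chain pq.
apply: le_trans (rp_triangle _ (w1 p.+1) _) _; rewrite ?rp_arc_unit //.
apply: le_trans (lerD Ep (rp_triangle (w1 _) (w1 q) _)) _; rewrite ?rp_arc_unit //.
have -> : \sum_(k < q) th k = \sum_(k < p) th k + th p + \sum_(p.+1 <= k < q) th k.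
  rewrite -(big_mkord xpredT th) (big_cat_nat _ pq) //=.
  by rewrite big_nat_recr //= big_mkord.
by rewrite -/(th p); lra.
Qed.

(** The integer times give one partition that attains the sum; no partition exceeds
   it, by geodesic_polygonal_dist. *)
Lemma geodesic_polygonal_length K :
  curve_length (@rp_dist R n) 0 K%:R geodesic_polygonal =
  (\sum_(k < K) rp_dist (w k) (w k.+1))%:E.
Proof.
have LE : L K%:R - L 0 = \sum_(k < K) rp_dist (w k) (w k.+1).
  rewrite /L !truncn0 natrK.
  by rewrite subrr mul0r big_ord0 subr0 mul0r !addr0 subr0.
apply/eqP; rewrite eq_le; apply/andP; split.
  rewrite -LE; apply: curve_length_le => x y x0 xy _.
  exact: geodesic_polygonal_dist.
rewrite /curve_length; apply: ereal_sup_ubound => /=; exists [seq (k%:R : R) | k <- iota 1 K].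
  split.
    rewrite -[X in path _ X](_ : 0%:R = _) //; clear LE.
    by elim: K 0%N => // K IH m /=; rewrite ltr_nat ltnSn /=; exact: IH.
  rewrite -[X in last X](_ : 0%:R = _) // (last_map (fun k => k%:R)).
  suff -> : last 0%N (iota 1 K) = K by [].
  rewrite -[RHS]add0n; clear LE.
  by elim: K 0%N => [|K IH] m /=; rewrite ?addn0 // IH addSnnS.
rewrite size_map size_iota; congr (_%:E); rewrite big_mkord; apply: eq_bigr => k _.
have E i : (i <= K)%N -> nth K%:R (0 :: [seq (k%:R : R) | k <- iota 1 K]) i = i%:R.
  case: i => //= i iK; rewrite (nth_map 0%N) ?size_iota // nth_iota //.
have E' := E k.+1 (ltn_ord k); rewrite /= in E'.
rewrite (E k (ltnW (ltn_ord k))) E'.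
by rewrite /geodesic_polygonal !natrK !subrr !rp_arc0.
Qed.

End ProjectivePolygonal.

End ProjectiveDistance.

(** * Discrete normals of polygonals with independent windows *)

Section Windows.
Context {R : realType} {N : nat}.
Implicit Types (P : seq 'rV[R]_N.+1).

Lemma row_free_row_neq0 k n (M : 'M[R]_(k, n)) i : row_free M -> row i M != 0.
Proof.
move=> fM; apply/eqP => h.
have : delta_mx 0 i *m M = 0 *m M :> 'rV_n by rewrite -rowE h mul0mx.
move=> /(row_free_inj fM) /rowP/(_ i); rewrite !mxE !eqxx => /eqP.
by rewrite oner_eq0.
Qed.

Lemma row_free_rowsub k l n (M : 'M[R]_(k, n)) (f : 'I_l -> 'I_k) :
  injective f -> row_free M -> row_free (rowsub f M).
Proof.
move=> fI fM; rewrite -kermx_eq0; apply/eqP; apply/row_matrixP => i; rewrite row0.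
set x := row i _.
have xM : x *m rowsub f M = 0 by rewrite /x -row_mul mulmx_ker row0.
pose y : 'rV[R]_k := \sum_a x 0 a *: delta_mx 0 (f a).
have : y *m M = 0 *m M.
  rewrite mul0mx -[RHS]xM (mulmx_sum_row x) /y mulmx_suml; apply: eq_bigr => a _.
  by rewrite -scalemxAl -rowE row_rowsub.
move=> /(row_free_inj fM) y0; apply/rowP => a; rewrite mxE.
have := congr1 (fun v : 'rV[R]_k => v 0 (f a)) y0.
rewrite mxE /y summxE (bigD1 a) //= big1 ?addr0 => [|b ba].
  by rewrite !mxE !eqxx mulr1.
by rewrite !mxE (inj_eq fI) eq_sym (negbTE ba) mulr0.
Qed.

Definition segmx P k i : 'M[R]_(k, N.+1) := \matrix_(a < k) segment P (i + a).

Lemma segmx_sub P k i k' i' : (i <= i')%N -> (i' + k' <= i + k)%N ->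
  exists2 f : 'I_k' -> 'I_k, injective f & segmx P k' i' = rowsub f (segmx P k i).
Proof.
move=> ii kk; have hf (a : 'I_k') : (i' - i + a < k)%N by have := ltn_ord a; lia.
exists (fun a => Ordinal (hf a)).
  by move=> a b [] /addnI /val_inj.
apply/matrixP => a l; rewrite !mxE /=; by rewrite addnA subnKC.
Qed.

Lemma segmx_free P k i k' i' : (i <= i')%N -> (i' + k' <= i + k)%N ->
  row_free (segmx P k i) -> row_free (segmx P k' i').
Proof. by move=> ii kk; have [f fI ->] := segmx_sub P ii kk; exact: row_free_rowsub. Qed.

Lemma segmx_submx P k i k' i' : (i <= i')%N -> (i' + k' <= i + k)%N ->
  (segmx P k' i' <= segmx P k i)%MS.
Proof.
move=> ii kk; have [f fI ->] := segmx_sub P ii kk.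
by apply/row_subP => a; rewrite row_rowsub row_sub.
Qed.

Section OpenPolygonal.
Variables (j r : nat) (P : seq 'rV[R]_N.+1).
Hypotheses (hN : (3 <= N)%N) (hj : (1 <= j <= N)%N) (hr : r = (npicks N j).+1).
Hypothesis open : ~~ closed_polygonal P.
Hypothesis rP : (r <= nseg P)%N.
Hypothesis freeP_ : forall i, (i + r <= nseg P)%N -> row_free (segmx P r i).

Let r2 : (2 <= r)%N. Proof. by rewrite hr /npicks; lia. Qed.

Lemma segment_neq0 h : (h < nseg P)%N -> segment P h != 0.
Proof.
move=> hh; pose i := minn h (nseg P - r)%N.
have f1 : row_free (segmx P r i) by apply: freeP_; rewrite /i; lia.
have f2 : row_free (segmx P 1 h) by apply: segmx_free f1; rewrite /i; lia.
have := row_free_row_neq0 0 f2; rewrite (_ : row _ _ = segment P h) //.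
by apply/rowP => l; rewrite !mxE addn0.
Qed.

Lemma dirE h : dir P h = (enorm (segment P h))^-1 *: segment P h.
Proof. by rewrite /dir (negbTE open). Qed.

Lemma nrm_neq0 h : (h < nseg P)%N -> (enorm (segment P h))^-1 != 0.
Proof. by move=> hh; rewrite invr_neq0 // enorm_eq0 segment_neq0. Qed.

Lemma segmentE h : (h < nseg P)%N -> segment P h = enorm (segment P h) *: dir P h.
Proof.
by move=> hh; rewrite dirE scalerA mulfV ?scale1r // enorm_eq0 segment_neq0.
Qed.

Lemma nth_dirs i k a : (a < k)%N -> [seq dir P l | l <- iota i k]`_a = dir P (i + a).
Proof. by move=> ak; rewrite (nth_map 0%N) ?size_iota // nth_iota. Qed.

(** Normalizing the sides rescales the coefficients of a linear relation. *)
Lemma free_dirs i k : (i + k <= nseg P)%N -> row_free (segmx P k i) ->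
  free [seq dir P l | l <- iota i k].
Proof.
move=> ik fM; have sz : size [seq dir P l | l <- iota i k] == k by rewrite size_map size_iota.
apply/(@freeP _ _ _ (Tuple sz)) => x hx a.
pose y : 'rV[R]_k := \row_a (x a * (enorm (segment P (i + a)))^-1).
have : y *m segmx P k i = 0 *m segmx P k i.
  rewrite mul0mx -[RHS]hx mulmx_sum_row; apply: eq_bigr => b _ /=.
  rewrite nth_dirs // dirE scalerA mxE; congr (_ *: _).
  by apply/rowP => l; rewrite !mxE.
move=> /(row_free_inj fM) /rowP/(_ a); rewrite !mxE => /eqP.
by rewrite mulf_eq0 (negbTE (nrm_neq0 _)) ?orbF; [move/eqP | have := ltn_ord a; lia].
Qed.

Lemma span_dirsP i k (w : 'rV[R]_N.+1) : (i + k <= nseg P)%N ->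
  (w \in <<[seq dir P l | l <- iota i k]>>%VS) = (w <= segmx P k i)%MS.
Proof.
move=> ik; apply/idP/idP => [hw|/submxP[D ->]].
  have sz : size [seq dir P l | l <- iota i k] == k by rewrite size_map size_iota.
  have -> := @coord_span _ _ _ (Tuple sz) w hw.
  apply: summx_sub => a _; apply: scalemx_sub => /=; rewrite nth_dirs // dirE.
  apply: scalemx_sub; rewrite (_ : segment P _ = row a (segmx P k i)) ?row_sub //.
  by apply/rowP => l; rewrite !mxE.
rewrite mulmx_sum_row memv_suml // => a _; rewrite memvZ //.
have -> : row a (segmx P k i) = segment P (i + a) by apply/rowP => l; rewrite !mxE.
have ia : (i + a < nseg P)%N by have := ltn_ord a; lia.
rewrite segmentE // memvZ // memv_span //; apply: map_f.
by rewrite mem_iota; have := ltn_ord a; lia.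
Qed.

Lemma ortho_dirsP i k (w : 'rV[R]_N.+1) : (i + k <= nseg P)%N ->
  (forall l, l \in iota i k -> dot w (dir P l) = 0) <-> w *m (segmx P k i)^T = 0.
Proof.
move=> ik; rewrite -row_mulmxtr0; split=> h.
  move=> a; have -> : row a (segmx P k i) = segment P (i + a) by apply/rowP => l; rewrite !mxE.
  have ak := ltn_ord a; rewrite segmentE; last by lia.
  by rewrite dotZr h ?mulr0 // mem_iota; lia.
move=> l; rewrite mem_iota => hl.
have hl' : (l - i < k)%N by lia.
rewrite dirE dotZr; have := h (Ordinal hl').
have -> : row (Ordinal hl') (segmx P k i) = segment P l.
  by apply/rowP => a; rewrite !mxE /= subnKC //; case/andP: hl.
by move=> ->; rewrite mulr0.
Qed.

(** When windows are free, each vector that is picked is the next side. *)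
Lemma pick_indices_free i k : (i + r <= nseg P)%N -> (k < r)%N ->
  pick_indices P i k = Some (iota i k.+1).
Proof.
move=> ir; elim: k => [//|k IH] kr /=; rewrite IH ?(ltnW kr) //.
have lE : last i (iota i k.+1) = (i + k)%N.
  rewrite -[k in RHS]/(k.+1.-1) /=.
  by elim: k {IH kr} i {ir} => [|k IH] i /=; rewrite ?addn0 // IH addSnnS.
have fr : free [seq dir P l | l <- iota i k.+2].
  by apply: free_dirs; [lia | apply: segmx_free (freeP_ ir); lia].
have rE : rcons (iota i k.+1) (i + k).+1 = iota i k.+2.
  by rewrite -cats1 -[in RHS](addn1 k.+1) iotaD /= addnS.
have -> : first_after P (last i (iota i k.+1)) (fun h =>
      if k is 0 then ~~ rp_eq (dir P h) (dir P i)
      else free [seq dir P l | l <- rcons (iota i k.+1) h]) = Some (i + k).+1.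
  rewrite /first_after lE.
  have : (0 < nseg P)%N by lia.
  case E : (nseg P) => [//|m] _ /=; rewrite -E ifT //.
  apply/andP; split; first by apply/orP; right; lia.
  case: k {IH kr lE} rE fr => [|k] rE fr; last by move: fr; rewrite -rE /=.
  rewrite addn0; apply/negP => h; move: fr; rewrite /= free_cons => /andP[/negP[]].
  have {}h : dir P i \in <[dir P i.+1]>%VS.
    move: h => /orP[/eqP ->|/eqP ->]; first exact: memv_line.
    by rewrite -[X in X \in _]opprK memvN memv_line.
  by rewrite span_seq1.
exact: (congr1 Some rE).
Qed.

Lemma first_after_gt l Q h : first_after P l Q = Some h -> (l < h < nseg P)%N.
Proof.
rewrite /first_after (negbTE open) /=.
set s := [seq _ <- _ | _] => hs.
have : h \in s by case: s hs => //= x s [<-]; rewrite inE eqxx.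
by rewrite mem_filter mem_iota => /andP[/andP[-> _]]; lia.
Qed.

Lemma pick_indices_last i k ls : pick_indices P i k = Some ls ->
  (i + k <= last i ls)%N /\ ((0 < k)%N -> (last i ls < nseg P)%N).
Proof.
elim: k ls => [|k IH] ls /=; first by case=> <- /=; rewrite addn0.
case E : (pick_indices P i k) => [ls'|] //; have [IH1 _] := IH _ E.
case E' : (first_after _ _ _) => [h|] //= [<-].
by have /andP[h1 h2] := first_after_gt E'; rewrite last_rcons; split=> //; lia.
Qed.

(** From there on there are too few sides left, and the normal is repeated. *)
Lemma normal_at_stop i : (nseg P - r <= i)%N -> normal_at j P i = normal_at j P (nseg P - r).
Proof.
move=> h; rewrite -(subnKC h); elim: (i - _)%N => [|m IH]; first by rewrite addn0.
rewrite addnS /=; case E : (pick_indices _ _ _) => [ls|]; last exact: IH.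
have [h1 h2] := pick_indices_last E.
have /h2 h3 : (0 < npicks N j)%N by rewrite /npicks; lia.
by move: h1 h3 rP; rewrite hr; lia.
Qed.

(** For j < N the normal lies in the span of the sides i, ..., i + j and is
   orthogonal to the last j of them; for j = N it is orthogonal to the sides
   i, ..., i + N - 1, whence the shift by the boolean j < N. *)
Definition window_nproj i :=
  nproj (N <= j)%N (segmx P j.+1 i) (segmx P j (i + (j < N))).

(** The unit normal is determined up to sign, and the sign disappears in the rank-one
   matrix. *)
Lemma normal_atP i : (i + r <= nseg P)%N ->
  dot (normal_at j P i) (normal_at j P i) = 1 /\
  (normal_at j P i)^T *m normal_at j P i = window_nproj i.
Proof.
move=> ir; have pk : pick_indices P i (npicks N j) = Some (iota i r).
  by rewrite hr pick_indices_free // hr.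
have -> : normal_at j P i = xget 0 (is_normal_at j P (iota i r)).
  by case: i ir pk => [|i] ir /= ->.
have fr := freeP_ ir.
have fB : row_free (segmx P j (i + (j < N))).
  by apply: segmx_free fr; move: hr; rewrite /npicks; lia.
have side : if (N <= j)%N then (j < N.+1)%N
    else row_free (segmx P j.+1 i) && (segmx P j (i + (j < N)) <= segmx P j.+1 i)%MS.
  have [jN|jN] := boolP (N <= j)%N; first by lia.
  apply/andP; split; last by apply: segmx_submx; lia.
  by apply: segmx_free fr; move: hr; rewrite /npicks; lia.
have isn w : is_normal_at j P (iota i r) w <->
    [/\ dot w w = 1, w *m (segmx P j (i + (j < N)))^T = 0
      & ~~ (N <= j)%N -> (w <= segmx P j.+1 i)%MS].
  rewrite /is_normal_at -ltnNge.
  have [jN|jN] := boolP (j < N)%N.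
    have rj : r = j.+1 by rewrite hr /npicks; lia.
    rewrite rj in ir *.
    rewrite span_dirsP // [behead _]/= addn1.
    have ij : (i.+1 + j <= nseg P)%N by lia.
    have [or1 or2] := @ortho_dirsP i.+1 j w ij.
    split=> [[/enorm1P ? [? ?]]|[? ? ?]]; first by split=> //; exact: or1.
    by split; [exact/enorm1P | split; [auto | exact: or2]].
  have rj : r = j by rewrite hr /npicks; lia.
  rewrite rj in ir *; rewrite addn0.
  have [or1 or2] := @ortho_dirsP i j w ir.
  split=> [[/enorm1P ? ?]|[? ? ?]]; first by split=> //; exact: or1.
  by split; [exact/enorm1P | exact: or2].
have [w0 hw0] := unit_normal_exists fB side.
have /isn[h1 h2 h3] : is_normal_at j P (iota i r) (xget 0 (is_normal_at j P (iota i r))).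
  by apply: (xgetI (P := is_normal_at j P (iota i r)) 0 (x := w0)); exact/isn.
split=> //; apply: rank1_nproj => //.
have [jN|jN] := boolP (N <= j)%N; first by case/andP: hj; lia.
by move: side; rewrite (negbTE jN) => /andP[_ ->]; rewrite h3.
Qed.

Lemma normal_at_unit i : dot (normal_at j P i) (normal_at j P i) = 1.
Proof.
have H k : (k <= nseg P - r)%N -> dot (normal_at j P k) (normal_at j P k) = 1.
  move=> hk; have kr : (k + r <= nseg P)%N by lia.
  by have [] := normal_atP kr.
have [h|h] := leqP i (nseg P - r); first exact: H.
by rewrite normal_at_stop ?(ltnW h) // H.
Qed.

Lemma discrete_normal_lengthE : discrete_normal_length j P =
  (\sum_(k < (nseg P).-1) rp_dist (normal_at j P k) (normal_at j P k.+1))%:E.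
Proof.
rewrite /discrete_normal_length /discrete_normal_end (negbTE open).
exact: (geodesic_polygonal_length normal_at_unit).
Qed.

Lemma has_normal : has_discrete_normal j P.
Proof.
move=> [p0 [W [dW hW]]].
have fr : row_free (segmx P r 0) by apply: freeP_.
have := @free_dirs 0 r rP fr; rewrite /free size_map size_iota => /eqP e.
have : (<<[seq dir P l | l <- iota 0 r]>> <= W)%VS.
  apply/span_subvP => v /mapP[l]; rewrite mem_iota => hl ->.
  rewrite dirE memvZ // /segment.
  have sP : (l.+1 < size P)%N by move: rP; rewrite /nseg; lia.
  rewrite (_ : _ - _ = (nth 0 P l.+1 - p0) - (nth 0 P l - p0)); last first.
    by rewrite opprB addrA subrK.
  rewrite memvB //; apply: hW; apply: mem_nth => //.
  exact: ltnW.
by move=> /dimvS; rewrite e hr => h; have := leq_trans dW h; rewrite ltnn.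
Qed.

Lemma polygonalP : polygonal P.
Proof. by split; [lia | exact: segment_neq0]. Qed.

End OpenPolygonal.
End Windows.

(** * Calculus within a closed interval *)

Section WithinCalculus.
Context {R : realType} (a b : R) (hab : a < b).
Implicit Types (f : R -> R) (t : R).

Lemma near_nbhsP t (P : R -> Prop) :
  (\forall u \near nbhs t, P u) <-> exists2 rho, 0 < rho & forall u, `|u - t| < rho -> P u.
Proof.
split=> [/nbhs_ballP[e /= e0 h]|[e e0 h]].
  by exists e => // u ut; apply: h; rewrite /ball /= distrC.
by apply/nbhs_ballP; exists e => //= u; rewrite /ball /= distrC => /h.
Qed.

Lemma near_withinP t (P : R -> Prop) :
  (\forall u \near within `[a, b] (nbhs t), P u) <->
  exists2 rho, 0 < rho & forall u, a <= u <= b -> `|u - t| < rho -> P u.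
Proof.
rewrite near_withinE near_nbhsP.
split=> -[rho r0 h]; exists rho => // u h1 h2.
  by apply: h => //=; rewrite in_itv.
by apply: h => //; move: h2; rewrite /= in_itv.
Qed.

Lemma near_punctP t (P : R -> Prop) :
  (\forall u \near within `[a, b] t^', P u) <->
  exists2 rho, 0 < rho & forall u, a <= u <= b -> u != t -> `|u - t| < rho -> P u.
Proof.
rewrite near_withinE /dnbhs near_withinE near_nbhsP.
split=> -[rho r0 h]; exists rho => // u.
  by move=> h1 h2 h3; apply: h => //=; rewrite in_itv.
by move=> h1 /= h2 h3; apply: h => //; move: h3; rewrite /= in_itv.
Qed.

Lemma punct_proper t : a <= t <= b -> ProperFilter (within `[a, b] t^').
Proof.
move=> tab; apply: Build_ProperFilter_ex => P /near_punctP[rho r0 h].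
have [tb|tb] := ltP t b.
  pose d := Num.min (rho / 2) (b - t); have d0 : 0 < d by rewrite lt_min subr_gt0 tb; lra.
  have [d1 d2] : d <= rho / 2 /\ d <= b - t by split; rewrite ge_min lexx ?orbT.
  exists (t + d); apply: h; first lra; first by rewrite gt_eqF //; lra.
  by rewrite addrAC subrr add0r gtr0_norm //; lra.
pose d := Num.min (rho / 2) (b - a); have d0 : 0 < d by rewrite lt_min subr_gt0 hab; lra.
have [d1 d2] : d <= rho / 2 /\ d <= b - a by split; rewrite ge_min lexx ?orbT.
exists (t - d); apply: h; first lra; first by rewrite lt_eqF //; lra.
by rewrite addrAC subrr add0r normrN gtr0_norm //; lra.
Qed.

(** The derivative within [a, b], by its first-order expansion. *)
Definition dwithin f t (l : R) : Prop := forall eps, 0 < eps ->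
  exists2 rho, 0 < rho & forall u, a <= u <= b -> `|u - t| < rho ->
    `|f u - f t - l * (u - t)| <= eps * `|u - t|.

Definition cwithin f t : Prop := forall eps, 0 < eps ->
  exists2 rho, 0 < rho & forall u, a <= u <= b -> `|u - t| < rho -> `|f u - f t| <= eps.

Lemma dwithinP f t l : ((fun u => (u - t)^-1 * (f u - f t)) @ within `[a, b] t^' --> l) <->
  dwithin f t l.
Proof.
split=> [h eps e0|h].
  have /cvgrPdist_le/(_ eps e0)/near_punctP[rho r0 hr] := h.
  exists rho => // u uab ut; have [->|ut0] := eqVneq u t.
    by rewrite !subrr mulr0 subr0 normr0 mulr0.
  have ut1 : u - t != 0 by rewrite subr_eq0.
  have -> : f u - f t - l * (u - t) = - (l - (u - t)^-1 * (f u - f t)) * (u - t).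
    by field.
  by rewrite normrM normrN ler_wpM2r // hr.
apply/cvgrPdist_le => eps e0; apply/near_punctP.
have [rho r0 hr] := h eps e0; exists rho => // u uab ut0 ut.
have ut1 : u - t != 0 by rewrite subr_eq0.
have -> : l - (u - t)^-1 * (f u - f t) = - (f u - f t - l * (u - t)) / (u - t).
  by field.
by rewrite normrM normrN normfV ler_pdivrMr ?normr_gt0 // hr.
Qed.

Lemma cwithinP f t : (f @ within `[a, b] (nbhs t) --> f t) <-> cwithin f t.
Proof.
split=> [h eps e0|h].
  have /cvgrPdist_le/(_ eps e0)/near_withinP[rho r0 hr] := h.
  by exists rho => // u uab ut; rewrite distrC hr.
apply/cvgrPdist_le => eps e0; apply/near_withinP.
by have [rho r0 hr] := h eps e0; exists rho => // u uab ut; rewrite distrC hr.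
Qed.

Lemma dwithin_cwithin f t l : dwithin f t l -> cwithin f t.
Proof.
move=> h eps e0; have [rho r0 hr] := h 1 ltr01.
have k0 : 0 < 1 + `|l| by rewrite ltr_wpDr.
exists (Num.min rho (eps / (1 + `|l|))); first by rewrite lt_min r0 divr_gt0.
move=> u uab; rewrite lt_min => /andP[u1 u2].
have -> : f u - f t = (f u - f t - l * (u - t)) + l * (u - t) by rewrite subrK.
apply: le_trans (ler_normD _ _) _; rewrite normrM.
apply: (@le_trans _ _ ((1 + `|l|) * `|u - t|)).
  by rewrite mulrDl lerD2r; exact: hr.
by rewrite mulrC -ler_pdivlMr //; exact: ltW.
Qed.

Lemma cwithin_interior f t eps : a < t < b -> cwithin f t -> 0 < eps ->
  exists2 rho, 0 < rho & forall u, `|u - t| < rho -> `|f u - f t| <= eps.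
Proof.
move=> /andP[at_ tb] h e0; have [rho r0 hr] := h eps e0.
exists (Num.min rho (Num.min (t - a) (b - t))).
  by rewrite !lt_min r0 !subr_gt0 at_.
move=> u; rewrite !lt_min => /andP[u1 /andP[]]; rewrite !ltr_norml => u2 u3.
by apply: hr => //; apply/andP; split; lra.
Qed.

Lemma cvg_is_derive f t (l : R) :
  (forall eps, 0 < eps -> exists2 rho, 0 < rho & forall u, `|u - t| < rho ->
    `|f u - f t - l * (u - t)| <= eps * `|u - t|) -> is_derive t 1 f l.
Proof.
move=> h.
have H : (fun k => k^-1 *: (f (k *: (1 : R) + t) - f t)) @ 0^' --> l.
  apply/cvgrPdist_le => eps e0; rewrite near_withinE; apply/near_nbhsP.
  have [rho r0 hr] := h eps e0; exists rho => // k; rewrite subr0 => kr /= k0.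
  have -> : l - k^-1 *: (f (k *: (1 : R) + t) - f t) = - (f (k + t) - f t - l * k) / k.
    by rewrite /GRing.scale /= mulr1; field.
  have := hr (k + t); rewrite addrK => /(_ kr).
  by rewrite normrM normrN normfV ler_pdivrMr ?normr_gt0.
by apply: DeriveDef; [exact: (cvgP _ H) | exact: (cvg_lim _ H)].
Qed.

Lemma dwithin_is_derive f t (l : R) : a < t < b -> dwithin f t l -> is_derive t 1 f l.
Proof.
move=> /andP[at_ tb] h; apply: cvg_is_derive => eps e0; have [rho r0 hr] := h eps e0.
exists (Num.min rho (Num.min (t - a) (b - t))).
  by rewrite !lt_min r0 !subr_gt0 at_.
move=> u; rewrite !lt_min => /andP[u1 /andP[]]; rewrite !ltr_norml => u2 u3.
by apply: hr => //; apply/andP; split; lra.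
Qed.

Lemma is_derive_dwithin f t (l : R) : is_derive t 1 f l -> dwithin f t l.
Proof.
move=> h; apply/dwithinP; case: h => dv vl.
move: dv; rewrite /derivable => /cvg_ex[/= l' H].
have ll' : l' = l by rewrite -vl; symmetry; exact: (cvg_lim _ H).
rewrite {}ll' in H; apply/cvgrPdist_le => eps e0; apply/near_punctP.
have /cvgrPdist_le/(_ eps e0) := H; rewrite near_withinE => /near_nbhsP[rho r0 hr].
exists rho => // u uab ut0 ut; have := hr (u - t); rewrite subr0 => /(_ ut) /=.
rewrite subr_eq0 => /(_ ut0); rewrite /GRing.scale /= mulr1 subrK //.
Qed.

Lemma dwithin_MVT f f' x y : a <= x -> x < y -> y <= b ->
  (forall t, x <= t <= y -> dwithin f t (f' t)) ->
  exists2 z, x < z < y & f y - f x = f' z * (y - x).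
Proof.
move=> ax xy yb h.
have [||z] := @MVT R f f' x y xy; last by rewrite in_itv; exists z.
  move=> t; rewrite in_itv /= => /andP[xt ty]; apply: dwithin_is_derive.
    by apply/andP; split; lra.
  by apply: h; apply/andP; split; lra.
apply/continuous_within_itvP => //; split.
- move=> t; rewrite in_itv /= => /andP[xt ty]; apply/cvgrPdist_le => eps e0.
  apply/near_nbhsP.
  have ht : cwithin f t.
    by apply: (@dwithin_cwithin f t (f' t)); apply: h; apply/andP; split; lra.
  have [|rho r0 hr] := cwithin_interior _ ht e0; first by apply/andP; split; lra.
  by exists rho => // u ut; rewrite distrC; exact: hr.
- apply/cvgrPdist_le => eps e0.
  have hx : cwithin f x.
    by apply: (@dwithin_cwithin f x (f' x)); apply: h; apply/andP; split; lra.
  have [rho r0 hr] := hx eps e0; rewrite near_withinE; apply/near_nbhsP.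
  exists (Num.min rho (y - x)); first by rewrite lt_min r0 subr_gt0.
  move=> u; rewrite lt_min ltr_norml => /andP[u1 u2] /= u3; rewrite distrC; apply: hr.
    by move: u2; rewrite ltr_norml => u2; apply/andP; split; lra.
  by rewrite ltr_norml.
- apply/cvgrPdist_le => eps e0.
  have hx : cwithin f y.
    by apply: (@dwithin_cwithin f y (f' y)); apply: h; apply/andP; split; lra.
  have [rho r0 hr] := hx eps e0; rewrite near_withinE; apply/near_nbhsP.
  exists (Num.min rho (y - x)); first by rewrite lt_min r0 subr_gt0.
  move=> u; rewrite lt_min ltr_norml => /andP[u1 u2] /= u3; rewrite distrC; apply: hr.
    by move: u2; rewrite ltr_norml => u2; apply/andP; split; lra.
  by rewrite ltr_norml.
Qed.

(** ** Orders of vanishing *)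

(** f t is equivalent to C (t - e)^q at e, or negligible with respect to that power
   when C = 0. *)
Definition equiv_power f e q (C : R) : Prop := forall eps, 0 < eps ->
  exists2 rho, 0 < rho & forall t, a <= t <= b -> t != e -> `|t - e| < rho ->
    `|f t - C * (t - e) ^+ q| <= eps * `|t - e| ^+ q.

Lemma is_derive_power e q (t : R) :
  is_derive t 1 (fun u => (u - e) ^+ q.+1) (q.+1%:R * (t - e) ^+ q).
Proof.
have h := is_deriveX q.+1 (is_derive_shift t 1 (- e)).
have E : shift (- e) ^+ q.+1 = (fun u => (u - e) ^+ q.+1) by rewrite exprfctE.
rewrite E in h; apply: (is_derive_eq h).
by rewrite /GRing.scale /= mulr1.
Qed.

Lemma dwithinB f g t (k l : R) : dwithin f t k -> dwithin g t l ->
  dwithin (fun u => f u - g u) t (k - l).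
Proof.
move=> /dwithinP hf /dwithinP hg; apply/dwithinP.
rewrite [X in X @ _](_ : _ = (fun u => (u - t)^-1 * (f u - f t) - (u - t)^-1 * (g u - g t))).
  exact: cvgB.
by apply/funext => u; ring.
Qed.

Lemma dwithinZ f t (k l : R) : dwithin f t l -> dwithin (fun u => k * f u) t (k * l).
Proof.
move=> /dwithinP hf; apply/dwithinP.
rewrite [X in X @ _](_ : _ = (fun u => k * ((u - t)^-1 * (f u - f t)))).
  by apply: cvgM hf; exact: cvg_cst.
by apply/funext => u; ring.
Qed.

(** The mean value theorem for f - C / (q + 1) (t - e)^(q + 1). *)
Lemma equiv_power_int f f' e q (C : R) : a <= e <= b ->
  (exists2 rho, 0 < rho & forall t, a <= t <= b -> `|t - e| < rho -> dwithin f t (f' t)) ->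
  f e = 0 -> equiv_power f' e q C -> equiv_power f e q.+1 (C / q.+1%:R).
Proof.
move=> eab [rho0 r00 hd] fe hC eps e0; have [rho r0 hr] := hC eps e0.
exists (Num.min rho rho0); first by rewrite lt_min r0.
move=> t tab te; rewrite lt_min => /andP[t1 t2].
pose g u := f u - C / q.+1%:R * (u - e) ^+ q.+1.
pose g' u := f' u - C * (u - e) ^+ q.
have hg u : a <= u <= b -> `|u - e| < rho0 -> dwithin g u (g' u).
  move=> uab ue; apply: dwithinB; first exact: hd.
  have := dwithinZ (C / q.+1%:R) (is_derive_dwithin (is_derive_power e q u)).
  by rewrite mulrA mulfVK // pnatr_eq0.
have ge : g e = 0 by rewrite /g fe subrr exprS mul0r mulr0 subrr.
have [z [zab ze zt] E] : exists2 z, [/\ a <= z <= b, z != e & `|z - e| <= `|t - e|] &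
    g t = g' z * (t - e).
  move: eab tab t2 => /andP[ae eb] /andP[ta tb]; rewrite ltr_norml => /andP[t3 t4].
  have [et|et|et] := ltgtP e t; last by rewrite et eqxx in te.
    have [u /andP[hu1 hu2]|z /andP[z1 z2]] := @dwithin_MVT g g' e t ae et tb.
      by apply: hg; [apply/andP; split; lra | rewrite ltr_norml; apply/andP; split; lra].
    rewrite ge subr0 => ->; exists z => //; split; first by apply/andP; split; lra.
      by rewrite gt_eqF.
    by rewrite !gtr0_norm ?subr_gt0 //; lra.
  have [u /andP[hu1 hu2]|z /andP[z1 z2]] := @dwithin_MVT g g' t e ta et eb.
    by apply: hg; [apply/andP; split; lra | rewrite ltr_norml; apply/andP; split; lra].
  rewrite ge sub0r => h; exists z; last by rewrite -(opprB e t) mulrN -h opprK.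
  split; [by apply/andP; split; lra|by rewrite lt_eqF|].
  by rewrite !ltr0_norm ?subr_lt0 //; lra.
have -> : f t - C / q.+1%:R * (t - e) ^+ q.+1 = g t by [].
rewrite E normrM exprSr mulrA ler_wpM2r //.
apply: le_trans (hr z zab ze _) _; first exact: le_lt_trans t1.
by rewrite ler_wpM2l ?(ltW e0) // lerXn2r ?nnegrE.
Qed.

(** Integrating from the k-th derivative down to the first nonzero one. *)
Lemma equiv_power_chain (f : nat -> R -> R) e k : a <= e <= b ->
  (exists2 rho, 0 < rho & forall t, a <= t <= b -> `|t - e| < rho ->
    forall i, (i < k)%N -> dwithin (f i) t (f i.+1 t)) ->
  cwithin (f k) e -> (forall i, (i < k)%N -> f i e = 0) ->
  forall d, (d <= k)%N -> equiv_power (f (k - d)%N) e d (f k e / (d`!)%:R).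
Proof.
move=> eab [rho r0 hd] ck f0; elim=> [|d IH] dk.
  rewrite subn0 fact0 divr1 => eps e0; have [rho' r0' hr] := ck eps e0.
  by exists rho' => // t tab te tr; rewrite !expr0 !mulr1; exact: hr.
rewrite factS natrM [X in f k e / X]mulrC invfM mulrA.
have kd : (k - d = (k - d.+1).+1)%N by lia.
apply: (@equiv_power_int _ (f (k - d)%N)) => //; last by apply: IH; exact: ltnW.
- exists rho => // t tab tr; rewrite kd; apply: hd => //; lia.
- by apply: f0; lia.
Qed.

Lemma equiv_power_cvg f e q (C : R) : a <= e <= b -> equiv_power f e q C ->
  (fun t => (t - e) ^- q * f t) @ within `[a, b] e^' --> C.
Proof.
move=> eab h; apply/cvgrPdist_le => eps e0; apply/near_punctP.
have [rho r0 hr] := h eps e0; exists rho => // t tab te tr.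
have te0 : (t - e) ^+ q != 0 by rewrite expf_neq0 // subr_eq0.
have -> : C - (t - e) ^- q * f t = - (f t - C * (t - e) ^+ q) / (t - e) ^+ q.
  by field.
by rewrite normrM normrN normfV ler_pdivrMr ?normr_gt0 // normrX hr.
Qed.

Lemma id_cvg_punct e : (fun t => t - e) @ within `[a, b] e^' --> (0 : R).
Proof.
apply/cvgrPdist_le => eps e0; apply/near_punctP; exists eps => // t _ _ te.
by rewrite sub0r normrN ltW.
Qed.

Lemma exp_cvg_punct e q : (fun t => (t - e) ^+ q) @ within `[a, b] e^' --> (0 ^+ q : R).
Proof.
elim: q => [|q IH]; first by under eq_fun do rewrite expr0; rewrite expr0; exact: cvg_cst.
rewrite exprS; under eq_fun do rewrite exprS.
by apply: cvgM IH; exact: id_cvg_punct.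
Qed.

(** If f has a zero of order k at e, its r-th derivative is equivalent to the
   one of a power; the falling factorial vanishes when r > k, as it should. *)
Lemma vanishing_derivatives (f : nat -> R -> R) e k m r : a <= e <= b ->
  (exists2 rho, 0 < rho & forall t, a <= t <= b -> `|t - e| < rho ->
    forall i, (i < m)%N -> dwithin (f i) t (f i.+1 t)) ->
  cwithin (f m) e -> (k <= m)%N -> (r <= m)%N -> (forall i, (i < k)%N -> f i e = 0) ->
  (fun t => (t - e) ^+ r * (t - e) ^- k * f r t) @ within `[a, b] e^' -->
    (k ^_ r)%:R / (k`!)%:R * f k e.
Proof.
move=> eab [rho r0 hd] cm km rm f0.
have cw i : (i <= m)%N -> cwithin (f i) e.
  rewrite leq_eqVlt => /predU1P[->//|im].
  by apply: (@dwithin_cwithin _ _ (f i.+1 e)); apply: hd => //; rewrite subrr normr0.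
have [rk|kr] := leqP r k.
  have h : equiv_power (f (k - (k - r))%N) e (k - r) (f k e / ((k - r)`!)%:R).
    apply: equiv_power_chain => //; [|exact: cw|exact: leq_subr].
    by exists rho => // t tab tr i ik; apply: hd => //; exact: leq_trans km.
  rewrite subKn // in h; have := equiv_power_cvg eab h.
  have -> : f k e / ((k - r)`!)%:R = (k ^_ r)%:R / (k`!)%:R * f k e.
    have E : (k`!)%:R = (k ^_ r)%:R * ((k - r)`!)%:R :> R by rewrite -natrM ffact_fact.
    have A0 : (k ^_ r)%:R != 0 :> R by rewrite pnatr_eq0 -lt0n ffact_gt0.
    have B0 : ((k - r)`!)%:R != 0 :> R by rewrite pnatr_eq0 -lt0n fact_gt0.
    rewrite E; move: ((k ^_ r)%:R) (((k - r)`!)%:R) A0 B0 => A B A0 B0.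
    by field; rewrite A0 B0.
  apply: cvg_trans; apply: near_eq_cvg; apply/near_punctP; exists 1 => // t _ te _.
  have te0 : t - e != 0 by rewrite subr_eq0.
  congr (_ * _); rewrite -[in RHS](subnKC rk) exprD invfM mulrA mulfV ?mul1r //.
  exact: expf_neq0.
rewrite ffact_small // mul0r mul0r.
have -> : (0 : R) = 0 ^+ (r - k) * f r e by rewrite expr0n subn_eq0 leqNgt kr mul0r.
have h : (fun t => (t - e) ^+ (r - k) * f r t) @ within `[a, b] e^' --> 0 ^+ (r - k) * f r e.
  apply: cvgM; first exact: exp_cvg_punct.
  apply/cvgrPdist_le => eps e0; apply/near_punctP.
  by have [rho' r0' hr] := cw r rm eps e0; exists rho' => // t tab _ tr; rewrite distrC hr.
apply: cvg_trans h; apply: near_eq_cvg; apply/near_punctP; exists 1 => // t _ te _.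
have te0 : t - e != 0 by rewrite subr_eq0.
congr (_ * _); rewrite -[X in _ ^+ X * _](subnK (ltnW kr)) exprD -mulrA mulfV ?mulr1 //.
exact: expf_neq0.
Qed.

End WithinCalculus.

(** * Finite differences *)

Section FiniteDifferences.
Context {R : realType}.

(** The iterated difference of order k over the nodes x, x + h, ..., x + k h. *)
Fixpoint fd (V : zmodType) k (h : R) (f : R -> V) (x : R) : V :=
  if k is k'.+1 then fd k' h f (x + h) - fd k' h f x else f x.

Lemma fdS (V : zmodType) k h (f : R -> V) x :
  fd k.+1 h f x = fd k h (fun y => f (y + h) - f y) x.
Proof. by elim: k x => [//|k IH] x; rewrite -[LHS]/(fd k.+1 h f (x + h) - fd k.+1 h f x) !IH. Qed.

(** For f the increments of a curve, by fdS, this puts the differences of positive order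
   in the span of the sides of a polygonal. *)
Lemma fd_submx k p n (h : R) (f : R -> 'rV[R]_n) (x : R) (M : 'M[R]_(p, n)) :
  (forall i, (i <= k)%N -> (f (x + i%:R * h)%R <= M)%MS) -> (fd k h f x <= M)%MS.
Proof.
elim: k x => [|k IH] x hM /=; first by have := hM 0%N isT; rewrite mul0r addr0.
rewrite addmx_sub ?eqmx_opp // IH // => i ik; last exact: hM (leqW ik).
by have := hM i.+1 ik; rewrite -natr1 mulrDl mul1r addrA addrAC.
Qed.

Lemma fd_subr (V : zmodType) k h (f : R -> V) x v : 
  fd k h (fun y => f y - v) x = fd k h f x - (if k is 0 then v else 0).
Proof.
elim: k x => [//|k IH] x; rewrite /= !IH subr0.
by rewrite opprB addrA subrK.
Qed.

Lemma fd_coord k n h (f : R -> 'rV[R]_n) x i : fd k h f x 0 i = fd k h (fun y => f y 0 i) x.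
Proof. by elim: k x => [//|k IH] x; rewrite /= -!IH !mxE. Qed.

Lemma is_derive_shifted (f : R -> R) (t h l : R) :
  is_derive (t + h) 1 f l -> is_derive t 1 (fun u => f (u + h)) l.
Proof.
move=> hf; have hs := is_derive_shift t 1 h.
have := @is_derive1_comp R f (shift h) t l 1 hf hs.
by rewrite mulr1.
Qed.

Lemma fd_is_derive (f f' : R -> R) k (h t : R) :
  (forall i, (i <= k)%N -> is_derive (t + i%:R * h) 1 f (f' (t + i%:R * h))) ->
  is_derive t 1 (fd k h f) (fd k h f' t).
Proof.
elim: k t => [|k IH] t hf /=; first by have := hf 0%N isT; rewrite mul0r addr0.
have h1 : is_derive t 1 (fun u => fd k h f (u + h)) (fd k h f' (t + h)).
  apply: is_derive_shifted; apply: IH => i ik.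
  by have := hf i.+1 ik; rewrite -natr1 mulrDl mul1r addrA addrAC.
have h2 : is_derive t 1 (fd k h f) (fd k h f' t).
  by apply: IH => i ik; exact: hf (leqW ik).
exact: (is_deriveB h1 h2).
Qed.

Lemma is_derive_MVT (f f' : R -> R) (x y : R) : x < y ->
  (forall t, x <= t <= y -> is_derive t 1 f (f' t)) ->
  exists2 z, x < z < y & f y - f x = f' z * (y - x).
Proof.
move=> xy h.
have [||z] := @MVT R f f' x y xy; last by rewrite in_itv; exists z.
  by move=> t; rewrite in_itv /= => /andP[/ltW xt /ltW ty]; apply: h; rewrite xt.
apply: derivable_within_continuous => t; rewrite in_itv /= => xty.
by case: (h t xty).
Qed.

(** Divided differences converge to derivatives, uniformly in the position of
   the nodes: each difference is traded for a derivative by the mean value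
   theorem. *)
Lemma fd_cvg (f : nat -> R -> R) k (x0 : R) :
  (exists2 rho, 0 < rho & forall t, `|t - x0| < rho -> forall i, (i < k)%N ->
     is_derive t 1 (f i) (f i.+1 t)) ->
  (forall eps, 0 < eps -> exists2 rho, 0 < rho & forall t, `|t - x0| < rho ->
     `|f k t - f k x0| <= eps) ->
  forall eps, 0 < eps -> exists2 rho, 0 < rho & forall x h, `|x - x0| < rho ->
     0 < h < rho -> `|h ^- k * fd k h (f 0%N) x - f k x0| <= eps.
Proof.
elim: k f => [|k IH] f [r r0 hd] hc eps e0.
  have [rho rho0 hr] := hc eps e0; exists rho => // x h xr _ /=.
  by rewrite expr0 invr1 mul1r hr.
have [||rho rho0 hr] := IH (fun i => f i.+1) _ _ eps e0 => //.
  by exists r => // t tr i ik; apply: hd.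
have K0 : 0 < k.+2%:R :> R by [].
pose d := Num.min (rho / 2) (r / k.+2%:R).
have d0 : 0 < d by rewrite lt_min !divr_gt0.
have [d1 d2] : d <= rho / 2 /\ d <= r / k.+2%:R by split; rewrite ge_min lexx ?orbT.
exists d => // x h xd /andP[h0 hd'].
have [|t /andP[xt th]|z /andP[z1 z2] E] := @is_derive_MVT (fd k h (f 0%N)) (fd k h (f 1%N)) x (x + h) _ _.
- by rewrite ltrDl.
- apply: fd_is_derive => i ik; apply: hd => //.
  have hh : h * k.+2%:R < r by rewrite -ltr_pdivlMr //; exact: lt_le_trans d2.
  have hx : `|x - x0| < h + (r - h * k.+2%:R) / k.+2%:R.
    apply: lt_le_trans xd _; rewrite mulrBl mulfK ?gt_eqF // addrC subrK //.
  have : i%:R * h <= k%:R * h by rewrite ler_pM2r // ler_nat.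
  have : (r - h * k.+2%:R) / k.+2%:R <= r - h * k.+2%:R.
    by rewrite ler_pdivrMr // ler_peMr ?subr_ge0 ?(ltW hh) // ler1n.
  have : 0 <= i%:R * h by rewrite mulr_ge0 // ltW.
  move: hx hh; rewrite -!natr1 ltr_norml => /andP[hx1 hx2] hh hi h1 h2.
  by rewrite ltr_norml; apply/andP; split; lra.
rewrite -[fd k.+1 _ _ _]/(_ - _) E addrAC subrr add0r.
rewrite [fd k h _ z * h]mulrC exprS invfM mulrA -[h^-1 * _]mulrC mulfVK ?gt_eqF //.
apply: hr; last by rewrite h0; lra.
by move: xd; rewrite !ltr_norml => /andP[? ?]; apply/andP; split; lra.
Qed.

End FiniteDifferences.

(** * Spans of consecutive derivatives near a point *)

Section FallingFactorialMatrix.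
Context {R : realType}.

(** The rows are the coefficients of the derivatives of the powers k_l: a
   confluent Vandermonde determinant. *)
Lemma ffact_mx_unit p (kk : 'I_p -> nat) : injective kk ->
  (\matrix_(i < p, l < p) ((kk l ^_ i)%:R / ((kk l)`!)%:R : R)) \in unitmx.
Proof.
move=> kI; set V := \matrix_(i, l) _; rewrite -row_free_unit -kermx_eq0.
apply/eqP/row_matrixP => a; rewrite row0; set y := row a _.
have yV : y *m V = 0 by rewrite /y -row_mul mulmx_ker row0.
(* Q i takes the value k ^_ i at k, so a relation y between the rows is a
   polynomial of degree less than p with the p roots kk l *)
pose Q i : {poly R} := \prod_(s < i) ('X - (s%:R)%:P).
have QE i (k : nat) : (Q i).[k%:R] = (k ^_ i)%:R.
  rewrite /Q horner_prod; elim: i => [|i IH]; first by rewrite big_ord0 ffactn0.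
  rewrite big_ord_recr /= IH hornerXsubC ffactnSr natrM.
  have [ik|ki] := leqP i k; first by rewrite natrB.
  by rewrite ffact_small // !mul0r.
pose S : {poly R} := \sum_(i < p) y 0 i *: Q i.
have sQ i : size (Q i) = i.+1.
  by rewrite /Q size_prod_XsubC /index_enum -enumT size_enum_ord.
have S0 : S = 0.
  apply/eqP; apply/negPn/negP => S0.
  pose rs := [seq ((kk l)%:R : R) | l <- enum 'I_p].
  have /(max_poly_roots S0) : all (root S) rs.
    apply/allP => _ /mapP[l _ ->]; rewrite rootE /S horner_sum; apply/eqP.
    have /rowP/(_ l) := yV; rewrite [LHS]mxE [RHS]mxE => h.
    have fk : ((kk l)`!)%:R != 0 :> R by rewrite pnatr_eq0 -lt0n fact_gt0.
    apply: (mulIf (invr_neq0 fk)); rewrite mul0r -[RHS]h mulr_suml.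
    by apply: eq_bigr => i _; rewrite hornerZ QE [V _ _]mxE mulrA.
  rewrite map_inj_uniq ?enum_uniq; last first.
    by move=> l l' /eqP; rewrite eqr_nat => /eqP /kI.
  move=> /(_ isT); rewrite size_map size_enum_ord ltnNge; apply/negP; rewrite negbK.
  apply: (leq_trans (size_sum _ _ _)); apply/bigmax_leqP => i _.
  by apply: (leq_trans (size_scale_leq _ _)); rewrite sQ.
(* evaluating S = 0 at i = 0, 1, ... gives the coefficients one by one *)
apply/rowP => i; rewrite [RHS]mxE; case: i => i ip; elim/ltn_ind: i ip => i IH ip.
have : S.[i%:R] = 0 by rewrite S0 horner0.
rewrite /S horner_sum (bigD1 (Ordinal ip)) //= big1 => [|l li].
  rewrite addr0 hornerZ QE ffactnn => /eqP; rewrite mulf_eq0 pnatr_eq0.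
  by rewrite (gtn_eqF (fact_gt0 i)) orbF => /eqP.
rewrite hornerZ QE; have [il|li'] := ltnP i l; first by rewrite ffact_small ?mulr0.
have li2 : (l < i)%N.
  rewrite ltn_neqAle li' andbT; apply: contraNneq li => e; apply/eqP; exact: val_inj.
have -> : l = Ordinal (ltn_ord l) by exact: val_inj.
by rewrite IH // mul0r.
Qed.

End FallingFactorialMatrix.


Section SpanLimit.
Context {R : realType} (a b : R) (hab : a < b) (e : R) (eab : a <= e <= b).
Variables (q p n : nat) (D0 : 'M[R]_(q, n)) (D1 : 'M[R]_(p, n)) (D2 : 'M[R]_n).
Variables (L0 : 'M[R]_(n, q)) (L1 : 'M[R]_(n, p)).
Hypothesis L01 : L0 *m D0 + L1 *m D1 + D2 = 1%:M.
Variables (J : R -> 'M[R]_(p, n)) (kk : 'I_p -> nat) (km : nat) (V : 'M[R]_p).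
Hypotheses (kkm : forall l, (kk l <= km)%N) (Vu : V \in unitmx).
Hypothesis J1 : forall i l : 'I_p, (fun t => (t - e) ^+ i * (t - e) ^- kk l * (J t *m L1) i l)
  @ within `[a, b] e^' --> V i l.
Hypothesis J2 : forall (i : 'I_p) (l : 'I_n), (fun t => (t - e) ^+ i * (t - e) ^- km * (J t *m D2) i l)
  @ within `[a, b] e^' --> (0 : R).

Local Notation F := (within `[a, b] e^').

Let X t : 'M[R]_p := diag_mx (\row_i (t - e) ^+ i).
Let K t : 'M[R]_p := diag_mx (\row_l (t - e) ^+ kk l).
Let Ki t : 'M[R]_p := diag_mx (\row_l (t - e) ^- kk l).
Let V' t : 'M[R]_p := X t *m (J t *m L1) *m Ki t.
Let W t : 'M[R]_(p, n) := (t - e) ^- km *: (X t *m (J t *m D2)).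

(** The p rows of J t are decomposed along D0, D1 and a remainder. V' is the block of
   the coordinates along D1, rescaled so that it tends to the invertible V; the
   remainder W is small even for the smallest scale, the one of power km. Solving
   for D1 gives vectors of the span of D0 and J t that tend to D1. *)
Lemma jets_span_cvg : exists DD : R -> 'M[R]_(q + p, n),
  (\forall t \near F, (DD t <= col_mx D0 (J t))%MS) /\ mxcvg F DD (col_mx D0 D1).
Proof.
have diagE m (d : 'rV[R]_p) (M : 'M[R]_(p, m)) i j : (diag_mx d *m M) i j = d 0 i * M i j.
  by rewrite mul_diag_mx mxE.
have diagE' m (d : 'rV[R]_p) (M : 'M[R]_(m, p)) i j : (M *m diag_mx d) i j = M i j * d 0 j.
  by rewrite mul_mx_diag mxE.
have cV : mxcvg F V' V.
  move=> i l; apply: cvg_trans (@J1 i l); apply: near_eq_cvg; apply: nearW => t.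
  by rewrite /V' diagE' diagE [X in _ = X * _ * _]mxE [X in _ = _ * X]mxE mulrAC.
have cW : mxcvg F W 0.
  move=> i l; rewrite mxE; apply: cvg_trans (@J2 i l); apply: near_eq_cvg; apply: nearW => t.
  by rewrite /W [RHS]mxE diagE [X in _ = _ * (X * _)]mxE mulrA [_ ^- km * _]mulrC.
have Vu' : \forall t \near F, V' t \in unitmx by apply: near_unitmx cV Vu.
exists (fun t => col_mx D0 (Ki t *m invmx (V' t) *m X t *m (J t - J t *m L0 *m D0))).
split.
  apply: nearW => t.
  have sD : (D0 <= col_mx D0 (J t))%MS by rewrite -addsmxE addsmxSl.
  have sJ : (J t <= col_mx D0 (J t))%MS by rewrite -addsmxE addsmxSr.
  rewrite col_mx_sub sD /=; apply: (submx_trans (submxMl _ _)).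
  by rewrite addmx_sub // eqmx_opp; apply: submx_trans sD; exact: submxMl.
apply: mxcvg_col_mx; first exact: mxcvg_cst.
pose K' t : 'M[R]_p := diag_mx (\row_l (t - e) ^+ (km - kk l)).
have cK' : mxcvg F K' (diag_mx (\row_l 0 ^+ (km - kk l))).
  move=> i j; rewrite !mxE; under eq_fun do rewrite !mxE.
  by case: eqP => _; [rewrite mulr1n; under eq_fun do rewrite mulr1n; exact: exp_cvg_punct
    | rewrite mulr0n; under eq_fun do rewrite mulr0n; exact: cvg_cst].
have cD : mxcvg F (fun t => D1 + K' t *m invmx (V' t) *m W t)
    (D1 + diag_mx (\row_l 0 ^+ (km - kk l)) *m invmx V *m 0).
  apply: mxcvgD; first exact: mxcvg_cst.
  by apply: mxcvgM => //; apply: mxcvgM => //; exact: mxcvg_inv.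
rewrite mulmx0 addr0 in cD; apply: mxcvg_eq cD.
have ne : \forall t \near F, t - e != 0.
  by apply/near_punctP; exists 1 => // t _ te _; rewrite subr_eq0.
apply: filterS2 Vu' ne => t vu te.
have -> : J t - J t *m L0 *m D0 = J t *m L1 *m D1 + J t *m D2.
  rewrite -[X in X - _](mulmx1 (J t)) -L01 !mulmxDr !mulmxA.
  by rewrite addrAC [_ + J t *m L1 *m D1]addrC addrK.
rewrite mulmxDr; congr (_ + _).
  have KK : Ki t *m K t = 1%:M.
    apply/matrixP => i j; rewrite diagE !mxE.
    have [->|ij] := eqVneq i j; last by rewrite mulr0n mulr0.
    by rewrite mulr1n mulVf // expf_neq0.
  have KK' : Ki t *m K t = K t *m Ki t.
    by apply/matrixP => i j; rewrite !diagE !mxE; case: eqP => [->|_];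
      rewrite ?mulr1n ?mulr0n ?mulr0 // mulrC.
  have XJ : X t *m (J t *m L1) = V' t *m K t by rewrite /V' -mulmxA KK mulmx1.
  rewrite mulmxA -(mulmxA (Ki t *m _) (X t)) XJ mulmxA -(mulmxA (Ki t)) mulVmx //.
  by rewrite mulmx1 KK mul1mx.
have -> : Ki t = (t - e) ^- km *: K' t.
  apply/matrixP => i l; rewrite !mxE; case: eqP => [->|_]; last by rewrite !mulr0n mulr0.
  have E : (t - e) ^+ km = (t - e) ^+ (km - kk l) * (t - e) ^+ kk l.
    by rewrite -exprD subnK.
  by rewrite !mulr1n E invfM mulrAC mulVf ?mul1r // expf_neq0.
by rewrite /W -scalemxAr -!scalemxAl !mulmxA.
Qed.

End SpanLimit.

Section GreedyExponents.
Context {R : realType} {n : nat} (u : nat -> 'rV[R]_n).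

Definition exp_mx (kk : nat -> nat) p : 'M[R]_(p, n) := \matrix_(l < p) u (kk l).

(** The exponents kk 0 < ... < kk (p-1) are those at which the span of the
   vectors u 1, u 2, ... grows. *)
Definition greedy (kk : nat -> nat) p : Prop :=
  [/\ row_free (exp_mx kk p),
      forall l l', (l < l' < p)%N -> (kk l < kk l')%N,
      forall l, (l < p)%N -> (0 < kk l)%N
    & forall l, (l < p)%N -> forall k, (0 < k < kk l)%N -> (u k <= exp_mx kk l)%MS].

Lemma exp_mx_sub kk p l : (l < p)%N -> (u (kk l) <= exp_mx kk p)%MS.
Proof.
move=> lp; rewrite (_ : u (kk l) = row (Ordinal lp) (exp_mx kk p)) ?row_sub //.
by apply/rowP => i; rewrite !mxE.
Qed.

Lemma exp_mx_col kk p q :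
  exp_mx kk (q + p) = col_mx (exp_mx kk q) (\matrix_(l < p) u (kk (q + l)%N)).
Proof.
apply/matrixP => i l; rewrite -[i]splitK; case: (fintype.split i) => i'.
  by rewrite col_mxEu !mxE.
by rewrite col_mxEd !mxE.
Qed.

Lemma exp_mx_mono kk p q : (q <= p)%N -> (exp_mx kk q <= exp_mx kk p)%MS.
Proof.
move=> qp; apply/row_subP => i.
rewrite (_ : row i _ = u (kk i)); last by apply/rowP => l; rewrite !mxE.
by apply: exp_mx_sub; exact: leq_trans qp.
Qed.

Lemma row_free_exp_mx kk p q : (q <= p)%N -> row_free (exp_mx kk p) -> row_free (exp_mx kk q).
Proof.
move=> qp fM.
have -> : exp_mx kk q = rowsub (widen_ord qp) (exp_mx kk p).
  by apply/matrixP => i l; rewrite !mxE.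
by apply: row_free_rowsub fM => i i' /(congr1 val) /= /val_inj.
Qed.

(** The next exponent is the least order at which a derivative leaves the span of the
   previous ones; it exists below m because p independent derivatives do. *)
Lemma greedy_exists m p : (0 < m)%N ->
  (exists B : 'M[R]_(p, n), row_free B /\
    forall i, exists2 k, (0 < k < m)%N & row i B = u k) ->
  exists kk, greedy kk p /\ forall l, (l < p)%N -> (kk l < m)%N.
Proof.
move=> m0; elim: p => [|p IH] [B [fB hB]].
  exists (fun=> 0%N); split=> //; split=> //; first by rewrite -row_leq_rank.
  by move=> l l' /andP[_]; rewrite ltn0.
have [|kk [[fk mono pos grow] bound]] := IH.
  exists (rowsub (widen_ord (leqnSn p)) B); split.
    by apply: row_free_rowsub fB => i i' /(congr1 val) /= /val_inj.
  by move=> i; rewrite row_rowsub.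
have [k0 [k0m hk0]] : exists k0, (0 < k0 < m)%N /\ ~~ (u k0 <= exp_mx kk p)%MS.
  apply: contrapT => no.
  have : (B <= exp_mx kk p)%MS.
    apply/row_subP => i; have [k km ->] := hB i.
    by apply: contrapT => /negP h; apply: no; exists k.
  move=> /mxrankS; move/eqP: fB => ->; move/eqP: fk => ->; lia.
have ex : exists k, (0 < k)%N && ~~ (u k <= exp_mx kk p)%MS.
  by exists k0; rewrite hk0 andbT; case/andP: k0m.
pose k1 := ex_minn ex.
have [k1p k1min] : ((0 < k1)%N /\ ~~ (u k1 <= exp_mx kk p)%MS) /\
    forall k, (0 < k < k1)%N -> (u k <= exp_mx kk p)%MS.
  rewrite /k1; case: ex_minnP => k /andP[h1 h2] h3; split=> // k' /andP[k'0 k'k].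
  apply: contrapT => /negP h; have := h3 k'; rewrite k'0 h => /(_ isT); lia.
have k1m : (k1 < m)%N.
  rewrite ltnNge; apply/negP => mk; move/negP: hk0; apply; apply: k1min.
  by case/andP: k0m => k00 k0m; rewrite k00 (leq_trans k0m).
pose kk' l := if (l == p)%N then k1 else kk l.
have kk'E q : (q <= p)%N -> exp_mx kk' q = exp_mx kk q.
  move=> qp; apply/matrixP => i l; rewrite !mxE /kk' ifF //.
  by apply/negbTE; rewrite neq_ltn (leq_trans (ltn_ord i) qp).
have klast l : (l < p)%N -> (kk l < k1)%N.
  move=> lp; rewrite ltnNge leq_eqVlt; apply/negP => /predU1P[e|lt].
    by move/negP: k1p.2; apply; rewrite e exp_mx_sub.
  move/negP: k1p.2; apply; apply: (submx_trans (grow l lp k1 _)); first by rewrite k1p.1.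
  by apply: exp_mx_mono; exact: ltnW.
exists kk'; split; last first.
  by move=> l; rewrite ltnS leq_eqVlt /kk'; case: eqP => //= _ /bound.
split.
- rewrite -addn1 exp_mx_col kk'E //.
  set v := \matrix_(_ < _) _.
  have vE : v = u k1 by apply/matrixP => i l; rewrite !mxE ord1 /kk' addn0 eqxx.
  have vn : ~~ (v <= exp_mx kk p)%MS by rewrite vE; exact: k1p.2.
  have := (mxrank_leqif_sup (addsmxSl (exp_mx kk p) v)).
  move=> [h1 h2]; rewrite /row_free eqn_leq rank_leq_row /= -addsmxE addn1.
  rewrite -[X in (X < _)%N](eqP fk) ltn_neqAle h1 andbT h2 addsmx_sub submx_refl /=.
  exact: vn.
- move=> l l' /andP[ll' l'p]; move: l'p ll'.
  rewrite ltnS leq_eqVlt /kk'; case: eqP => [->|_] /=.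
    move=> _ lp.
    by rewrite ifF ?klast //; apply/negbTE; rewrite neq_ltn lp.
  move=> l'p ll'; rewrite ifF; last by apply/negbTE; rewrite neq_ltn (ltn_trans ll' l'p).
  by apply: mono; rewrite ll'.
- by move=> l; rewrite ltnS leq_eqVlt /kk'; case: eqP => //= _; [rewrite k1p.1|exact: pos].
- move=> l; rewrite ltnS leq_eqVlt => /predU1P[->|lp] k.
    by rewrite /kk' eqxx kk'E // => /k1min.
  rewrite {1}/kk' ifF; last by apply/negbTE; rewrite neq_ltn lp.
  by move=> hk; rewrite kk'E ?(ltnW lp) //; exact: grow.
Qed.

End GreedyExponents.

Section Curve.
Context {R : realType} {N : nat} (a b : R) (hab : a < b) (c : R -> 'rV[R]_N.+1).
Implicit Types (s t e : R).

Local Notation D k := (derivn_itv a b k c).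

(** Linear forms reduce the calculus of vector functions to that of real ones. *)
Definition lform n (u : 'cV[R]_n) (x : 'rV[R]_n) : R := (x *m u) 0 0.

Lemma lform_cvg (T : Type) (F : set_system T) {FF : Filter F} n (u : 'cV[R]_n)
    (M : T -> 'rV[R]_n) A : mxcvg F M A -> (fun x => lform u (M x)) @ F --> lform u A.
Proof.
move=> h; have h2 : mxcvg F (fun x => M x *m u) (A *m u).
  by apply: mxcvgM => //; exact: mxcvg_cst.
exact: (h2 0 0).
Qed.

Lemma lform_cwithin (f : R -> 'rV[R]_N.+1) t u :
  f @ within `[a, b] (nbhs t) --> f t -> cwithin a b (fun x => lform u (f x)) t.
Proof.
move=> h; apply/cwithinP; apply: lform_cvg; exact: cvg_mxcvg.
Qed.

Lemma derivable_dwithin (f : R -> 'rV[R]_N.+1) t u : derivable_itv a b f t ->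
  dwithin a b (fun x => lform u (f x)) t (lform u (deriv_itv a b f t)).
Proof.
move=> h; apply/dwithinP.
have h' : diff_quotient f t @ within `[a, b] t^' --> deriv_itv a b f t by [].
have h2 : (fun x => lform u (diff_quotient f t x)) @ within `[a, b] t^' -->
    lform u (deriv_itv a b f t) by apply: lform_cvg; exact: cvg_mxcvg.
apply: cvg_trans h2; apply: near_eq_cvg; apply: nearW => x.
by rewrite /diff_quotient /lform -scalemxAl mulmxBl !mxE.
Qed.

Lemma lformB n (u : 'cV[R]_n) x y : lform u (x - y) = lform u x - lform u y.
Proof. by rewrite /lform mulmxBl [LHS]mxE [X in _ + X]mxE. Qed.

Lemma mulmx_lform k n l (A : 'M[R]_(k, n)) (B : 'M[R]_(n, l)) i i' :
  (A *m B) i i' = lform (col i' B) (row i A).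
Proof. by rewrite /lform !mxE; apply: eq_bigr => h _; rewrite !mxE. Qed.

Lemma submx_lform0 k n (A : 'M[R]_(k, n)) u x : (x <= A)%MS -> A *m u = 0 -> lform u x = 0.
Proof. by move=> /submxP[B ->] h; rewrite /lform -mulmxA h mulmx0 mxE. Qed.

(** Class C^m near s, read on linear forms. *)
Lemma class_C_nearE m s : a <= s <= b -> class_C_near a b c m s ->
  (exists2 rho, 0 < rho & forall t, a <= t <= b -> `|t - s| < rho ->
    forall k, (k < m)%N -> forall u,
      dwithin a b (fun x => lform u (D k x)) t (lform u (D k.+1 t))) /\
  (forall k, (k <= m)%N -> forall u, cwithin a b (fun x => lform u (D k x)) s).
Proof.
move=> sab /near_withinP[rho r0 h]; split.
  exists rho => // t tab ts k km u; have [hd _] := h t tab ts.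
  exact: derivable_dwithin (hd k km).
move=> k; have [hd hc] := h s sab (ltac:(by rewrite subrr normr0)).
rewrite leq_eqVlt => /predU1P[-> u|km u]; first exact: lform_cwithin.
exact: dwithin_cwithin (derivable_dwithin u (hd k km)).
Qed.

(** A basis of the p-th osculating space at t, when it is free. *)
Definition osc p t : 'M[R]_(p, N.+1) := \matrix_(i < p) D i.+1 t.

(** For o = 0 the derivatives of c - c e of order 0 to p - 1 at t, for o = 1
   those of order 1 to p. *)
Definition jet_row e k t : 'rV[R]_N.+1 := D k t - (if k == 0%N then c e else 0).

Definition jet e o p t : 'M[R]_(p, N.+1) := \matrix_(i < p) jet_row e (o + i) t.

Lemma jet1 e p t : jet e 1 p t = osc p t.
Proof. by apply/matrixP => i l; rewrite !mxE subr0. Qed.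

Lemma jet_row_dwithin e k t u :
  dwithin a b (fun x => lform u (D k x)) t (lform u (D k.+1 t)) ->
  dwithin a b (fun x => lform u (jet_row e k x)) t (lform u (jet_row e k.+1 t)).
Proof.
move=> h eps e0; have [rho r0 hr] := h eps e0; exists rho => // x xab xt.
rewrite [jet_row e k.+1 t]/jet_row subr0 /jet_row !lformB opprB addrA subrK.
exact: hr.
Qed.

(** If u kills the first derivatives of c - c e at e, then u (c - c e) has a zero there,
   so vanishing_derivatives applies. *)
Lemma jet_row_cvg e m o k r u : a <= e <= b -> class_C_near a b c m e ->
  (k <= m - o)%N -> (r <= m - o)%N -> (o <= m)%N ->
  (forall i, (i < k)%N -> lform u (jet_row e (o + i) e) = 0) ->
  (fun t => (t - e) ^+ r * (t - e) ^- k * lform u (jet_row e (o + r) t)) @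
    within `[a, b] e^' --> (k ^_ r)%:R / (k`!)%:R * lform u (jet_row e (o + k) e).
Proof.
move=> eab cm km rm om h0; have [[rho r0 hd] hc] := class_C_nearE eab cm.
apply: (@vanishing_derivatives R a b hab (fun i t => lform u (jet_row e (o + i) t)) e k (m - o) r eab) => //.
  exists rho => // t tab te i im; rewrite addnS; apply: jet_row_dwithin.
  by apply: hd => //; lia.
move=> eps e0; have [|rho' r0' hr] := hc (o + (m - o))%N _ u eps e0; first by lia.
exists rho' => // x xab xe; rewrite /jet_row !lformB opprB addrA subrK; exact: hr.
Qed.

(** Modulo the span of q generalized osculating directions at e, the span of p
   consecutive derivatives at t tends to the next p directions. *)
Lemma jets_cvg e m kk r o q p : a <= e <= b -> class_C_near a b c m e ->
  greedy (fun k => D k e) kk r -> (forall l, (l < r)%N -> (kk l < m)%N) ->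
  (q + p <= r)%N -> (p < m)%N -> (o <= 1)%N -> (o * q = 0)%N ->
  exists DD : R -> 'M[R]_(q + p, N.+1),
  (\forall t \near within `[a, b] e^',
     (DD t <= col_mx (exp_mx (fun k => D k e) kk q) (jet e o p t))%MS) /\
  mxcvg (within `[a, b] e^') DD (exp_mx (fun k => D k e) kk (q + p)).
Proof.
move=> eab cm [fk mono pos grow] bound qpr pm o1 oq.
have fC : row_free (exp_mx (fun k => D k e) kk (q + p)) by apply: row_free_exp_mx fk.
have /row_freeP[L hL] := fC.
set C := exp_mx _ kk (q + p) in fC hL *.
have CE : C = col_mx (exp_mx (fun k => D k e) kk q) (\matrix_(l < p) D (kk (q + l)%N) e).
  exact: exp_mx_col.
pose D2 := 1%:M - L *m C.
have pos' l : (l < p)%N -> (o <= kk (q + l))%N.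
  by move=> lp; have := pos (q + l)%N; lia.
have jetR k : (0 < k)%N -> jet_row e k e = D k e.
  by rewrite /jet_row; case: k => // k _; rewrite subr0.
have jet0 u : lform u (jet_row e 0 e) = 0.
  by rewrite /jet_row /= subrr /lform mul0mx mxE.
rewrite CE; apply: (@jets_span_cvg R a b e q p N.+1 _ _ D2 (lsubmx L) (rsubmx L) _
  (jet e o p) (fun l => kk (q + l)%N - o)%N (kk (q + p.-1)%N - o)%N
  (\matrix_(i < p, l < p) (((kk (q + l) - o) ^_ i)%:R / ((kk (q + l) - o)`!)%:R))).
- rewrite /D2 CE -[in X in _ + (_ - X)](hsubmxK L) mul_row_col.
  by rewrite addrC subrK.
- move=> l; have lp := ltn_ord l; apply: leq_sub2r.
  have [e'|ne] := eqVneq (l : nat) p.-1; first by rewrite e'.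
  by apply: ltnW; apply: mono; apply/andP; split; lia.
- apply: ffact_mx_unit => l l' e'; apply: val_inj.
  have {}e' : (kk (q + l) - o = kk (q + l') - o)%N := e'.
  have lp := ltn_ord l; have lp' := ltn_ord l'.
  have p1 := pos' l lp; have p2 := pos' l' lp'.
  have [lt|lt|//] := ltngtP l l'.
    have : (q + l < q + l' < r)%N by apply/andP; split; lia.
    by move=> /mono; lia.
  have : (q + l' < q + l < r)%N by apply/andP; split; lia.
  by move=> /mono; lia.
- move=> i l; have lp := ltn_ord l; have ip := ltn_ord i.
  have qlr : (q + l < r)%N by lia.
  have kkm := bound _ qlr; have p1 := pos' l lp.
  pose u := col l (rsubmx L).
  have hu k : (k <= q + p)%N -> exp_mx (fun k => D k e) kk k *m u =
      \col_i (i == q + l :> nat)%:R.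
    move=> kqp; apply/colP => h; rewrite [RHS]mxE.
    have := congr1 (fun M : 'M[R]_(q + p) => M (widen_ord kqp h) (rshift q l)) hL.
    rewrite [RHS]mxE -val_eqE /= => <-; rewrite !mxE; apply: eq_bigr => x _.
    by rewrite !mxE.
  have := @jet_row_cvg e m o (kk (q + l)%N - o) i u eab cm _ _ _ _.
  rewrite subnKC // jetR ?pos // [lform u (D _ e)](_ : _ = 1); last first.
    have /colP/(_ (rshift q l)) := hu (q + p)%N (leqnn _).
    rewrite [RHS]mxE /= eqxx => h1; rewrite -[RHS]/(true%:R) -h1 /lform !mxE.
    by apply: eq_bigr => x _; rewrite !mxE.
  rewrite mulr1 => h; rewrite mxE.
  apply: cvg_trans (h _ _ _ _); try lia.
    apply: near_eq_cvg; apply: nearW => t; congr (_ * _).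
    by rewrite mulmx_lform; congr lform; apply/rowP => x; rewrite !mxE.
  move=> k hk; have [k0|k0] := posnP (o + k); first by rewrite k0 jet0.
  rewrite jetR //; apply: (@submx_lform0 (q + l) _ (exp_mx (fun k => D k e) kk (q + l))).
    by apply: grow => //; lia.
  rewrite hu; last by lia.
  by apply/colP => x; rewrite !mxE (ltn_eqF (ltn_ord x)).
- move=> i l; have ip := ltn_ord i.
  have p1 : (p.-1 < p)%N by lia.
  have qlr : (q + p.-1 < r)%N by lia.
  have kkm := bound _ qlr; have p2 := pos' _ p1.
  pose u := col l D2.
  have hu : C *m u = 0.
    by rewrite /u colE mulmxA /D2 mulmxBr mulmx1 mulmxA hL mul1mx subrr mul0mx.
  have hz k : (o + k <= kk (q + p.-1))%N -> lform u (jet_row e (o + k) e) = 0.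
    move=> hk; have [k0|k0] := posnP (o + k); first by rewrite k0 jet0.
    rewrite jetR //; apply: (@submx_lform0 (q + p) _ C) => //.
    move: hk; rewrite leq_eqVlt => /predU1P[->|hk].
      by apply: exp_mx_sub; lia.
    apply: (@submx_trans _ _ _ _ _ _ (exp_mx (fun k => D k e) kk (q + p.-1))).
      by apply: grow => //; lia.
    by apply: exp_mx_mono; lia.
  have := @jet_row_cvg e m o (kk (q + p.-1)%N - o) i u eab cm _ _ _ _.
  rewrite hz ?mulr0; last by lia.
  move=> h; apply: cvg_trans (h _ _ _ _); try lia.
    apply: near_eq_cvg; apply: nearW => t; congr (_ * _).
    by rewrite mulmx_lform; congr lform; apply/rowP => x; rewrite !mxE.
  by move=> k hk; apply: hz; lia.
Qed.

End Curve.

(** * Windows of a uniform grid near a good point *)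

Section Wedge.
Context {R : realType}.

(** A free matrix has a nonzero maximal minor, and conversely a relation between the
   rows makes each minor vanish. *)
Lemma wedge_neq0 k n (v : 'I_k -> 'rV[R]_n) :
  (wedge v != 0) = row_free (\matrix_(p < k) v p).
Proof.
set V := \matrix_p _.
have wE f : wedge v f = \det (colsub f V).
  by rewrite ffunE; congr (\det _); apply/matrixP => p q; rewrite !mxE.
apply/idP/idP => [|fV].
  move=> w0; have [f hf] : exists f, wedge v f != 0.
    apply: contrapT => h; move/eqP: w0; apply; apply/ffunP => f; rewrite [RHS]ffunE.
    by apply: contrapT => /eqP h'; apply: h; exists f.
  rewrite wE -unitfE -unitmxE in hf.
  have E : colsub f V = V *m colsub f 1%:M by rewrite mulmx_colsub mulmx1.
  by apply/row_freeP; exists (colsub f 1%:M *m invmx (colsub f V)); rewrite mulmxA -E mulmxV.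
have fT : row_full V^T by rewrite /row_full mxrank_tr.
pose g := fullrankfun fT.
have hg : rowsub g V^T \in unitmx by exact: fullrowsub_unit.
apply/eqP => w0; have := wE g; rewrite w0 ffunE => h.
move: hg; rewrite -unitmx_tr unitmxE unitfE => /eqP; apply; rewrite h.
by congr (\det _); apply/matrixP => p q; rewrite !mxE.
Qed.

End Wedge.

Section FdFilter.
Context {R : realType}.

(** z = (x, h): the first node x tends to x0 and the step h to 0+, independently. *)
Definition fdF (x0 : R) : set_system (R * R) := filter_prod (nbhs x0) (at_right (0 : R)).

Lemma near_fdFP x0 (P : R * R -> Prop) : (\forall z \near fdF x0, P z) <->
  exists2 rho, 0 < rho & forall x h, `|x - x0| < rho -> 0 < h < rho -> P (x, h).
Proof.
split.
  case=> -[A B] /= [hA hB] hP.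
  have /near_nbhsP[r1 r10 h1] := hA.
  have /near_nbhsP[r2 r20 h2] : \forall u \near nbhs (0 : R), 0 < u -> B u by [].
  exists (Num.min r1 r2); first by rewrite lt_min r10.
  move=> x h; rewrite lt_min => /andP[x1 _]; rewrite lt_min => /andP[h0 /andP[_ hr]].
  apply: hP; split=> /=; first exact: h1.
  by apply: h2 => //; rewrite subr0 gtr0_norm.
move=> [rho r0 h]; exists ([set x | `|x - x0| < rho], [set h | 0 < h < rho]) => /=.
  split; first by apply/near_nbhsP; exists rho.
  suff : \forall u \near nbhs (0 : R), 0 < u -> 0 < u < rho by [].
  apply/near_nbhsP; exists rho => // u.
  by rewrite subr0 ltr_norml => /andP[_ ur] u0; rewrite /= u0.
by move=> [x k] /= [h1 h2]; exact: h.
Qed.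

Lemma fdF_shift x0 (P : R * R -> Prop) : (\forall z \near fdF x0, P z) ->
  \forall z \near fdF x0, P (z.1 + z.2, z.2).
Proof.
move=> /near_fdFP[rho r0 h]; apply/near_fdFP; exists (rho / 2); first lra.
move=> x k; rewrite ltr_norml => /andP[x1 x2] /andP[k0 k1] /=.
by apply: h; [rewrite ltr_norml; apply/andP; split; lra | apply/andP; split; lra].
Qed.

Lemma mxcvg_fdF_shift x0 m n (M : R * R -> 'M[R]_(m, n)) A :
  mxcvg (fdF x0) M A -> mxcvg (fdF x0) (fun z => M (z.1 + z.2, z.2)) A.
Proof.
move=> h i l; apply/cvgrPdist_le => eps e0.
by apply: (fdF_shift (P := fun z => `|A i l - M z i l| <= eps)); have /cvgrPdist_le := h i l; apply.
Qed.

Lemma fdF_snd_gt0 x0 : \forall z \near fdF x0, 0 < z.2.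
Proof. by apply/near_fdFP; exists 1 => // x h _ /andP[]. Qed.

End FdFilter.

Section Mild.
Context {R : realType} (N : nat) (a b : R) (hab : a < b) (c : R -> 'rV[R]_N.+1) (j : nat).
Hypothesis hmild : mildly_smoothly_turning a b c j.
Implicit Types (s t e : R).

Local Notation D k := (derivn_itv a b k c).
Local Notation osc := (osc a b c).

(** The hypothesis at e, with the orders at which the span of the derivatives grows
   in place of the given ones. *)
Lemma mild_data e : a <= e <= b -> exists m kk, [/\ (j + 2 <= m)%N,
  class_C_near a b c m e, greedy (fun k => D k e) kk j.+1
  & forall l, (l < j.+1)%N -> (kk l < m)%N].
Proof.
move=> eab; have [i [m [jm cm si /andP[pi ai] wi]]] := hmild eab.
have : exists B : 'M[R]_(j.+1, N.+1), row_free B /\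
    forall l, exists2 k, (0 < k < m)%N & row l B = D k e.
  rewrite wedge_neq0 in wi; exists (\matrix_(p < j.+1) nth 0 (derivs_at a b c e i) p); split=> //.
  move=> l; exists (nth 0%N (1%N :: i) l); last first.
    rewrite rowK /derivs_at (nth_map 0%N) //= si; exact: ltn_ord.
  have : nth 0%N (1%N :: i) l \in 1%N :: i by apply: mem_nth; rewrite /= si.
  rewrite inE => /predU1P[->|hi]; first by apply/andP; split=> //; lia.
  rewrite (allP ai _ hi) andbT.
  have := order_path_min ltn_trans pi => /allP/(_ _ hi); lia.
move=> /greedy_exists[|kk [g1 g2]]; first by lia.
by exists m, kk; split.
Qed.

Lemma D_dwithin t k u : a <= t <= b -> (k <= j.+1)%N ->
  dwithin a b (fun x => lform u (D k x)) t (lform u (D k.+1 t)).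
Proof.
move=> tab kj; have [m [kk [jm cm _ _]]] := mild_data tab.
have [[rho r0 h] _] := class_C_nearE tab cm.
by apply: h => //; [rewrite subrr normr0 | lia].
Qed.

Lemma D_cwithin t k u : a <= t <= b -> (k <= j.+2)%N ->
  cwithin a b (fun x => lform u (D k x)) t.
Proof.
move=> tab kj; have [m [kk [jm cm _ _]]] := mild_data tab.
have [_ h] := class_C_nearE tab cm.
by apply: h => //; lia.
Qed.

Lemma lform_delta (x : 'rV[R]_N.+1) l : lform (delta_mx l 0) x = x 0 l.
Proof.
rewrite /lform mxE (bigD1 l) //= big1 ?addr0 => [|i il].
  by rewrite mxE !eqxx mulr1.
by rewrite mxE (negbTE il) mulr0.
Qed.

Lemma D_dwithin_coord t k l : a <= t <= b -> (k <= j.+1)%N ->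
  dwithin a b (fun x => D k x 0 l) t (D k.+1 t 0 l).
Proof.
move=> tab kj; have := D_dwithin (delta_mx l 0) tab kj.
by rewrite lform_delta; under eq_fun do rewrite lform_delta.
Qed.

Lemma D_cwithin_coord t k l : a <= t <= b -> (k <= j.+2)%N ->
  cwithin a b (fun x => D k x 0 l) t.
Proof.
move=> tab kj; have := D_cwithin (delta_mx l 0) tab kj.
by under eq_fun do rewrite lform_delta.
Qed.

Lemma osc_cvg t p : a <= t <= b -> (p <= j.+2)%N ->
  mxcvg (within `[a, b] (nbhs t)) (osc p) (osc p t).
Proof.
move=> tab pj i l; rewrite mxE; under eq_fun do rewrite mxE.
by apply/cwithinP; apply: D_cwithin_coord => //; have := ltn_ord i; lia.
Qed.

(** The derivative of osc p. *)
Definition osc1 p t : 'M[R]_(p, N.+1) := \matrix_(i < p) D i.+2 t.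

Lemma osc_strict_diff t p : a <= t <= b -> (p <= j.+1)%N ->
  strict_diff (within `[a, b] t^') (fun x => x - t) (fun=> osc p t) (osc p) (osc p t) (osc1 p t).
Proof.
move=> tab pj; split; first exact: mxcvg_cst.
  move=> i l; apply: cvg_trans (@osc_cvg t p tab (leqW pj) i l); apply: cvg_app.
  by move=> A /near_withinP[rho r0 h]; apply/near_punctP; exists rho => // u uab _; exact: h.
move=> i l; have := D_dwithin_coord l tab (leq_trans (ltn_ord i) pj).
move=> /dwithinP; rewrite mxE; apply: cvg_trans; apply: near_eq_cvg; apply: nearW => x.
by rewrite !mxE.
Qed.

(** Divided differences of c over a uniform grid. *)
Definition fdmx p (z : R * R) : 'M[R]_(p, N.+1) :=
  \matrix_(i < p) (z.2 ^- i.+1 *: fd i.+1 z.2 c z.1).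

Lemma fd_D_cvg x0 k : a < x0 < b -> (k <= j.+2)%N ->
  mxcvg (fdF x0) (fun z => z.2 ^- k *: fd k z.2 c z.1) (D k x0).
Proof.
move=> /andP[ax xb] kj i l; rewrite ord1; apply/cvgrPdist_le => eps e0; apply/near_fdFP.
have xab : a <= x0 <= b by rewrite !ltW.
have [||rho r0 h] := @fd_cvg R (fun i t => D i t 0 l) k x0 _ _ eps e0.
- exists (Num.min (x0 - a) (b - x0)); first by rewrite lt_min !subr_gt0 ax.
  move=> t; rewrite lt_min !ltr_norml => /andP[/andP[t1 _] /andP[_ t2]] q qk.
  have tab' : a < t < b by apply/andP; split; lra.
  apply: (@dwithin_is_derive R a b _ _ _ tab').
  by apply: D_dwithin_coord; [apply/andP; split; lra | lia].
- move=> e' e'0; have xab' : a < x0 < b by rewrite ax.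
  by apply: (cwithin_interior xab' _ e'0); exact: D_cwithin_coord.
exists rho => // x k' h1 h2; rewrite mxE fd_coord distrC /=; exact: h.
Qed.

Lemma fdmx_cvg x0 p : a < x0 < b -> (p <= j.+2)%N ->
  mxcvg (fdF x0) (fdmx p) (osc p x0).
Proof.
move=> hx pj i l; rewrite mxE; under eq_fun do rewrite mxE.
by apply: (@fd_D_cvg x0 i.+1 hx); exact: leq_trans (ltn_ord i) pj.
Qed.

(** The increment over one step is a difference of the next order. *)
Lemma fdmx_strict_diff x0 p : a < x0 < b -> (p <= j.+1)%N ->
  strict_diff (fdF x0) (fun z => z.2) (fdmx p) (fun z => fdmx p (z.1 + z.2, z.2))
    (osc p x0) (osc1 p x0).
Proof.
move=> hx pj; have h := @fdmx_cvg x0 p hx (leqW pj).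
split=> //; first exact: mxcvg_fdF_shift.
move=> i l; rewrite mxE.
have hi : (i.+2 <= j.+2)%N by have := ltn_ord i; lia.
have h' := @fd_D_cvg x0 i.+2 hx hi 0 l.
apply: cvg_trans h'; apply: near_eq_cvg.
apply: filterS (fdF_snd_gt0 x0) => -[x k] /= k0.
by rewrite !mxE -mulrBr mulrA -invfM -exprS.
Qed.

Definition full := (N <= j)%N.

(** The sign-free normal of the curve, and its derivative. *)
Definition onproj t := nproj full (osc j.+1 t) (osc j t).
Definition donproj t := dnproj full (osc j.+1 t) (osc1 j.+1 t) (osc j t) (osc1 j t).

(** The same for the window that starts at z.1 in a grid of step z.2; divided differences
   of order 1 to j span what j consecutive sides do. *)
Definition wnproj z :=
  nproj full (fdmx j.+1 z) (fdmx j (z.1 + (j < N)%:R * z.2, z.2)).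

(** The number of sides in a window, hence of derivatives required at a good point. *)
Definition npk := minn j.+1 N.

Definition good t := row_free (osc npk t).

Lemma osc_free t p : (p <= npk)%N -> good t -> row_free (osc p t).
Proof.
move=> pk; have -> : osc p t = rowsub (widen_ord pk) (osc npk t).
  by apply/matrixP => i l; rewrite !mxE.
by apply: row_free_rowsub => i i' /(congr1 val) /= /val_inj.
Qed.

Hypothesis jN : (j <= N)%N.

Lemma good_free t : good t -> (~~ full -> row_free (osc j.+1 t)) /\ row_free (osc j t).
Proof.
by move=> gt; split=> [nf|]; apply: osc_free gt; move: jN; rewrite /npk; [move: nf; rewrite /full|]; lia.
Qed.

Lemma wnproj_strict_diff x0 : a < x0 < b -> good x0 ->
  strict_diff (fdF x0) (fun z => z.2) wnproj (fun z => wnproj (z.1 + z.2, z.2))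
    (onproj x0) (donproj x0).
Proof.
move=> hx gx; have [fA fB] := good_free gx.
apply: strict_diff_nproj => //; first exact: fdmx_strict_diff.
have [d1 d2 d3] := fdmx_strict_diff hx (leqnSn j).
case: (j < N)%N; last first.
  split.
  - apply: mxcvg_eq d1; apply: nearW => z; rewrite mul0r addr0; by case: z.
  - apply: mxcvg_eq d2; apply: nearW => z; rewrite /= mul0r addr0; by case: z.
  - apply: mxcvg_eq d3; apply: nearW => z; rewrite /= !mul0r !addr0; by case: z.
split.
- by apply: mxcvg_eq d2; apply: nearW => z; rewrite mul1r.
- by apply: mxcvg_eq (mxcvg_fdF_shift d2); apply: nearW => z; rewrite /= mul1r.
- by apply: mxcvg_eq (mxcvg_fdF_shift d3); apply: nearW => z; rewrite /= mul1r.
Qed.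

Lemma onproj_strict_diff t : a <= t <= b -> good t ->
  strict_diff (within `[a, b] t^') (fun x => x - t) (fun=> onproj t) onproj
    (onproj t) (donproj t).
Proof.
move=> tab gt; have [fA fB] := good_free gt.
by apply: strict_diff_nproj => //; apply: osc_strict_diff.
Qed.

End Mild.

(** * The Gram-Schmidt procedure and the Hodge operator *)

Section GramSchmidt.
Context {R : realType} {n : nat} (u : nat -> 'rV[R]_n).

Definition initmx k : 'M[R]_(k, n) := \matrix_(i < k) u i.

(** The (k + 1)-th vector of the Gram-Schmidt procedure applied to u. *)
Definition gsvec k : 'rV[R]_n := normalize (u k *m (1%:M - proj (initmx k))).

Lemma initmx_sub k l : (k <= l)%N -> (initmx k <= initmx l)%MS.
Proof.
move=> kl; apply/row_subP => i.
rewrite (_ : row i _ = row (widen_ord kl i) (initmx l)) ?row_sub //.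
by apply/rowP => h; rewrite !mxE.
Qed.

Lemma initmx_free k l : (k <= l)%N -> row_free (initmx l) -> row_free (initmx k).
Proof.
move=> kl; have -> : initmx k = rowsub (widen_ord kl) (initmx l).
  by apply/matrixP => i h; rewrite !mxE.
by apply: row_free_rowsub => i i' /(congr1 val) /= /val_inj.
Qed.

Lemma initmxS k : (u k <= initmx k.+1)%MS.
Proof.
rewrite (_ : u k = row ord_max (initmx k.+1)) ?row_sub //.
by apply/rowP => h; rewrite !mxE.
Qed.

Lemma gsvec_pre_neq0 k : row_free (initmx k.+1) -> u k *m (1%:M - proj (initmx k)) != 0.
Proof.
move=> fk; rewrite mulmxBr mulmx1 subr_eq0; apply/eqP => e.
have uk : (u k <= initmx k)%MS by rewrite e (submx_trans (submxMl _ _)) ?proj_submx.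
have : (initmx k.+1 <= initmx k)%MS.
  apply/row_subP => i; rewrite rowK.
  have := ltn_ord i; rewrite ltnS leq_eqVlt => /predU1P[->//|ik].
  rewrite (_ : u i = row (Ordinal ik) (initmx k)) ?row_sub //.
  by apply/rowP => h; rewrite !mxE.
move=> /mxrankS; move/eqP: fk => ->; have := rank_leq_row (initmx k); lia.
Qed.

(** Its sign-free description is the difference of two consecutive projectors. *)
Lemma gsvec_spec k : row_free (initmx k.+1) ->
  [/\ dot (gsvec k) (gsvec k) = 1, gsvec k *m (initmx k)^T = 0,
      (gsvec k <= initmx k.+1)%MS
    & (gsvec k)^T *m gsvec k = proj (initmx k.+1) - proj (initmx k)].
Proof.
move=> fk; have f0 := initmx_free (leqnSn k) fk; have p0 := gsvec_pre_neq0 fk.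
have h1 : dot (gsvec k) (gsvec k) = 1 by apply/enorm1P; exact: enorm_normalize.
have h2 : gsvec k *m (initmx k)^T = 0.
  rewrite /gsvec /normalize -scalemxAl mulmxBr mulmx1 mulmxBl -mulmxA.
  by rewrite -[proj (initmx k)]proj_tr -trmx_mul mul_proj // subrr scaler0.
have h3 : (gsvec k <= initmx k.+1)%MS.
  rewrite /gsvec /normalize scalemx_sub // mulmxBr mulmx1 addmx_sub ?initmxS //.
  rewrite eqmx_opp (submx_trans (submxMl _ _)) // (submx_trans (proj_submx _)) //.
  exact: initmx_sub.
split=> //; rewrite (@rank1_nproj _ _ false _ (initmx k.+1) (initmx k)) //.
by rewrite h3 initmx_sub.
Qed.

(** Removing the components along an orthonormal basis of the previous vectors is
   applying the complementary projector. *)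
Lemma gram_schmidtS k :
  row_free (initmx k) -> \sum_(e <- gram_schmidt (mkseq u k)) e^T *m e = proj (initmx k) ->
  gram_schmidt (mkseq u k.+1) = rcons (gram_schmidt (mkseq u k)) (gsvec k).
Proof.
move=> f0 IH; rewrite /gram_schmidt mkseqS foldl_rcons -/(gram_schmidt _).
congr (rcons _ (normalize _)); rewrite mulmxBr mulmx1 -IH mulmx_sumr; congr (_ - _).
by apply: eq_bigr => e _; rewrite mulmxA dot_mx mul_scalar_mx.
Qed.

Lemma gram_schmidt_proj k : row_free (initmx k) ->
  \sum_(e <- gram_schmidt (mkseq u k)) e^T *m e = proj (initmx k).
Proof.
elim: k => [|k IH] fk; first by rewrite big_nil; apply/matrixP => i l; rewrite [RHS]mxE big_ord0 mxE.
have f0 := initmx_free (leqnSn k) fk.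
rewrite gram_schmidtS // ?IH // -cats1 big_cat /= IH // big_seq1.
by have [_ _ _ ->] := gsvec_spec fk; rewrite addrC subrK.
Qed.

Lemma last_gram_schmidt k : row_free (initmx k.+1) ->
  last 0 (gram_schmidt (mkseq u k.+1)) = gsvec k.
Proof.
move=> fk; have f0 := initmx_free (leqnSn k) fk.
by rewrite gram_schmidtS ?last_rcons // gram_schmidt_proj.
Qed.

Lemma gsvec_ortho k l : (k < l)%N -> row_free (initmx l.+1) -> dot (gsvec l) (gsvec k) = 0.
Proof.
move=> kl fl; have [_ o _ _] := gsvec_spec fl.
have [_ _ /submxP[B ->] _] := gsvec_spec (initmx_free (leqW kl) fl).
have /submxP[C ->] := initmx_sub kl.
by rewrite /dot !trmx_mul !mulmxA o !mul0mx mxE.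
Qed.

End GramSchmidt.

Section Hodge.
Context {R : realType} {n : nat}.

Lemma col_mx_top m (x : 'rV[R]_m) (V : 'M[R]_(n, m)) k :
  (col_mx x V : 'M[R]_(n.+1, m)) 0 k = x 0 k.
Proof. by rewrite mxE; case: fintype.splitP => // i _; rewrite ord1. Qed.

Lemma col_mx_lift m (x : 'rV[R]_m) (V : 'M[R]_(n, m)) p k :
  (col_mx x V : 'M[R]_(n.+1, m)) (lift 0 p) k = V p k.
Proof.
rewrite mxE; case: fintype.splitP => [i|i] /=; first by rewrite ord1.
by rewrite /bump /= !add1n => -[] /val_inj ->.
Qed.

(** Laplace expansion along the first row. *)
Lemma dot_hodge (v : 'I_n -> 'rV[R]_n.+1) (x : 'rV[R]_n.+1) :
  dot x (hodge (wedge v)) = (-1) ^+ n * \det (col_mx x (\matrix_(k < n) v k) : 'M[R]_n.+1).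
Proof.
rewrite dotE (expand_det_row _ 0) mulr_sumr; apply: eq_bigr => k _.
rewrite mxE ffunE /cofactor col_mx_top exprD add0n.
rewrite [X in \det X](_ : _ = row' 0 (col' k (col_mx x (\matrix_(k < n) v k) : 'M[R]_n.+1))).
  by ring.
by apply/matrixP => p q; rewrite [LHS]mxE ffunE [RHS]mxE [RHS]mxE col_mx_lift mxE.
Qed.

(** By dot_hodge, the product with x is a determinant, which vanishes if x is one of the
   v k and is 1 or - 1 if x completes them into an orthonormal basis. *)
Lemma hodge_orthonormal (v : 'I_n -> 'rV[R]_n.+1) :
  (forall k l, dot (v k) (v l) = (k == l)%:R) ->
  dot (hodge (wedge v)) (hodge (wedge v)) = 1 /\
  hodge (wedge v) *m (\matrix_(k < n) v k)^T = 0.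
Proof.
move=> von; set V := \matrix_k v k; set w := hodge _.
have VV : V *m V^T = 1%:M.
  apply/matrixP => k l; rewrite [RHS]mxE -von dotE mxE; apply: eq_bigr => i _.
  by rewrite !mxE.
have fV : row_free V by apply/row_freeP; exists V^T.
have wV : w *m V^T = 0.
  apply/row_mulmxtr0 => k; rewrite rowK dotC dot_hodge.
  rewrite (@determinant_alternate _ _ _ 0 (lift 0 k)) ?mulr0 //.
  by move=> l; rewrite col_mx_top col_mx_lift mxE.
split=> //; have [x [x1 xV _]] := @unit_normal_exists R n.+1 true n (const_mx 0) V fV (ltnSn n).
pose M : 'M[R]_n.+1 := col_mx x V.
have Vx : V *m x^T = 0 by rewrite -[LHS]trmxK trmx_mul trmxK xV trmx0.
have MM : M *m M^T = 1%:M.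
  have := @mul_col_row R 1 n n.+1 1 n x V x^T V^T.
  rewrite -tr_col_mx -/M => ->; rewrite dot_mx x1 xV Vx VV.
  by rewrite -(scalar_mx_block 1 n 1).
have dM : \det M ^+ 2 = 1 by rewrite expr2 -{2}det_tr -det_mulmx MM det1.
have wx : dot w x ^+ 2 = 1.
  by rewrite dotC dot_hodge exprMn sqrr_sign mul1r -/M dM.
have : w = w *m M^T *m M by rewrite -mulmxA (mulmx1C MM) mulmx1.
have MT : M^T = row_mx x^T V^T := tr_col_mx x V.
have -> : w *m M^T *m M = (w *m x^T) *m x + (w *m V^T) *m V.
  rewrite MT; have -> : w *m row_mx x^T V^T = row_mx (w *m x^T) (w *m V^T) := mul_mx_row _ _ _.
  exact: (@mul_row_col R 1 1 n n.+1 (w *m x^T) (w *m V^T) x V).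
rewrite wV mul0mx addr0 dot_mx mul_scalar_mx => e.
by rewrite [in LHS]e dotZl dotZr x1 mulr1 -expr2 wx.
Qed.

End Hodge.

(** * The speed of the smooth normal *)

Section UnitCurveDerivative.
Context {R : realType} {n : nat}.

(** If a unit vector depends continuously on x, it is as differentiable as its
   sign-free description, and only the factor sqrt 2 distinguishes the speeds. *)
Lemma rank1_derivative (F : set_system R) {PF : ProperFilter F} (h : R -> R)
    (w : R -> 'rV[R]_n) (w0 : 'rV[R]_n) (p : R -> 'M[R]_n) (p1 : 'M[R]_n) :
  (\forall x \near F, dot (w x) (w x) = 1 /\ (w x)^T *m w x = p x) ->
  dot w0 w0 = 1 -> mxcvg F w w0 ->
  mxcvg F (fun x => (h x)^-1 *: (p x - w0^T *m w0)) p1 ->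
  exists w1, mxcvg F (fun x => (h x)^-1 *: (w x - w0)) w1 /\ dot w1 w1 = frob2 p1 / 2.
Proof.
move=> hw w01 cw cp.
pose s x := dot w0 (w x).
have cs : s @ F --> (1 : R) by rewrite -w01; apply: mxcvg_dot => //; exact: mxcvg_cst.
(* w0 p x = s x w x with s x tending to 1, and s x ^ 2 - 1 = dot (w0 p x - w0) w0, so
   the quotients of s, and then those of w, converge *)
pose q1 := w0 *m p1; pose s1 := dot q1 w0 / 2.
have cq : mxcvg F (fun x => (h x)^-1 *: (w0 *m p x - w0)) q1.
  have cq' : mxcvg F (fun x => w0 *m ((h x)^-1 *: (p x - w0^T *m w0))) q1.
    by apply: mxcvgM => //; exact: mxcvg_cst.
  apply: mxcvg_eq cq'; apply: nearW => x.
  by rewrite -scalemxAr mulmxBr mulmxA dot_mx w01 mul1mx.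
have s2 x : dot (w x) (w x) = 1 /\ (w x)^T *m w x = p x -> w0 *m p x = s x *: w x.
  by move=> [_ <-]; rewrite mulmxA dot_mx mul_scalar_mx.
have sN1 : \forall x \near F, s x + 1 != 0.
  apply: (@near_neq0 _ _ _ _ (fun x => s x + 1) (1 + 1)); last by apply: lt0r_neq0; lra.
  by apply: cvgD => //; exact: cvg_cst.
have sN0 : \forall x \near F, s x != 0 by apply: (near_neq0 cs); exact: oner_neq0.
have cs1 : (fun x => (h x)^-1 * (s x - 1)) @ F --> s1.
  have c2 : (fun x => dot ((h x)^-1 *: (w0 *m p x - w0)) w0 * (s x + 1)^-1) @ F --> s1.
    apply: cvgM; first by apply: mxcvg_dot => //; exact: mxcvg_cst.
    have -> : (2 : R)^-1 = (1 + 1)^-1 by congr (_^-1); lra.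
    apply: cvgV; first by apply: lt0r_neq0; lra.
    by apply: cvgD => //; exact: cvg_cst.
  apply: cvg_trans c2; apply: near_eq_cvg; apply: filterS2 hw sN1 => x hx sx.
  rewrite s2 // dotZl dotDl dotNl dotZl w01 (dotC (w x)) -/(s x).
  by move: ((h x)^-1) => k; field; exact: sx.
exists (q1 - s1 *: w0).
have cw1 : mxcvg F (fun x => (h x)^-1 *: (w x - w0)) (q1 - s1 *: w0).
  have c2 : mxcvg F (fun x => (s x)^-1 *: ((h x)^-1 *: (w0 *m p x - w0) -
      ((h x)^-1 * (s x - 1)) *: w0)) (1^-1 *: (q1 - s1 *: w0)).
    apply: mxcvgZ; first by apply: cvgV => //; exact: oner_neq0.
    by apply: mxcvgB => //; apply: mxcvgZ => //; exact: mxcvg_cst.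
  rewrite invr1 scale1r in c2; apply: mxcvg_eq c2.
  apply: filterS2 hw sN0 => x hx sx; rewrite s2 //.
  by apply/rowP => i; rewrite !mxE; move: ((h x)^-1) => k; field.
split=> //; set w1 := q1 - s1 *: w0 in cw1 *; clearbody w1.
(* with dot w1 w0 = 0 this gives frob2 p1 = 2 dot w1 w1 *)
have Ep : p1 = w1^T *m w0 + w0^T *m w1.
  have c3 : mxcvg F (fun x => ((h x)^-1 *: (w x - w0))^T *m w x +
      w0^T *m ((h x)^-1 *: (w x - w0))) (w1^T *m w0 + w0^T *m w1).
    apply: mxcvgD; apply: mxcvgM => //; first exact: mxcvg_tr.
    exact: mxcvg_cst.
  apply/matrixP => i l.
  have c4 : (fun x => ((h x)^-1 *: (p x - w0^T *m w0)) i l) @ F -->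
      (w1^T *m w0 + w0^T *m w1) i l.
    apply: cvg_trans (c3 i l); apply: near_eq_cvg; apply: filterS hw => x [_ <-].
    congr (fun_of_matrix _ i l).
    rewrite linearZ /= -scalemxAl -scalemxAr -scalerDr linearB /= mulmxBl mulmxBr.
    by rewrite addrA subrK.
  by rewrite -(cvg_lim _ (cp i l)) // (cvg_lim _ c4).
have o1 : dot w1 w0 = 0.
  have c5 : (fun x => dot ((h x)^-1 *: (w x - w0)) (w x) + dot w0 ((h x)^-1 *: (w x - w0)))
      @ F --> dot w1 w0 + dot w0 w1.
    by apply: cvgD; apply: mxcvg_dot => //; exact: mxcvg_cst.
  have c6 : (fun x => dot ((h x)^-1 *: (w x - w0)) (w x) + dot w0 ((h x)^-1 *: (w x - w0)))
      @ F --> (0 : R).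
    apply: (@cvg_trans _ ((fun=> 0 : R) @ F)); last exact: cvg_cst.
    apply: near_eq_cvg; apply: filterS hw => x [h1 _].
    rewrite dotZl dotZr dotDl dotDr dotNl dotNr h1 w01 (dotC w0); ring.
  have h0 : dot w1 w0 + dot w0 w1 = 0 by rewrite -(cvg_lim _ c5) // (cvg_lim _ c6).
  by move: h0; rewrite (dotC w0) => h0; lra.
rewrite Ep frob2E [(_ + _)^T]linearD /= !trmx_mul !trmxK mulmxDl !mulmxDr !raddfD /=.
have T (u v x y : 'rV[R]_n) : \tr (u^T *m v *m (x^T *m y)) = dot v x * dot y u.
  rewrite !mulmxA -(mulmxA _ v) dot_mx mul_mx_scalar -scalemxAl mxtraceZ mxtrace_mulC.
  by rewrite dot_mx mxtrace_scalar mulr1n.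
by rewrite !T w01 (dotC w0) o1; field.
Qed.

End UnitCurveDerivative.

Section SmoothNormal.
Context {R : realType} (N : nat) (a b : R) (hab : a < b) (c : R -> 'rV[R]_N.+1) (j : nat).
Hypothesis hmild : mildly_smoothly_turning a b c j.
Hypotheses (harc : arclength_parameterized a b c) (hj : (1 <= j <= N)%N).
Implicit Types (s t e : R).

Local Notation D k := (derivn_itv a b k c).
Local Notation osc := (osc a b c).
Local Notation good := (good a b c j).
Local Notation onproj := (onproj a b c j).
Local Notation donproj := (donproj a b c j).
Local Notation npk := (npk N j).

Lemma chord_le s t : a <= s -> s <= t -> t <= b -> enorm (c t - c s) <= t - s.
Proof.
move=> as_ st tb; move: st; rewrite le_eqVlt => /predU1P[->|st].
  by rewrite !subrr enorm0.
have := harc as_ (ltW st) tb => E.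
by have := curve_length_chord (@euclid_dist R N.+1) c st; rewrite E lee_fin.
Qed.

Lemma lform_dot (x u : 'rV[R]_N.+1) : lform u^T x = dot x u.
Proof. by []. Qed.

(** A chord is at most its arc, so the speed is at most 1. If it were less than 1 at t,
   then by continuity it would be at most 1 - eps on some [x, y], and the arc from x
   to y would be shorter than y - x. *)
Lemma unit_speed t : a <= t <= b -> enorm (D 1 t) = 1.
Proof.
move=> tab.
have cN : cwithin a b (fun x => enorm (D 1 x)) t.
  apply/cwithinP; apply: mxcvg_enorm => i l; rewrite ord1.
  by apply/cwithinP; apply: (D_cwithin_coord hab hmild).
have PF := punct_proper hab tab.
apply/eqP; rewrite eq_le; apply/andP; split.
  have h : mxcvg (within `[a, b] t^') (diff_quotient c t) (D 1 t).
    move=> i l; rewrite ord1.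
    have /dwithinP := D_dwithin_coord hab hmild (k := 0) l tab isT.
    apply: cvg_trans; apply: near_eq_cvg; apply: nearW => x.
    by rewrite /diff_quotient !mxE.
  have hE : (fun x => enorm (diff_quotient c t x)) @ within `[a, b] t^' --> enorm (D 1 t).
    exact: mxcvg_enorm.
  rewrite -(cvg_lim _ hE) //; apply: limr_le; first exact: (cvgP _ hE).
  apply/near_punctP; exists 1 => // x /andP[ax xb] xt _.
  move: tab => /andP[at_ tb].
  rewrite /diff_quotient enormZ normfV ler_pdivrMl ?normr_gt0 ?subr_eq0 // mulr1.
  have [lt|gt|e] := ltgtP x t; last by rewrite e eqxx in xt.
    rewrite -enormN opprB ltr0_norm ?subr_lt0 // opprB.
    by apply: chord_le => //; exact: ltW.
  by rewrite gtr0_norm ?subr_gt0 //; apply: chord_le => //; exact: ltW.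
rewrite leNgt; apply/negP => lt1.
pose eps := (1 - enorm (D 1 t)) / 2.
have e0 : 0 < eps by rewrite /eps; lra.
have ep2 : enorm (D 1 t) + eps = 1 - eps by rewrite /eps; lra.
have [rho r0 hr] := cN eps e0.
(* an interval around t on which the speed is at most 1 - eps *)
have [x [y [ax xy yb hxy]]] : exists x y, [/\ a <= x, x < y, y <= b &
    forall z, x <= z <= y -> `|z - t| < rho].
  move: tab => /andP[at_ tb]; have [tb'|tb'] := ltP t b.
    exists t, (Num.min b (t + rho / 2)); split=> //.
    - by rewrite lt_min tb' ltrDl divr_gt0.
    - by rewrite ge_min lexx.
    - move=> z /andP[tz]; rewrite le_min => /andP[_ z2].
      by rewrite ger0_norm ?subr_ge0 //; lra.
  exists (Num.max a (t - rho / 2)), t; split=> //.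
  - by rewrite le_max lexx.
  - by rewrite gt_max (lt_le_trans hab tb') gtrBl divr_gt0.
  - move=> z /andP[]; rewrite ge_max => /andP[_ z2] zt.
    by rewrite ler0_norm ?subr_le0 //; lra.
have sp z : x <= z <= y -> enorm (D 1 z) <= 1 - eps.
  move=> zxy; have zab : a <= z <= b by move: (zxy) => /andP[z1 z2]; apply/andP; split; lra.
  have h : `|enorm (D 1 z) - enorm (D 1 t)| <= eps := hr z zab (hxy z zxy).
  rewrite -ep2; move: h; move: (enorm (D 1 z)) (enorm (D 1 t)) (eps) => p q x'.
  by rewrite ler_norml lerBlDl => /andP[].
have lip u v : x <= u -> u <= v -> v <= y ->
    enorm (c v - c u) <= (1 - eps) * v - (1 - eps) * u.
  move=> xu uv vy; rewrite -mulrBr; move: uv; rewrite le_eqVlt => /predU1P[->|uv].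
    by rewrite !subrr mulr0 enorm0.
  set d := c v - c u; have [->|d0] := eqVneq d 0.
    rewrite enorm0.
    apply: mulr_ge0; last by rewrite subr_ge0 ltW.
    have /sp h : x <= u <= y by apply/andP; split; lra.
    exact: le_trans (enorm_ge0 _) h.
  have [|||z /andP[z1 z2] E] := @dwithin_MVT R a b (fun z => lform d^T (D 0 z))
      (fun z => lform d^T (D 1 z)) u v _ uv; [lra|lra| |].
    move=> z /andP[z1 z2]; apply: (D_dwithin hab hmild) => //; apply/andP; split; lra.
  have Ed : dot d d = dot (D 1 z) d * (v - u).
    by rewrite -[RHS]E /= !lform_dot -dotNl -dotDl.
  have dp : 0 < enorm d by rewrite enorm_gt0.
  rewrite -(ler_pM2l dp) -expr2 sqr_enorm Ed mulrA ler_wpM2r ?subr_ge0 ?(ltW uv) //.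
  apply: le_trans (ler_norm _) _; apply: le_trans (norm_dot_le _ _) _.
  rewrite mulrC ler_wpM2l ?(ltW dp) //; apply: sp; apply/andP; split; lra.
have := harc ax (ltW xy) yb => E.
have := @curve_length_le R _ (@euclid_dist R N.+1) c (fun z => (1 - eps) * z) x y lip.
rewrite E lee_fin -mulrBr => h.
have yx : 0 < eps * (y - x) by rewrite mulr_gt0 // subr_gt0.
by lra.
Qed.

End SmoothNormal.

Section DprojLimit.
Context {R : realType} {T : Type} (F : set_system T) {FF : Filter F}.

Lemma mxcvg_dproj k n (M M1 : T -> 'M[R]_(k, n)) A A1 :
  mxcvg F M A -> mxcvg F M1 A1 -> row_free A ->
  mxcvg F (fun t => dproj (M t) (M1 t)) (dproj A A1).
Proof.
move=> cM cM1 fA.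
have cT := mxcvg_tr cM; have cT1 := mxcvg_tr cM1.
have cI : mxcvg F (fun t => invmx (gram (M t))) (invmx (gram A)).
  by apply: mxcvg_inv; [exact: mxcvg_gram | rewrite gram_unit].
apply: mxcvgD; last by apply: mxcvgM => //; exact: mxcvgM.
apply: mxcvgM => //; apply: mxcvgD; first exact: mxcvgM.
apply: mxcvgM => //; apply: mxcvgN; apply: mxcvgM => //; apply: mxcvgM => //.
by apply: mxcvgD; exact: mxcvgM.
Qed.

Lemma mxcvg_dnproj full k l n (M M1 : T -> 'M[R]_(k, n)) A A1
    (L L1 : T -> 'M[R]_(l, n)) B B1 :
  mxcvg F M A -> mxcvg F M1 A1 -> mxcvg F L B -> mxcvg F L1 B1 ->
  (~~ full -> row_free A) -> row_free B ->
  mxcvg F (fun t => dnproj full (M t) (M1 t) (L t) (L1 t)) (dnproj full A A1 B B1).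
Proof.
move=> cM cM1 cL cL1 fA fB; apply: mxcvgB; last exact: mxcvg_dproj.
case: full fA => fA; first exact: mxcvg_cst.
exact: (mxcvg_dproj cM cM1 (fA isT)).
Qed.

Lemma mxcvg_hodge n (v : T -> 'I_n -> 'rV[R]_n.+1) (v0 : 'I_n -> 'rV[R]_n.+1) :
  (forall k, mxcvg F (fun s => v s k) (v0 k)) ->
  mxcvg F (fun s => hodge (wedge (v s))) (hodge (wedge v0)).
Proof.
move=> cv.
have hE (x : 'I_n -> 'rV[R]_n.+1) i l :
    hodge (wedge x) i l = (-1) ^+ (n + l) * \det (\matrix_(p, q) x p 0 (lift l q)).
  rewrite /hodge mxE /wedge ffunE; congr (_ * \det _).
  by apply/matrixP => p q; rewrite !mxE ffunE.
move=> i l.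
have h : (fun s => (-1) ^+ (n + l) * \det (\matrix_(p, q) v s p 0 (lift l q))) @ F -->
    (-1) ^+ (n + l) * \det (\matrix_(p, q) v0 p 0 (lift l q)).
  apply: cvgM; first exact: cvg_cst.
  apply: mxcvg_det => p q; rewrite mxE.
  apply: cvg_trans (cv p 0 (lift l q)); apply: near_eq_cvg; apply: nearW => s.
  by rewrite mxE.
rewrite -(hE v0 i l) in h; apply: cvg_trans h; apply: near_eq_cvg; apply: nearW => s.
exact: (esym (hE (v s) i l)).
Qed.

End DprojLimit.

Section SmoothNormal.
Context {R : realType} (N : nat) (a b : R) (hab : a < b) (c : R -> 'rV[R]_N.+1) (j : nat).
Hypothesis hmild : mildly_smoothly_turning a b c j.
Hypotheses (harc : arclength_parameterized a b c) (hj : (1 <= j <= N)%N).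
Implicit Types (s t e : R).

Local Notation D k := (derivn_itv a b k c).
Local Notation osc := (osc a b c).
Local Notation good := (good a b c j).
Local Notation onproj := (onproj a b c j).
Local Notation donproj := (donproj a b c j).
Local Notation npk := (npk N j).
Local Notation nrm := (smooth_normal a b c j).

Let jN : (j <= N)%N. Proof. by case/andP: hj. Qed.

Lemma good_near t : a <= t <= b -> good t -> \forall s \near within `[a, b] (nbhs t), good s.
Proof.
move=> tab gt; apply: near_row_free gt; apply: (osc_cvg hab hmild) => //.
by rewrite /npk; lia.
Qed.

(** Independence of the first k + 1 derivatives makes the orders 2, ..., k + 1
   admissible, and no list of increasing orders is below them. *)
Lemma iota_smallest k t : a <= t <= b -> (k <= j)%N -> row_free (osc k.+1 t) ->
  smallest_admissible a b c k t (iota 2 k).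
Proof.
move=> tab kj fk; have [m [kk [jm cm _ _]]] := mild_data hab hmild tab.
split.
  exists m; split=> //; first by lia.
  - by rewrite size_iota.
  - apply/andP; split; last by apply/allP => x; rewrite mem_iota => /andP[_ xk]; lia.
    suff P k' : forall l, path ltn l (iota l.+1 k') by exact: P.
    by elim: k' => // k' IH l /=; rewrite IH andbT; exact: ltnSn.
  rewrite wedge_neq0; set V := \matrix_p _.
  suff -> : V = osc k.+1 t by [].
  have ne (p : 'I_k.+1) : nth 0%N (1%N :: iota 2 k) p = p.+1.
    by case: p => -[|p] pk //=; rewrite nth_iota.
  apply/matrixP => p l; rewrite [LHS]mxE [RHS]mxE /derivs_at (nth_map 0%N) ?ne //.
  by rewrite /= size_iota.
move=> i' [m' [_ _ si /andP[pi _] _]] l.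
have [lk|kl] := ltnP l k; last by rewrite nth_default // size_iota.
rewrite nth_iota //.
suff P l' : forall (s : seq nat) z, path ltn z s -> (l' < size s)%N -> (z.+1 + l' <= nth 0 s l')%N.
  by apply: P => //; rewrite si.
elim: l' => [|l' IH] [|x s] z //= /andP[zx ps] ls; first by rewrite addn0.
by rewrite addnS -addSn; apply: leq_trans (IH s x ps ls); rewrite leq_add2r.
Qed.

Lemma smallest_unique k t i : a <= t <= b -> (k <= j)%N -> row_free (osc k.+1 t) ->
  smallest_admissible a b c k t i -> i = iota 2 k.
Proof.
move=> tab kj fk [[m [? ? si ? ?]] mi]; have [ai mio] := iota_smallest tab kj fk.
apply: (@eq_from_nth _ 0%N); first by rewrite si size_iota.
move=> l _; apply/eqP; rewrite eqn_leq mi //= mio //.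
by exists m; split.
Qed.

Lemma gs_normalE k t : a <= t <= b -> (k <= j)%N -> row_free (osc k.+1 t) ->
  gs_normal a b c k t = gsvec (fun p => D p.+1 t) k.
Proof.
move=> tab kj fk; rewrite /gs_normal.
have /(smallest_unique tab kj fk) -> : smallest_admissible a b c k t
    (xget [::] [set i | smallest_admissible a b c k t i]).
  exact: (xgetI [::] (iota_smallest tab kj fk)).
have -> : derivs_at a b c t (iota 2 k) = mkseq (fun p => D p.+1 t) k.+1.
  rewrite /derivs_at /mkseq -[1%N :: _]/(iota (1 + 0) k.+1).
  by rewrite iotaDl -map_comp; exact: eq_map.
exact: last_gram_schmidt.
Qed.

Lemma gsvec0 t : a <= t <= b -> D 1 t = gsvec (fun p => D p.+1 t) 0.
Proof.
move=> tab; rewrite /gsvec; have -> : proj (initmx (fun p => D p.+1 t) 0) = 0.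
  by apply/matrixP => i l; rewrite [LHS]mxE big_ord0 mxE.
by rewrite subr0 mulmx1 /normalize (unit_speed hab hmild harc) // invr1 scale1r.
Qed.

Lemma npkE : npk = if (j < N)%N then j.+1 else j.
Proof. by rewrite /npk; case: ifP; lia. Qed.

(** In the definition of the last normal, the frame t, n_1, ..., n_(N-1) is the
   Gram-Schmidt basis of the first N derivatives. *)
Lemma gs_frame t (k : 'I_N) : ~~ (j < N)%N -> a <= t <= b -> good t ->
  (if k == 0%N :> nat then deriv_itv a b c t else gs_normal a b c k t) =
  gsvec (fun p => D p.+1 t) k.
Proof.
move=> jn tab gt; have kN := ltn_ord k.
case: eqP => [k0|k0]; first by rewrite k0 -gsvec0.
apply: gs_normalE => //; first by lia.
by apply: osc_free gt; rewrite npkE (negbTE jn); lia.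
Qed.

Lemma smooth_normal_spec t : a <= t <= b -> good t ->
  dot (nrm t) (nrm t) = 1 /\ (nrm t)^T *m nrm t = onproj t.
Proof.
move=> tab gt; rewrite /smooth_normal /onproj /full [(N <= j)%N]leqNgt.
have fo p : (p <= npk)%N -> row_free (osc p t) by move=> h; exact: osc_free gt.
case: ifPn => jn; rewrite ?jn.
  have fj : row_free (osc j.+1 t) by apply: fo; rewrite npkE jn.
  rewrite gs_normalE //.
  by have [? _ _ ?] := @gsvec_spec _ _ (fun p => D p.+1 t) j fj.
have jE : j = N by lia.
set v := fun k : 'I_N => _.
have vE : v = (fun k : 'I_N => gsvec (fun p => D p.+1 t) k).
  by apply/funext => k; exact: gs_frame.
rewrite /= in vE; rewrite vE {v vE}.
have fj : row_free (osc j t) by apply: fo; rewrite npkE (negbTE jn).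
have fk k : (k < N)%N -> row_free (initmx (fun p => D p.+1 t) k.+1).
  by move=> kN; apply: fo; rewrite npkE (negbTE jn) jE.
have von (k l : 'I_N) : dot (gsvec (fun p => D p.+1 t) k) (gsvec (fun p => D p.+1 t) l) = (k == l)%:R.
  have [->|kl] := eqVneq k l; first by have [-> _ _ _] := gsvec_spec (fk _ (ltn_ord l)).
  have [lt|lt|/val_inj e] := ltngtP k l; last by rewrite e eqxx in kl.
    by rewrite dotC gsvec_ortho // fk.
  by rewrite gsvec_ortho // fk.
have [w1 wE] := hodge_orthonormal von.
split=> //; set w := hodge _ in w1 wE *.
set E := \matrix_k _ in wE.
have EE : E *m E^T = 1%:M.
  apply/matrixP => k l; rewrite [RHS]mxE -von dotE mxE; apply: eq_bigr => i _.
  by rewrite !mxE.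
have fE : row_free E by apply/row_freeP; exists E^T.
have EV : (E <= osc j t)%MS.
  apply/row_subP => k; rewrite rowK; have [_ _ h _] := gsvec_spec (fk _ (ltn_ord k)).
  apply: (submx_trans h); apply: initmx_sub; rewrite jE; exact: ltn_ord.
have [_ /submxP[B hB]] := row_free_sub fE EV (eq_leq jE).
apply: rank1_nproj => //; last by rewrite /= ltnS jE.
by rewrite hB trmx_mul mulmxA wE mul0mx.
Qed.

Lemma gsvec_cvg t k : a <= t <= b -> (k <= j)%N -> row_free (osc k.+1 t) ->
  mxcvg (within `[a, b] (nbhs t)) (fun s => gsvec (fun p => D p.+1 s) k)
    (gsvec (fun p => D p.+1 t) k).
Proof.
move=> tab kj fk; rewrite /gsvec /normalize.
have c1 : mxcvg (within `[a, b] (nbhs t))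
    (fun s => D k.+1 s *m (1%:M - proj (osc k s))) (D k.+1 t *m (1%:M - proj (osc k t))).
  apply: mxcvgM.
    move=> i l; rewrite ord1; apply/cwithinP; by apply: (D_cwithin_coord hab hmild) => //; lia.
  apply: mxcvgB; first exact: mxcvg_cst.
  apply: mxcvg_proj; first by apply: (osc_cvg hab hmild) => //; lia.
  exact: (@initmx_free _ _ (fun p => D p.+1 t) k k.+1 (leqnSn k) fk).
apply: mxcvgZ => //; apply: cvgV; last exact: mxcvg_enorm.
by rewrite enorm_eq0; exact: (@gsvec_pre_neq0 _ _ (fun p => D p.+1 t) k fk).
Qed.

(** The normal itself is continuous at a good point, with no change of sign: near it,
   it is given by the same algebraic expression in the derivatives. *)
Lemma smooth_normal_cvg t : a <= t <= b -> good t ->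
  mxcvg (within `[a, b] (nbhs t)) nrm (nrm t).
Proof.
move=> tab gt; have gn := good_near tab gt.
have gn' : \forall s \near within `[a, b] (nbhs t), a <= s <= b /\ good s.
  have /near_withinP[rho r0 h] := gn; apply/near_withinP; exists rho => // s sab st.
  by split=> //; exact: h.
have [jn|jn] := boolP (j < N)%N.
  have fj s : good s -> row_free (osc j.+1 s).
    by move=> gs; apply: osc_free gs; rewrite npkE jn.
  have nE s : a <= s <= b -> good s -> nrm s = gsvec (fun p => D p.+1 s) j.
    by move=> sab gs; rewrite /smooth_normal jn gs_normalE // fj.
  rewrite nE //; apply: mxcvg_eq (gsvec_cvg tab (leqnn j) (fj t gt)).
  by apply: filterS gn' => s [sab gs]; rewrite nE.
have jE : j = N by lia.
have nE s : a <= s <= b -> good s ->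
    nrm s = hodge (wedge (fun k : 'I_N => gsvec (fun p => D p.+1 s) k)).
  move=> sab gs; rewrite /smooth_normal (negbTE jn); congr (hodge (wedge _)).
  by apply/funext => k; exact: gs_frame.
rewrite nE //.
have cg : mxcvg (within `[a, b] (nbhs t))
    (fun s => hodge (wedge (fun k : 'I_N => gsvec (fun p => D p.+1 s) k)))
    (hodge (wedge (fun k : 'I_N => gsvec (fun p => D p.+1 t) k))).
  apply: mxcvg_hodge => p; have pN := ltn_ord p.
  apply: (@gsvec_cvg t p tab); first by lia.
  by apply: osc_free gt; rewrite npkE (negbTE jn); lia.
by apply: mxcvg_eq cg; apply: filterS gn' => s [sab gs]; rewrite nE.
Qed.

(** The speed of the normal in terms of its sign-free description. *)
Definition nspeed t := Num.sqrt (frob2 (donproj t) / 2).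

(** n is a continuous choice of a sign, so rank1_derivative applies. *)
Lemma smooth_normal_speed t : a <= t <= b -> good t ->
  enorm (deriv_itv a b nrm t) = nspeed t.
Proof.
move=> tab gt; have PF := punct_proper hab tab.
have [n1 nn] := smooth_normal_spec tab gt.
have sub (P : R -> Prop) : (\forall s \near within `[a, b] (nbhs t), P s) ->
    \forall s \near within `[a, b] t^', a <= s <= b /\ P s.
  by move=> /near_withinP[rho r0 h]; apply/near_punctP; exists rho => // s sab _ st; split=> //; exact: h.
have hw : \forall s \near within `[a, b] t^', dot (nrm s) (nrm s) = 1 /\ (nrm s)^T *m nrm s = onproj s.
  by apply: filterS (sub _ (good_near tab gt)) => s [sab gs]; exact: smooth_normal_spec.
have cw : mxcvg (within `[a, b] t^') nrm (nrm t).
  move=> i l; apply: cvg_trans (@smooth_normal_cvg t tab gt i l); apply: cvg_app.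
  by move=> A /near_withinP[rho r0 h]; apply/near_punctP; exists rho => // u uab _; exact: h.
have [_ _ cp] := onproj_strict_diff hab hmild jN tab gt.
rewrite -nn in cp.
have [w1 [cw1 dw1]] := rank1_derivative hw n1 cw cp.
have -> : deriv_itv a b nrm t = w1.
  by apply: cvg_lim => //; apply: mxcvg_cvg.
by rewrite /enorm dw1.
Qed.

Lemma nspeed_cvg t : a <= t <= b -> good t -> cwithin a b nspeed t.
Proof.
move=> tab gt; apply/cwithinP; have [fA fB] := good_free hab jN gt.
have co p : (p <= j.+1)%N -> mxcvg (within `[a, b] (nbhs t)) (osc p) (osc p t).
  by move=> pj; apply: (osc_cvg hab hmild) => //; exact: leqW.
have co1 p : (p <= j.+1)%N -> mxcvg (within `[a, b] (nbhs t)) (osc1 a b c p) (osc1 a b c p t).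
  move=> pj i l; have ip := ltn_ord i.
  have h : (fun s => D i.+2 s 0 l) @ within `[a, b] (nbhs t) --> D i.+2 t 0 l.
    by apply/cwithinP; apply: (D_cwithin_coord hab hmild) => //; lia.
  rewrite /osc1 [X in _ --> X]mxE; apply: cvg_trans h; apply: near_eq_cvg.
  by apply: nearW => s; rewrite mxE.
have cd : mxcvg (within `[a, b] (nbhs t)) donproj (donproj t).
  by apply: mxcvg_dnproj => //; [exact: co|exact: co1|exact: co|exact: co1].
have cf : (fun s => frob2 (donproj s) / 2) @ within `[a, b] (nbhs t) --> frob2 (donproj t) / 2.
  by apply: cvgM; [exact: mxcvg_frob2 | exact: cvg_cst].
apply: (cvg_comp (fun s => frob2 (donproj s) / 2) Num.sqrt cf).
exact: (@sqrt_continuous R (frob2 (donproj t) / 2)).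
Qed.

Lemma frob2Z m n (M : 'M[R]_(m, n)) k : frob2 (k *: M) = k ^+ 2 * frob2 M.
Proof.
rewrite /frob2 mulr_sumr; apply: eq_bigr => i _; rewrite mulr_sumr; apply: eq_bigr => l _.
by rewrite mxE exprMn.
Qed.

(** Consecutive windows of a fine uniform grid have normals at a distance
   equivalent to the step times the speed of the normal of the curve. *)
Lemma window_dist t eps : a < t < b -> good t -> 0 < eps ->
  \forall z \near fdF t, forall x y : 'rV[R]_N.+1, dot x x = 1 -> dot y y = 1 ->
    x^T *m x = wnproj c j z -> y^T *m y = wnproj c j (z.1 + z.2, z.2) ->
    `|rp_dist x y - z.2 * nspeed t| <= eps * z.2.
Proof.
move=> tab gt e0; have [c1 c2 c3] := wnproj_strict_diff hab hmild jN tab gt.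
pose Q z := wnproj c j (z.1 + z.2, z.2) - wnproj c j z.
pose sg z := Num.sqrt (frob2 (Q z) / 2).
have s0 z : 0 <= sg z by exact: sqrtr_ge0.
have cQ : mxcvg (fdF t) Q 0.
  rewrite -(subrr (onproj t)); exact: mxcvgB.
have csq (f : R * R -> R) (l : R) : f @ fdF t --> l ->
    (fun z => Num.sqrt (f z / 2)) @ fdF t --> Num.sqrt (l / 2).
  move=> cf; have cf2 : (fun z => f z / 2) @ fdF t --> l / 2.
    by apply: cvgM => //; exact: cvg_cst.
  exact: (cvg_comp (fun z => f z / 2) Num.sqrt cf2 (@sqrt_continuous R (l / 2))).
have cs : sg @ fdF t --> (0 : R).
  have -> : (0 : R) = Num.sqrt (frob2 (0 : 'M[R]_N.+1) / 2).
    rewrite /frob2 big1 ?mul0r ?sqrtr0 // => i _; rewrite big1 // => l _.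
    by rewrite mxE expr0n.
  by apply: csq; exact: mxcvg_frob2.
have cr : (fun z => z.2^-1 * sg z) @ fdF t --> nspeed t.
  have h : (fun z => Num.sqrt (frob2 (z.2^-1 *: Q z) / 2)) @ fdF t --> nspeed t.
    by apply: csq; exact: mxcvg_frob2.
  apply: cvg_trans h; apply: near_eq_cvg; apply: filterS (fdF_snd_gt0 t) => z z0.
  rewrite frob2Z -mulrA sqrtrM ?sqr_ge0 // sqrtr_sqr ger0_norm // invr_ge0.
  exact: ltW.
have cr2 : (fun z => z.2^-1 * sg z * (Num.sqrt (1 - sg z ^+ 2))^-1) @ fdF t --> nspeed t.
  rewrite -[nspeed t]mulr1 -[X in _ * X]invr1; apply: cvgM => //; apply: cvgV; first exact: oner_neq0.
  have h : (fun z => 1 - sg z ^+ 2) @ fdF t --> (1 : R).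
    rewrite -[X in _ --> X]subr0 -[X in _ - X](expr0n R 2).
    apply: cvgB; first exact: cvg_cst.
    by rewrite expr2; under eq_fun do rewrite expr2; exact: cvgM.
  have := cvg_comp (fun z => 1 - sg z ^+ 2) Num.sqrt h (@sqrt_continuous R 1).
  by rewrite sqrtr1.
have n1 : \forall z \near fdF t, sg z < 1.
  have /cvgrPdist_lt/(_ 1 ltr01) := cs; apply: filterS => z.
  by rewrite sub0r normrN ger0_norm.
have n2 : \forall z \near fdF t, `|nspeed t - z.2^-1 * sg z| <= eps.
  by have /cvgrPdist_le/(_ eps e0) := cr.
have n3 : \forall z \near fdF t, `|nspeed t - z.2^-1 * sg z * (Num.sqrt (1 - sg z ^+ 2))^-1| <= eps.
  by have /cvgrPdist_le/(_ eps e0) := cr2.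
near=> z => x y x1 y1 xz yz.
have z0 : 0 < z.2 by near: z; exact: fdF_snd_gt0.
have d0 := rp_dist_ge0 x1 y1; set d := rp_dist x y in d0 *.
have dE : sin d = sg z.
  rewrite /sg /Q -xz -yz frob2_rp_dist // rp_distC // -/d mulrAC mulfV ?pnatr_eq0 // mul1r.
  by rewrite sqrtr_sqr ger0_norm // sin_rp_dist_ge0.
have cE : cos d = Num.sqrt (1 - sg z ^+ 2).
  rewrite -dE -cos2sin2 sqrtr_sqr ger0_norm // /d cos_rp_dist //.
have /andP[h1 h2] := sin_le_id d0 (rp_dist_le_pi2 x1 y1).
rewrite dE cE in h1 h2.
have s1 : sg z < 1 by near: z.
have c0 : 0 < Num.sqrt (1 - sg z ^+ 2).
  by rewrite sqrtr_gt0 subr_gt0 -[ltRHS](expr1n R 2) ltr_pXn2r ?nnegrE.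
have h3 : d <= sg z * (Num.sqrt (1 - sg z ^+ 2))^-1 by rewrite ler_pdivlMr.
have e2 : `|nspeed t - z.2^-1 * sg z| <= eps by near: z.
have e3 : `|nspeed t - z.2^-1 * sg z * (Num.sqrt (1 - sg z ^+ 2))^-1| <= eps by near: z.
move: e2 e3; rewrite -mulrA !ler_norml.
move: (Num.sqrt _)^-1 h3 => k h3 /andP[e2 e2'] /andP[e3 e3'].
have z2 : z.2 * z.2^-1 = 1 by rewrite mulfV // gt_eqF.
have E (u : R) : z.2 * (z.2^-1 * u) = u by rewrite mulrA z2 mul1r.
have m1 : z.2 * (nspeed t - z.2^-1 * sg z) <= z.2 * eps by rewrite ler_pM2l.
have m2 : z.2 * (- eps) <= z.2 * (nspeed t - z.2^-1 * (sg z * k)) by rewrite ler_pM2l.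
rewrite mulrBr E in m1; rewrite mulrBr E mulrN in m2.
rewrite (mulrC eps); apply/andP; split; lra.
Unshelve. all: by end_near.
Qed.

End SmoothNormal.

(** * Exceptional points of the curve *)

Section Exceptional.
Context {R : realType} (N : nat) (a b : R) (hab : a < b) (c : R -> 'rV[R]_N.+1) (j : nat).
Hypothesis hmild : mildly_smoothly_turning a b c j.
Implicit Types (s t e : R).

Local Notation D k := (derivn_itv a b k c).
Local Notation osc := (osc a b c).
Local Notation good := (good a b c j).
Local Notation jet := (jet a b c).

(** The generalized osculating spaces at e: their projectors are the limits of
   those of the osculating spaces at t, as t tends to e. *)
Definition oscproj e p : 'M[R]_N.+1 := lim (proj (osc p t) @[t --> within `[a, b] e^']).

Definition exceptional_data e m kk := [/\ (j + 2 <= m)%N,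
  class_C_near a b c m e, greedy (fun k => D k e) kk j.+1 &
  forall l, (l < j.+1)%N -> (kk l < m)%N].

(** This is the case without vectors at e of jets_cvg, for the derivatives of order
   1 to p. *)
Lemma osc_span_cvg e m kk p : a <= e <= b -> exceptional_data e m kk -> (p <= j.+1)%N ->
  (\forall t \near within `[a, b] e^', row_free (osc p t)) /\
  mxcvg (within `[a, b] e^') (fun t => proj (osc p t)) (proj (exp_mx (fun k => D k e) kk p)).
Proof.
move=> eab [jm cm g bound] pj; have [gf _ _ _] := g.
have pm : (p < m)%N by lia.
have [DD [hD cD]] := @jets_cvg R N a b hab c e m kk j.+1 1 0 p eab cm g bound pj pm isT erefl.
apply: (@mxcvg_span R R (within `[a, b] e^') _ p N.+1 DD) => //.
  apply: filterS hD => t h; apply: submx_trans h _.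
  by rewrite col_mx_sub jet1 submx_refl andbT [exp_mx _ _ _]flatmx0 sub0mx.
exact: row_free_exp_mx gf.
Qed.

Lemma oscprojE e m kk p : a <= e <= b -> exceptional_data e m kk -> (p <= j.+1)%N ->
  oscproj e p = proj (exp_mx (fun k => D k e) kk p).
Proof.
move=> eab he pj; have PF := punct_proper hab eab.
have [_ h] := osc_span_cvg eab he pj.
by apply: cvg_lim => //; exact: mxcvg_cvg.
Qed.

Lemma mild_exceptional e : a <= e <= b -> exists m kk, exceptional_data e m kk.
Proof. by move=> eab; have [m [kk [? ? ? ?]]] := mild_data hab hmild eab; exists m, kk; split. Qed.

Lemma near_allP (T : Type) (F : set_system T) {FF : Filter F} n (P : nat -> T -> Prop) :
  (forall i, (i <= n)%N -> \forall t \near F, P i t) ->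
  \forall t \near F, forall i, (i <= n)%N -> P i t.
Proof.
move=> h; have h' : \forall t \near F, forall i : 'I_n.+1, P i t.
  by apply: filter_forall => i; apply: h; rewrite -ltnS.
by apply: filterS h' => t ht i ip; have := ht (Ordinal (ip : (i < n.+1)%N)).
Qed.

(** The form in which closeness of spans is used: the two conditions pass from a
   matrix to any other one of the same size whose row space contains its rows. *)
Definition free_close eta k (M : 'M[R]_(k, N.+1)) (Q : 'M[R]_N.+1) : Prop :=
  row_free M /\ mxclose eta (proj M) Q.

Lemma near_osc e eta : a <= e <= b -> 0 < eta ->
  \forall t \near within `[a, b] e^', forall p, (p <= j.+1)%N ->
    free_close eta (osc p t) (oscproj e p).
Proof.
move=> eab e0; have [m [kk he]] := mild_exceptional eab.
apply: near_allP => p pj; have [h1 h2] := osc_span_cvg eab he pj.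
rewrite (oscprojE eab he pj).
have h3 : \forall t \near within `[a, b] e^', mxclose eta (proj (osc p t))
    (proj (exp_mx (fun k => D k e) kk p)) by apply: mxcvg_close.
by apply: filterS2 h1 h3 => t ? ?; split.
Qed.

(** The spans of windows around e: the step of the grid tends to 0 first, which
   turns the chords into derivatives of c - c e at two points t1 and t2; then t2
   tends to e, and finally t1. *)
Lemma near_jets e eta : a <= e <= b -> 0 < eta ->
  \forall t1 \near within `[a, b] e^', \forall t2 \near within `[a, b] e^',
    forall p q, (q + p <= j.+1)%N ->
    free_close eta (col_mx (jet e 0 q t2) (jet e 0 p t1)) (oscproj e (q + p)).
Proof.
move=> eab e0; have [m [kk he]] := mild_exceptional eab; have [jm cm g bound] := he.
have [gf _ _ _] := g.
pose E := exp_mx (fun k => D k e) kk.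
have e20 : 0 < eta / 2 by lra.
have F1 : \forall t1 \near within `[a, b] e^', forall p, (p <= j.+1)%N -> forall q, (q <= j.+1)%N ->
    (q + p <= j.+1)%N -> free_close (eta / 2) (col_mx (E q) (jet e 0 p t1)) (oscproj e (q + p)).
  apply: near_allP => p pj; apply: near_allP => q qj.
  have [pq|pq] := leqP (q + p) j.+1; last by apply: nearW => t.
  have pm : (p < m)%N by lia.
  have [DD [hD cD]] := @jets_cvg R N a b hab c e m kk j.+1 0 q p eab cm g bound pq pm isT erefl.
  have [h1 h2] := mxcvg_span hD cD (row_free_exp_mx pq gf).
  rewrite (oscprojE eab he pq).
  have h3 : \forall t \near within `[a, b] e^', mxclose (eta / 2)
      (proj (col_mx (E q) (jet e 0 p t))) (proj (E (q + p)%N)) by apply: mxcvg_close.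
  by apply: filterS2 h1 h3 => t ? ? _; split.
apply: filterS F1 => t1 F1.
suff F2 : \forall t2 \near within `[a, b] e^', forall p, (p <= j.+1)%N -> forall q, (q <= j.+1)%N ->
    (q + p <= j.+1)%N -> free_close eta (col_mx (jet e 0 q t2) (jet e 0 p t1)) (oscproj e (q + p)).
  by apply: filterS F2 => t2 h p q pq; apply: h => //; lia.
apply: near_allP => p pj; apply: near_allP => q qj.
have [pq|pq] := leqP (q + p) j.+1; last by apply: nearW => t.
have [fA cA] := F1 p pj q qj pq.
have qm : (q < m)%N by lia.
have [DD [hD cD]] := @jets_cvg R N a b hab c e m kk j.+1 0 0 q eab cm g bound qj qm isT erefl.
have hS : \forall t \near within `[a, b] e^',
    (col_mx (DD t) (jet e 0 p t1) <= col_mx (jet e 0 q t) (jet e 0 p t1))%MS.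
  apply: filterS hD => t h; rewrite !col_mx_sub -!addsmxE addsmxSr andbT.
  apply: (submx_trans h); rewrite col_mx_sub [exp_mx _ _ _]flatmx0 sub0mx /=.
  exact: addsmxSl.
have cS : mxcvg (within `[a, b] e^') (fun t => col_mx (DD t) (jet e 0 p t1))
    (col_mx (E q) (jet e 0 p t1)).
  by apply: mxcvg_col_mx => //; exact: mxcvg_cst.
have [h1 h2] := mxcvg_span (W := fun t => col_mx (jet e 0 q t) (jet e 0 p t1)) hS cS fA.
have h3 : \forall t \near within `[a, b] e^', mxclose (eta / 2)
    (proj (col_mx (jet e 0 q t) (jet e 0 p t1))) (proj (col_mx (E q) (jet e 0 p t1))).
  by apply: mxcvg_close.
apply: filterS2 h1 h3 => t f1 c1 _; split=> //.
by apply: mxclose_le (mxclose_trans c1 cA); lra.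
Qed.

Lemma last_path_max x y (s : seq R) :
  path <%R x s -> y \in s -> (forall z, z \in s -> z <= y) -> last x s = y.
Proof.
elim: s x => [//|z s IH] x /= /andP[xz ps]; rewrite inE => /predU1P[yz|ys] h.
  case: s ps IH h => [//|u s] /= /andP[zu _] _ h.
  have := h u; rewrite !inE eqxx orbT => /(_ isT).
  by rewrite yz leNgt zu.
by apply: IH => // u us; apply: h; rewrite inE us orbT.
Qed.

(** By compactness, only finitely many points are not good. *)
Lemma good_partition : exists es : seq R, itv_partition a b es /\
  forall k t, (k < size es)%N -> nth b (a :: es) k < t < nth b (a :: es) k.+1 -> good t.
Proof.
have hg e : a <= e <= b -> exists2 rho, 0 < rho & forall t, a <= t <= b -> t != e ->
    `|t - e| < rho -> good t.
  move=> eab; have := near_osc eab ltr01 => /near_punctP[rho r0 h].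
  exists rho => // t tab te tr; have [] // := h t tab te tr (npk N j).
  by rewrite /npk; lia.
pose rho e := xget 1 [set r | 0 < r /\ forall t, a <= t <= b -> t != e ->
    `|t - e| < r -> good t].
have rhoP e : a <= e <= b -> 0 < rho e /\ forall t, a <= t <= b -> t != e ->
    `|t - e| < rho e -> good t.
  move=> eab; have [r r0 hr] := hg e eab.
  exact: (@xgetI _ 1 [set r | 0 < r /\ _] r (conj r0 hr)).
have hc : cover_compact (`[a, b] : set R) by rewrite -compact_cover; exact: segment_compact.
have [||Ds Dab cov] := hc R (`[a, b]%classic : set R) (fun e => ball e (rho e)).
- by move=> e _; exact: ball_open.
- move=> t tab; exists t => //=; apply: ballxx.
  by move: tab; rewrite /= in_itv => /rhoP[].
pose L := [seq x <- b :: (mathcomp.finmap.finmap.enum_fset Ds) | a < x <= b].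
pose es := sort <=%R (undup L).
have mem_es x : (x \in es) = (x \in L) by rewrite mem_sort mem_undup.
have bes : b \in es by rewrite mem_es /L mem_filter hab lexx inE eqxx.
have ses : path <%R a es.
  rewrite path_sortedE; last exact: lt_trans.
  apply/andP; split.
    by apply/allP => x; rewrite mem_es mem_filter => /andP[/andP[]].
  by rewrite lt_sorted_uniq_le sort_uniq undup_uniq sort_le_sorted.
have mono i k : (i < size (a :: es))%N -> (k < size (a :: es))%N ->
    (nth b (a :: es) i < nth b (a :: es) k) = (i < k)%N.
  by move=> hi hk; apply: lt_sorted_ltn_nth.
have les x : x \in a :: es -> a <= x <= b.
  rewrite inE => /predU1P[->|]; first by rewrite lexx ltW.
  by rewrite mem_es mem_filter => /andP[/andP[/ltW -> ->]].
exists es; split.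
  split=> //.
  apply/eqP; apply: last_path_max => // x xes.
  by have /andP[] : a <= x <= b by apply: les; rewrite inE xes orbT.
move=> k t kes /andP[t1 t2].
have /les/andP[ak _] : nth b (a :: es) k \in a :: es by apply: mem_nth; exact: ltnW.
have /les/andP[_ kb] : nth b (a :: es) k.+1 \in a :: es by apply: mem_nth.
have tab : a <= t <= b by apply/andP; split; lra.
have [|e De te] := cov t; first by rewrite /= in_itv.
have eab : a <= e <= b by have := Dab e De; rewrite inE /= in_itv.
have [et|et] := eqVneq t e; last first.
  by have [_] := rhoP e eab; apply => //; move: te; rewrite /ball /= distrC.
have tL : t \in a :: es.
  rewrite inE mem_es mem_filter; apply/orP; right; apply/andP; split.
    by apply/andP; split; lra.
  by rewrite inE et De orbT.
move: t1 t2; have it := tL; rewrite -index_mem in it.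
rewrite -(nth_index b tL) !mono //; first by move=> h1; rewrite ltnS leqNgt h1.
exact: ltnW.
Qed.

End Exceptional.

Section WindowLimits.
Context {R : realType} (N : nat) (a b : R) (hab : a < b) (c : R -> 'rV[R]_N.+1) (j : nat).
Hypothesis hmild : mildly_smoothly_turning a b c j.
Implicit Types (s t e : R).

Local Notation D k := (derivn_itv a b k c).
Local Notation osc := (osc a b c).
Local Notation good := (good a b c j).
Local Notation jet := (jet a b c).

Lemma fdF_shiftk t k (P : R * R -> Prop) : (\forall z \near fdF t, P z) ->
  \forall z \near fdF t, P (z.1 + k * z.2, z.2).
Proof.
move=> /near_fdFP[rho r0 h]; apply/near_fdFP.
have k0 : 0 < `|k| + 1 by rewrite ltr_wpDl.
exists (Num.min (rho / 2) (rho / 2 / (`|k| + 1))).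
  by rewrite lt_min !divr_gt0.
move=> x h'; rewrite !lt_min => /andP[x1 _] /andP[h0 /andP[h1 h2]] /=.
rewrite ltr_pdivlMr // in h2.
apply: h; last by rewrite h0; lra.
rewrite addrAC; apply: le_lt_trans (ler_normD _ _) _.
have : `|k * h'| <= h' * (`|k| + 1).
  by rewrite normrM (gtr0_norm h0) mulrC ler_pM2l // lerDl.
lra.
Qed.

Lemma mxcvg_fdF_shiftk t k m n (M : R * R -> 'M[R]_(m, n)) A :
  mxcvg (fdF t) M A -> mxcvg (fdF t) (fun z => M (z.1 + k * z.2, z.2)) A.
Proof.
move=> h i l; apply/cvgrPdist_le => eps e0.
by apply: (fdF_shiftk k (P := fun z => `|A i l - M z i l| <= eps)); have /cvgrPdist_le := h i l; apply.
Qed.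

Lemma free_close_near T (F : set_system T) {FF : Filter F} k (M : T -> 'M[R]_(k, N.+1)) A eta :
  mxcvg F M A -> row_free A -> 0 < eta ->
  \forall z \near F, free_close eta (M z) (proj A).
Proof.
move=> cM fA e0; have h1 : \forall z \near F, row_free (M z) by apply: near_row_free cM fA.
have h2 : \forall z \near F, mxclose eta (proj (M z)) (proj A).
  by apply: mxcvg_close => //; exact: mxcvg_proj.
by apply: filterS2 h1 h2 => z ? ?; split.
Qed.

Lemma free_close_trans eta eta' k (M : 'M[R]_(k, N.+1)) Q Q' :
  free_close eta M Q -> mxclose eta' Q Q' -> free_close (eta + eta') M Q'.
Proof. by move=> [f cl] h; split=> //; exact: mxclose_trans cl h. Qed.

Lemma free_close_span eta k (M W : 'M[R]_(k, N.+1)) Q : (M <= W)%MS ->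
  free_close eta M Q -> free_close eta W Q.
Proof.
move=> MW [f cl]; split; first by have [] := row_free_sub f MW (leqnn k).
by rewrite -(proj_eqspan f MW).
Qed.

(** A window inside the grid near a point t where p derivatives are independent; the
   shift by k h covers those that begin or end at t. *)
Lemma window_uniform t p k eta : a < t < b -> (p <= j.+1)%N -> row_free (osc p t) -> 0 < eta ->
  exists2 rho, 0 < rho & forall h, 0 < h < rho ->
    free_close eta (fdmx c p (t + k * h, h)) (proj (osc p t)).
Proof.
move=> tab pj fo e0.
have cF : mxcvg (fdF t) (fun z => fdmx c p (z.1 + k * z.2, z.2)) (osc p t).
  by apply: mxcvg_fdF_shiftk; apply: (fdmx_cvg hab hmild) => //; exact: leqW.
have /near_fdFP[rho r0 hr] : \forall z \near fdF t,
    free_close eta (fdmx c p (z.1 + k * z.2, z.2)) (proj (osc p t)).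
  by apply: free_close_near.
by exists rho => // h hh; apply: (hr t h) => //; rewrite subrr normr0.
Qed.

(** Differences, from order 0, of c - c e. *)
Definition jetfd e p (z : R * R) : 'M[R]_(p, N.+1) :=
  \matrix_(i < p) (z.2 ^- i *: fd i z.2 (fun x => c x - c e) z.1).

Lemma jetfd_cvg e t p : a < t < b -> (p <= j.+1)%N -> mxcvg (fdF t) (jetfd e p) (jet e 0 p t).
Proof.
move=> tab pj i l; have ip := ltn_ord i.
have h : mxcvg (fdF t) (fun z => z.2 ^- i *: fd i z.2 c z.1 - (if i == 0%N :> nat then c e else 0))
    (jet_row a b c e i t).
  apply: mxcvgB; last exact: mxcvg_cst.
  by apply: (fd_D_cvg hab hmild) => //; lia.
rewrite /jet [X in _ --> X]mxE; apply: cvg_trans (h 0 l); apply: near_eq_cvg.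
apply: nearW => z; rewrite /jetfd [RHS]mxE fd_subr; congr (fun_of_matrix _ 0 l).
case: (nat_of_ord i) => [|i'] /=; first by rewrite expr0 invr1 !scale1r.
by rewrite !subr0.
Qed.

(** A window across e, with q sides after e and p before it; the p differences on the
   left have t1 as their last node. *)
Lemma window_straddle e t1 t2 p q eta : a < t1 < b -> a < t2 < b ->
  (p <= j.+1)%N -> (q <= j.+1)%N ->
  row_free (col_mx (jet e 0 q t2) (jet e 0 p t1)) -> 0 < eta ->
  exists2 rho, 0 < rho & forall h1 h2, 0 < h1 < rho -> 0 < h2 < rho ->
    free_close eta (col_mx (jetfd e q (t2, h2)) (jetfd e p (t1 - p.-1%:R * h1, h1)))
      (proj (col_mx (jet e 0 q t2) (jet e 0 p t1))).
Proof.
move=> t1ab t2ab pj qj fA e0.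
pose F2 := filter_prod (fdF t2) (fdF t1).
have c1 : mxcvg F2 (fun z => jetfd e q z.1) (jet e 0 q t2).
  move=> i l; apply: (cvg_comp fst (fun z => jetfd e q z i l)); first exact: cvg_fst.
  exact: (@jetfd_cvg e t2 q t2ab qj).
have c2 : mxcvg F2 (fun z => jetfd e p (z.2.1 + (- p.-1%:R) * z.2.2, z.2.2)) (jet e 0 p t1).
  move=> i l; apply: (cvg_comp snd (fun z => jetfd e p (z.1 + (- p.-1%:R) * z.2, z.2) i l)).
    exact: cvg_snd.
  by have := mxcvg_fdF_shiftk (- p.-1%:R) (@jetfd_cvg e t1 p t1ab pj); apply.
have : \forall z \near F2, free_close eta
    (col_mx (jetfd e q z.1) (jetfd e p (z.2.1 + (- p.-1%:R) * z.2.2, z.2.2)))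
    (proj (col_mx (jet e 0 q t2) (jet e 0 p t1))).
  by apply: free_close_near => //; exact: mxcvg_col_mx.
case=> -[A B] /= [/near_fdFP[r1 r10 hA] /near_fdFP[r2 r20 hB]] h.
exists (Num.min r1 r2); first by rewrite lt_min r10.
move=> h1 h2; rewrite !lt_min => /andP[h10 /andP[_ h12]] /andP[h20 /andP[h21 _]].
have := h ((t2, h2), (t1, h1)); rewrite /= mulNr; apply; split=> /=.
  by apply: hA; rewrite ?subrr ?normr0 // h20.
by apply: hB; rewrite ?subrr ?normr0 // h10.
Qed.

End WindowLimits.

(** * Integrals *)

Section Integrals.
Context {R : realType}.
Local Notation mu := (@lebesgue_measure R).

(** The antiderivative is needed slightly beyond [al, be], since the steps of the grid
   cross the end points. *)
Lemma antiderivative (f : R -> R) x0 y0 al be : x0 < al -> al < be -> be < y0 ->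
  (forall t, x0 < t < y0 -> {for t, continuous f}) ->
  exists G : R -> R, (forall t, (x0 + al) / 2 < t < (be + y0) / 2 -> is_derive t 1 G (f t)) /\
    (\int[mu]_(t in `[al, be]) (f t)%:E = (G be - G al)%:E)%E.
Proof.
move=> xa ab by_ cf; pose al' := (x0 + al) / 2; pose be' := (be + y0) / 2.
have [h1 h2] : x0 < al' < al /\ be < be' < y0 by rewrite /al' /be'; split; apply/andP; split; lra.
case/andP: h1 => h11 h12; case/andP: h2 => h21 h22.
have ci (u v : R) : x0 < u -> v < y0 -> {within `[u, v], continuous f}.
  move=> xu vy; apply: continuous_in_subspaceT => t; rewrite inE /= in_itv /= => /andP[t1 t2].
  by apply: cf; apply/andP; split; [exact: lt_le_trans t1 | exact: le_lt_trans vy].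
have fi : mu.-integrable `[al', be'] (EFin \o f).
  by apply: continuous_compact_integrable; [exact: segment_compact | exact: ci].
pose G x := (\int[mu]_(t in [set` `[al', x]]) (f t))%R.
have dG t : al' < t < be' -> is_derive t 1 G (f t).
  move=> /andP[altt tbe'].
  have [|d1 d2] := @continuous_FTC1_closed R f al' t be' tbe' fi altt.
    by apply: cf; apply/andP; split; lra.
  by apply: DeriveDef; [exact: d1 | rewrite -derive1E].
exists G; split=> //.
have dG' t : al <= t <= be -> is_derive t 1 G (f t).
  by move=> /andP[t1 t2]; apply: dG; apply/andP; split; lra.
have cG t : al <= t <= be -> {for t, continuous G}.
  by move=> /dG'[h _]; apply: differentiable_continuous; apply/derivable1_diffP.
rewrite (@continuous_FTC2 R f G al be ab) ?EFinB //.
- exact: ci.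
- split.
  + by move=> t; rewrite in_itv /= => /andP[/ltW t1 /ltW t2]; have [] := dG' t ltac:(by rewrite t1 t2).
  + by apply: cvg_at_right_filter; apply: cG; rewrite lexx ltW.
  + by apply: cvg_at_left_filter; apply: cG; rewrite lexx ltW.
- move=> t; rewrite in_itv /= => /andP[/ltW t1 /ltW t2].
  by rewrite derive1E; have [] := dG' t ltac:(by rewrite t1 t2).
Qed.

(** The finitely many points of the partition are negligible. *)
Lemma partition_integral (f : R -> \bar R) (a b : R) (es : seq R) : itv_partition a b es ->
  (forall x, 0 <= f x)%E ->
  (forall k, (k < size es)%N ->
    measurable_fun `]nth b (a :: es) k, nth b (a :: es) k.+1[ f) ->
  measurable_fun `[a, b] f /\
  (\int[mu]_(x in `[a, b]) f x = \sum_(0 <= k < size es)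
    \int[mu]_(x in `]nth b (a :: es) k, nth b (a :: es) k.+1[) f x)%E.
Proof.
move=> + f0; elim: es a => [|x s IH] a hp hm.
  rewrite (itv_partition_nil hp) set_itv1 big_nil integral_set1; split=> //.
  exact: measurable_fun_set1.
have hp' := itv_partition_cons hp.
have ax : a < x by case: hp => /= /andP[].
have xb : x <= b := itv_partition_le hp'.
have [m1 E1] := IH x hp' (fun k ks => hm k.+1 ks).
have mo : measurable_fun `]a, x[ f := hm 0%N isT.
have E : (`[a, b]%classic : set R) = [set a] `|` `]a, x[%classic `|` `[x, b]%classic.
  apply/seteqP; split=> t /=; rewrite !in_itv /=.
    move=> /andP[at_ tb]; have [tx|xt] := ltP t x; last by right; rewrite tb.
    left; move: at_; rewrite le_eqVlt => /predU1P[->|at_]; first by left.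
    by right; rewrite at_.
  case=> [[->|/andP[at_ tx]]|/andP[xt tb]].
  - by rewrite lexx ltW // (lt_le_trans ax).
  - by rewrite (ltW at_) (le_trans (ltW tx)).
  - by rewrite tb (le_trans (ltW ax)).
have mU : measurable_fun `[a, b] f.
  rewrite E; apply/measurable_funU => //; first exact: measurableU.
  split=> //; apply/measurable_funU => //; split=> //; exact: measurable_fun_set1.
split=> //; rewrite big_nat_recl //= -E1 E.
have mA : measurable ([set a] `|` `]a, x[%classic : set R) by exact: measurableU.
have disj : [disjoint ([set a] `|` `]a, x[%classic : set R) & (`[x, b]%classic : set R)].
  rewrite disj_set2E; apply/eqP/seteqP; split=> // y [[->|]] /=.
    by rewrite in_itv /= leNgt ax.
  by rewrite !in_itv /= => /andP[_ yx] /andP[]; rewrite leNgt yx.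
rewrite ge0_integral_setU //; last by rewrite -E.
congr (_ + _)%E; rewrite setU1itv ?bnd_simp //.
rewrite integral_itv_obnd_cbnd //.
Qed.

(** The integrals are squeezed between those on increasing compact sets and the
   integral on the whole gap. *)
Lemma gap_integral_cvg (f : R -> \bar R) (x y : R) (al be : nat -> R) : x < y ->
  (forall t, 0 <= f t)%E -> measurable_fun `]x, y[ f ->
  (forall n, x < al n /\ al n < x + n.+1%:R^-1) -> (forall n, y - n.+1%:R^-1 < be n /\ be n < y) ->
  (fun n => \int[mu]_(t in `[al n, be n]) f t)%E @ \oo --> (\int[mu]_(t in `]x, y[) f t)%E.
Proof.
move=> xy f0 mf hal hbe.
pose S (n : nat) : set R := `[x + n.+1%:R^-1, y - n.+1%:R^-1]%classic.
have sub (u v : R) : x < u -> v < y -> `[u, v]%classic `<=` `]x, y[%classic.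
  by move=> xu vy t /=; rewrite !in_itv /= => /andP[t1 t2]; apply/andP; split; lra.
have n0 n : 0 < n.+1%:R^-1 :> R by rewrite invr_gt0.
have mS n : measurable_fun (S n) f.
  by apply: measurable_funS mf => //; apply: sub; rewrite ?ltrDl ?gtrBl n0.
have c1 : (fun n => \int[mu]_(t in S n) f t)%E @ \oo --> (\int[mu]_(t in `]x, y[) f t)%E.
  have -> : (`]x, y[%classic : set R) = \bigcup_n S n.
    apply/seteqP; split=> [t /=|t [n _]]; last first.
      by apply: sub; rewrite ?ltrDl ?gtrBl n0.
    rewrite in_itv /= => /andP[xt ty].
    have d0 : 0 < Num.min (t - x) (y - t) by rewrite lt_min !subr_gt0 xt.
    have [n _ /(_ n (leqnn n))] := near_infty_natSinv_lt (PosNum d0).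
    rewrite /= lt_min => /andP[n1 n2]; exists n => //=.
    rewrite /S /= in_itv /=; move: (n.+1%:R^-1) n1 n2 => u n1 n2.
    by apply/andP; split; lra.
  apply: ge0_nondecreasing_set_cvg_integral => //; last by move=> i; exact: measurable_itv.
  apply/nondecreasing_seqP => n; rewrite subsetEset => t; rewrite /S /= !in_itv /= => /andP[t1 t2].
  have h : n.+2%:R^-1 <= n.+1%:R^-1 :> R by rewrite lef_pV2 ?posrE // ler_nat.
  move: (n.+2%:R^-1) (n.+1%:R^-1) t1 t2 h => u v t1 t2 h.
  by apply/andP; split; lra.
apply: (@squeeze_cvge _ _ _ _ (fun n => \int[mu]_(t in S n) f t)%E _
    (fun=> \int[mu]_(t in `]x, y[) f t)%E) => //; last exact: cvg_cst.
apply: nearW => n; have [a1 a2] := hal n; have [b1 b2] := hbe n.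
have m1 : measurable_fun `[al n, be n] f.
  by apply: measurable_funS mf => //; exact: sub.
apply/andP; split; apply: ge0_subset_integral => //.
- exact: measurable_itv.
- move=> t; rewrite /S /= !in_itv /=; move: (n.+1%:R^-1) a2 b1 => u a2 b1 /andP[t1 t2].
  by apply/andP; split; lra.
- exact: sub.
Qed.

(** A compact interval covered by neighbourhoods on which a property holds for
   small steps has a step that fits everywhere. *)
Lemma uniform_step (P : R -> R -> Prop) (al be : R) :
  (forall t, al <= t <= be -> exists2 rho, 0 < rho & forall x h, `|x - t| < rho ->
    0 < h < rho -> P x h) ->
  exists2 rho, 0 < rho & forall x h, al <= x <= be -> 0 < h < rho -> P x h.
Proof.
move=> hP.
have /compact_near_coveringP/(_ R (0 : R)^'+ (fun h x => P x h)) := @segment_compact R al be.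
move=> /(_ _ _) [].
  move=> t; rewrite /= in_itv /= => /hP[rho r0 hr].
  exists ([set x | `|x - t| < rho], [set h | 0 < h < rho]) => /=.
    split; first by apply/near_nbhsP; exists rho.
    suff : \forall u \near nbhs (0 : R), 0 < u -> 0 < u < rho by [].
    apply/near_nbhsP; exists rho => // u.
    by rewrite subr0 ltr_norml => /andP[_ ur] u0; rewrite u0.
  by move=> [x h] /= [h1 h2]; exact: hr.
move=> rho /= r0 hr; exists rho => // x h xab /andP[h0 h1].
by apply: (hr h) => //=; rewrite ?sub0r ?normrN ?gtr0_norm ?in_itv.
Qed.

End Integrals.

(** * The inscribed polygonal *)

Section Grid.
Context {R : realType} {N : nat} (a b : R) (c : R -> 'rV[R]_N.+1).
Variables (e : nat -> R) (K M : nat) (d d' : R).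
Hypotheses (K0 : (0 < K)%N) (M0 : (0 < M)%N) (d0 : 0 < d) (d'0 : 0 < d').

Definition gleft k := e k + d'.
Definition gright k := e k.+1 - d.
Definition gstep k := (gright k - gleft k) / M%:R.

(** In the k-th block of M + 2 indices, e k comes first and then the M + 1 points of a
   uniform grid from gleft k to gright k. *)
Definition node t : R :=
  let k := (t %/ (M + 2))%N in
  if (t %% (M + 2))%N is i.+1 then gleft k + i%:R * gstep k else e k.

(** Each gap contributes M + 2 sides: one after e k, M in the grid, one before
   e (k + 1). *)
Definition ngrid := (K * (M + 2))%N.

Definition grid_polygonal : seq 'rV[R]_N.+1 := map c [seq node t | t <- iota 0 ngrid.+1].

Hypothesis gap : forall k, (k < K)%N -> gleft k < gright k.

Lemma node_e k : node (k * (M + 2)) = e k.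
Proof. by rewrite /node modnMl mulnK // addn2. Qed.

Lemma node_grid k i : (i <= M)%N -> node (k * (M + 2) + i.+1) = gleft k + i%:R * gstep k.
Proof.
move=> iM; have iM2 : (i.+1 < M + 2)%N by lia.
by rewrite /node modnMDl modn_small // divnMDl ?addn2 // divn_small ?addn0 // -addn2.
Qed.

Lemma gstep_gt0 k : (k < K)%N -> 0 < gstep k.
Proof. by move=> kK; rewrite divr_gt0 ?subr_gt0 ?gap // ltr0n. Qed.

Lemma gright_step k : gright k = gleft k + M%:R * gstep k.
Proof. by rewrite /gstep mulrC mulfVK ?pnatr_eq0 -?lt0n // addrC subrK. Qed.

Lemma nodeS t : (t < ngrid)%N -> node t < node t.+1 /\
  exists2 k, (k < K)%N & node t.+1 - node t <= Num.max (Num.max d d') (gstep k).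
Proof.
move=> tg; pose k := (t %/ (M + 2))%N; pose i := (t %% (M + 2))%N.
have tE : t = (k * (M + 2) + i)%N by exact: divn_eq.
have iM : (i < M + 2)%N by rewrite ltn_mod addn2.
have kK : (k < K)%N by rewrite ltn_divLR ?addn2 // -addn2.
have sp := gstep_gt0 kK.
case: i tE iM => [|i] tE iM.
  rewrite tE addn0 node_e -addn1 node_grid // mul0r addr0 /gleft; split; first by rewrite ltrDl.
  by exists k => //; rewrite addrAC subrr add0r !le_max lexx orbT.
have [iM'|iM'] := ltnP i M.
  rewrite tE -addnS !node_grid ?(ltnW iM') //; split.
    by rewrite ltrD2l ltr_pM2r // ltr_nat.
  exists k => //; rewrite !le_max; apply/orP; right.
  by rewrite -natr1 mulrDl mul1r addrA [X in X <= _]addrAC subrr add0r.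
have iE : i = M by lia.
rewrite tE iE node_grid // -gright_step.
have -> : (k * (M + 2) + M.+1).+1 = (k.+1 * (M + 2))%N by rewrite mulSn; lia.
rewrite node_e /gright; split; first by rewrite gtrBl.
by exists k => //; rewrite opprB addrC subrK !le_max lexx.
Qed.

Lemma node_mono t u : (t <= u <= ngrid)%N -> node t <= node u.
Proof.
move=> /andP[tu]; rewrite -(subnKC tu); elim: (u - t)%N => [|m IH]; first by rewrite addn0.
rewrite addnS => h; apply: le_trans (IH (ltnW h)) _.
by have [/ltW] := nodeS h.
Qed.

Lemma size_grid : nseg grid_polygonal = ngrid.
Proof. by rewrite /nseg /grid_polygonal !size_map size_iota. Qed.

Lemma nth_grid t : (t <= ngrid)%N -> nth 0 grid_polygonal t = c (node t).
Proof.
move=> tg; rewrite /grid_polygonal (nth_map 0) ?size_map ?size_iota //.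
by rewrite (nth_map 0%N) ?size_iota // nth_iota.
Qed.

Lemma segment_grid t : (t < ngrid)%N -> segment grid_polygonal t = c (node t.+1) - c (node t).
Proof. by move=> tg; rewrite /segment !nth_grid // ltnW. Qed.

Lemma inscribed_grid : e 0%N = a -> e K = b -> inscribed a b c grid_polygonal.
Proof.
move=> ea eb; have n0 : node 0 = a by have := node_e 0; rewrite mul0n ea.
exists [seq node t | t <- iota 1 ngrid]; last first.
  by rewrite /grid_polygonal /= n0.
have P m n : (m + n <= ngrid)%N -> path <%R (node m) [seq node t | t <- iota m.+1 n].
  elim: n m => //= n IH m mn; rewrite IH ?andbT; last by rewrite addSnnS.
  by have [|] := @nodeS m; first by lia.
have L m n : last (node m) [seq node t | t <- iota m.+1 n] = node (m + n).
  by elim: n m => [|n IH] m /=; rewrite ?addn0 // IH addSnnS.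
split; first by rewrite -n0; exact: P.
by rewrite -n0 L add0n /ngrid node_e eb.
Qed.

Lemma mesh_grid eps : (forall s t, a <= s -> s <= t -> t <= b -> enorm (c t - c s) <= t - s) ->
  e 0%N = a -> e K = b -> 0 <= eps -> d <= eps -> d' <= eps -> (forall k, (k < K)%N -> gstep k <= eps) ->
  mesh grid_polygonal <= eps.
Proof.
move=> chord ea eb eps0 de d'e se; rewrite /mesh.
apply: (big_ind (fun x => x <= eps)) => // [x y hx hy|t _]; first by rewrite ge_max hx.
have tg : (t < ngrid)%N by rewrite -size_grid ltn_ord.
rewrite segment_grid //; have [lt [k kK h]] := nodeS tg.
apply: le_trans (chord _ _ _ (ltW lt) _) _.
- have n0 : node 0 = a by have := node_e 0; rewrite mul0n ea.
  by rewrite -n0; apply: node_mono; lia.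
- by rewrite -eb -(node_e K); apply: node_mono; rewrite -/ngrid; lia.
- by apply: le_trans h _; rewrite !ge_max de d'e se.
Qed.

(** A chord is the sum of the sides under it. *)
Lemma chord_submx t p u v : (t <= u)%N -> (u <= t + p)%N -> (t <= v)%N -> (v <= t + p)%N ->
  (t + p <= ngrid)%N ->
  (c (node v) - c (node u) <= segmx grid_polygonal p t)%MS.
Proof.
move=> tu up tv vp pg.
have H w : (t <= w)%N -> (w <= t + p)%N -> (c (node w) - c (node t) <= segmx grid_polygonal p t)%MS.
  move=> tw; rewrite -(subnKC tw); elim: (w - t)%N => [|m IH] mp.
    by rewrite addn0 subrr sub0mx.
  have -> : c (node (t + m.+1)) - c (node t) =
      (c (node (t + m).+1) - c (node (t + m))) + (c (node (t + m)) - c (node t)).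
    by rewrite addnS addrA subrK.
  have mp' : (m < p)%N by lia.
  rewrite addmx_sub ?IH //; last by lia.
  rewrite -segment_grid; last by lia.
  rewrite (_ : segment _ _ = row (Ordinal mp') (segmx grid_polygonal p t)) ?row_sub //.
  by apply/rowP => l; rewrite !mxE.
have -> : c (node v) - c (node u) = (c (node v) - c (node t)) - (c (node u) - c (node t)).
  by rewrite opprB addrA subrK.
by rewrite addmx_sub ?eqmx_opp ?H.
Qed.

Lemma fdmx_submx k p i : (k < K)%N -> (i + p <= M)%N ->
  (fdmx c p (gleft k + i%:R * gstep k, gstep k)%R <=
    segmx grid_polygonal p (k * (M + 2) + i.+1))%MS.
Proof.
move=> kK ipM; apply/row_subP => l; have lp := ltn_ord l.
have kg : ((k * (M + 2) + i.+1) + p <= ngrid)%N.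
  have : (k.+1 * (M + 2) <= K * (M + 2))%N by rewrite leq_mul2r kK orbT.
  by rewrite /ngrid mulSn; lia.
rewrite rowK scalemx_sub // [(_, _).2]/= [(_, _).1]/= fdS; apply: fd_submx => m ml.
have -> : gleft k + i%:R * gstep k + m%:R * gstep k + gstep k =
    gleft k + (i + m.+1)%:R * gstep k.
  by rewrite natrD -natr1; ring.
have -> : gleft k + i%:R * gstep k + m%:R * gstep k = gleft k + (i + m)%:R * gstep k.
  by rewrite natrD; ring.
rewrite -!node_grid; [|lia|lia].
apply: chord_submx => //; lia.
Qed.

Lemma straddle_submx k p q t : (k <= K)%N -> (t + p = k * (M + 2))%N -> (p <= M.+1)%N -> (q <= M.+1)%N ->
  (t + (q + p) <= ngrid)%N ->
  (col_mx (jetfd c (e k) q (gleft k, gstep k))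
          (jetfd c (e k) p (gright k.-1 - p.-1%:R * gstep k.-1, gstep k.-1)%R) <=
    segmx grid_polygonal (q + p) t)%MS.
Proof.
move=> kK tp pM qM qpg; rewrite col_mx_sub; apply/andP; split; apply/row_subP => l;
  have lp := ltn_ord l; rewrite rowK scalemx_sub // [(_, _).2]/= [(_, _).1]/=;
  apply: fd_submx => m ml; rewrite -(node_e k).
  rewrite -node_grid; last by lia.
  by apply: chord_submx; lia.
have k0 : (0 < k)%N by case: k kK tp {ml} => //= _; rewrite mul0n; lia.
have kE : (k * (M + 2) = k.-1 * (M + 2) + (M + 2))%N by rewrite -{1}(prednK k0) mulSn addnC.
rewrite gright_step.
have -> : gleft k.-1 + M%:R * gstep k.-1 - p.-1%:R * gstep k.-1 + m%:R * gstep k.-1 =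
    gleft k.-1 + (M - p.-1 + m)%:R * gstep k.-1.
  by rewrite natrD natrB; [ring|lia].
rewrite -node_grid; last by lia.
by apply: chord_submx; lia.
Qed.

End Grid.

Lemma sum_blocks (R : nmodType) (f : nat -> R) K m :
  \sum_(t < K * m) f t = \sum_(k < K) \sum_(i < m) f (k * m + i)%N.
Proof.
elim: K => [|K IH]; first by rewrite mul0n !big_ord0.
by rewrite mulSnr big_split_ord big_ord_recr /= IH.
Qed.

Section GridLength.
Context {R : realType} {N : nat} (a b : R) (c : R -> 'rV[R]_N.+1).
Variables (e : nat -> R) (K M : nat) (d d' : R) (j r : nat).
Hypotheses (hN : (3 <= N)%N) (hj : (1 <= j <= N)%N) (hr : r = (npicks N j).+1).
Hypotheses (K0 : (0 < K)%N) (M0 : (2 * (j + 4) <= M)%N) (d0 : 0 < d) (d'0 : 0 < d').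
Local Notation gleft := (gleft e d').
Local Notation gright := (gright e d).
Local Notation gstep := (gstep e M d d').
Local Notation ngrid := (ngrid K M).
Local Notation P := (grid_polygonal c e K M d d').
Local Notation Q k := (oscproj a b c (e k)).
Hypothesis gap : forall k, (k < K)%N -> gleft k < gright k.
Hypothesis open : ~~ closed_polygonal P.
Variables (eta : R) (eps D : R) (G : nat -> R -> R).
Hypotheses (eta0 : 0 <= eta) (eta1 : 4 * N.+1%:R * eta <= 1) (eps0 : 0 <= eps).
(* The spans of windows just after, just before and across each e k. *)
Hypothesis right_window : forall k, (k < K)%N -> forall p i, (p <= j.+1)%N -> (i <= 1)%N ->
  free_close eta (fdmx c p (gleft k + i%:R * gstep k, gstep k)) (Q k p).
Hypothesis left_window : forall k, (k < K)%N -> forall p, (p <= j.+1)%N ->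
  free_close eta (fdmx c p (gright k - p%:R * gstep k, gstep k)) (Q k.+1 p).
Hypothesis straddling_window : forall k, (k <= K)%N -> forall p q, (q + p <= j.+1)%N ->
  (k = 0%N -> p = 0%N) -> (k = K -> q = 0%N) ->
  free_close eta (col_mx (jetfd c (e k) q (gleft k, gstep k))
      (jetfd c (e k) p (gright k.-1 - p.-1%:R * gstep k.-1, gstep k.-1))) (Q k (q + p)).
(* Inside a gap, normals turn by the increments of G k, up to eps per unit of length. *)
Hypothesis inner_window : forall k, (k < K)%N -> forall x, gleft k <= x <= gright k ->
  [/\ row_free (fdmx c (npk N j) (x, gstep k)),
      row_free (fdmx c j (x + (j < N)%:R * gstep k, gstep k)) &
      forall u v : 'rV[R]_N.+1, dot u u = 1 -> dot v v = 1 ->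
        u^T *m u = wnproj c j (x, gstep k) -> v^T *m v = wnproj c j (x + gstep k, gstep k) ->
        `|rp_dist u v - (G k (x + gstep k) - G k x)| <= eps * gstep k].
Hypothesis gap_end : forall k, (k < K)%N ->
  `|G k (gright k) - G k (gright k - r%:R * gstep k)| <= eps.
Hypothesis gap_le : forall k, (k < K)%N -> gright k - gleft k <= D.

Let M1 : (0 < M)%N. Proof. by lia. Qed.
Let rj : (r <= j.+1)%N. Proof. by rewrite hr /npicks; lia. Qed.
Let rE : r = npk N j. Proof. by rewrite hr /npicks /npk; lia. Qed.
Let rN : r = (j + (j < N))%N. Proof. by rewrite hr /npicks; lia. Qed.
Let gstep0 k : (k < K)%N -> 0 < gstep k. Proof. exact: gstep_gt0. Qed.

Lemma block_le k : (k < K)%N -> (k * (M + 2) + (M + 2) <= ngrid)%N.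
Proof. by move=> kK; rewrite -mulSnr leq_mul2r kK orbT. Qed.

(** A window that comes within two nodes of e k falls under one of the three
   assumptions: it lies after e k, before it, or across. *)
Lemma near_window k p t : (k <= K)%N -> (p <= j.+1)%N -> (k * (M + 2) <= t + p + 1)%N ->
  (t <= k * (M + 2) + 2)%N -> (t + p <= ngrid)%N -> free_close eta (segmx P p t) (Q k p).
Proof.
move=> kK pj h1 h2 h3; have [tr|tl] := ltnP (k * (M + 2)) t.
  have kK' : (k < K)%N.
    rewrite ltn_neqAle kK andbT; apply/eqP => kE; move: h3; rewrite /ngrid -kE; lia.
  pose i := (t - k * (M + 2)).-1; have i1 : (i <= 1)%N by rewrite /i; lia.
  have -> : t = (k * (M + 2) + i.+1)%N by rewrite /i; lia.
  apply: free_close_span (right_window kK' pj i1).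
  by apply: (@fdmx_submx _ _ c e K M d d') => //; lia.
have [tl'|tr] := ltnP (t + p) (k * (M + 2)).
  case: k => [|k] in kK h1 h2 tl tl' *; first by rewrite mul0n in tl'.
  have kE : (k.+1 * (M + 2) = k * (M + 2) + (M + 2))%N by rewrite mulSnr.
  have tE : t = (k * (M + 2) + (M - p).+1)%N by lia.
  rewrite tE; apply: free_close_span (left_window kK pj).
  have -> : gright k - p%:R * gstep k = gleft k + (M - p)%:R * gstep k.
    by rewrite (@gright_step _ e M d d') // natrB; [ring|lia].
  by apply: (@fdmx_submx _ _ c e K M d d') => //; lia.
pose p' := (k * (M + 2) - t)%N; pose q := (p - p')%N.
have pE : p = (q + p')%N by rewrite /q /p'; lia.
rewrite pE in pj h3 *; apply: free_close_span (straddling_window kK pj _ _).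
- by apply: (@straddle_submx _ _ c e K M d d') => //; rewrite /p' /q; lia.
- by move=> k0; rewrite /p' k0 mul0n.
- by move=> kE; move: h3; rewrite /ngrid -kE /q /p'; lia.
Qed.

Lemma divn_block t : (t < ngrid)%N -> exists k i, [/\ (k < K)%N, (i < M + 2)%N &
  t = (k * (M + 2) + i)%N].
Proof.
move=> tg; exists (t %/ (M + 2))%N, (t %% (M + 2))%N; split.
- by rewrite ltn_divLR ?addn2 // -addn2.
- by rewrite ltn_mod addn2.
- exact: divn_eq.
Qed.

Lemma inner_node k l : (k < K)%N -> (l <= M)%N ->
  gleft k <= gleft k + l%:R * gstep k <= gright k.
Proof.
move=> kK lM; have s0 := ltW (gstep0 kK).
by rewrite (@gright_step _ e M d d') // lerDl mulr_ge0 // lerD2l ler_wpM2r // ler_nat.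
Qed.

(** A window is either near some e k or inside a gap. *)
Lemma grid_free t : (t + r <= nseg P)%N -> row_free (segmx P r t).
Proof.
rewrite size_grid => tr; have [|k [i [kK iM tE]]] := @divn_block t; first by lia.
have [i2|i2] := leqP i 2.
  by have [|||||] // := @near_window k r t; lia.
have [ir|ir] := ltnP (i + r) (M + 2); last first.
  have kE : (k.+1 * (M + 2) = k * (M + 2) + (M + 2))%N by rewrite mulSnr.
  by have [|||||] // := @near_window k.+1 r t; lia.
case: i => [//|i] in iM tE i2 ir *.
have iM' : (i <= M)%N by lia.
have [+ _ _] := inner_window kK (inner_node kK iM').
rewrite -rE tE => f; have h : (i + r <= M)%N by lia.
have := @fdmx_submx _ _ c e K M d d' K0 M1 d0 d'0 k r i kK h.
by move=> /(row_free_sub f)/(_ (leqnn r)) [].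
Qed.

Let rP : (r <= nseg P)%N.
Proof. by rewrite size_grid; have := block_le K0; lia. Qed.

Let NP t : (t + r <= nseg P)%N -> dot (normal_at j P t) (normal_at j P t) = 1 /\
  (normal_at j P t)^T *m normal_at j P t = window_nproj j P t.
Proof. exact: (normal_atP hN hj hr open rP grid_free). Qed.

Definition arc t := rp_dist (normal_at j P t) (normal_at j P t.+1).

Lemma arc_last t : (nseg P - r <= t)%N -> arc t = 0.
Proof.
move=> h; rewrite /arc !(@normal_at_stop R N j r P hN hj hr open rP) ?(leqW h) //.
by apply: rp_dist_xx; exact: (normal_at_unit hN hj hr open rP grid_free).
Qed.

Lemma near_nproj k t : (k <= K)%N -> (k * (M + 2) <= t + r + 1)%N ->
  (t <= k * (M + 2) + 1)%N -> (t + r <= ngrid)%N ->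
  mxclose (eta + eta) (window_nproj j P t)
    ((if (N <= j)%N then 1%:M else Q k j.+1) - Q k j).
Proof.
move=> kK h1 h2 h3; rewrite /window_nproj /nproj; apply: mxcloseB; last first.
  by have [|||||] // := @near_window k j (t + (j < N)); move: rN; lia.
case: leqP => jN; first exact: mxclose_refl.
by have [|||||] // := @near_window k j.+1 t; move: rN; lia.
Qed.

Local Notation C := (8 * N.+1%:R * eta).

(** The normals at the ends of the arc come from two windows close to the same pair of
   spans. *)
Lemma arc_near k t : (k <= K)%N -> (k * (M + 2) <= t + r + 1)%N -> (t <= k * (M + 2))%N ->
  `|arc t| <= C.
Proof.
move=> kK h1 h2; have C0 : 0 <= C by rewrite !mulr_ge0.
have [h|h] := leqP (nseg P - r) t; first by rewrite arc_last ?normr0.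
have [|u1 u2] := NP (t := t); first by lia.
have [|v1 v2] := NP (t := t.+1); first by lia.
rewrite size_grid in h.
have cl : mxclose (4 * eta) (window_nproj j P t) (window_nproj j P t.+1).
  have w1 : mxclose _ _ _ := @near_nproj k t kK ltac:(lia) ltac:(lia) ltac:(lia).
  have w2 : mxclose _ _ _ := @near_nproj k t.+1 kK ltac:(lia) ltac:(lia) ltac:(lia).
  by apply: mxclose_le (mxclose_trans w1 (mxclose_sym w2)); lra.
have f := frob2_close cl; rewrite -u2 -v2 in f.
have E : (N.+1 * N.+1)%:R * (4 * eta) ^+ 2 = (4 * N.+1%:R * eta) ^+ 2 :> R.
  by rewrite natrM; ring.
rewrite E in f.
have x0 : 0 <= 4 * N.+1%:R * eta by rewrite !mulr_ge0.
have CE : C = 2 * (4 * N.+1%:R * eta) by ring.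
move: (4 * N.+1%:R * eta) x0 CE f eta1 => x x0 CE f x1.
have f1 : frob2 ((normal_at j P t)^T *m normal_at j P t -
    (normal_at j P t.+1)^T *m normal_at j P t.+1) <= 1.
  by apply: le_trans f _; rewrite expr_le1.
have := rp_dist_le_frob u1 v1 f1; rewrite -/(arc t) => h4.
have a0 : 0 <= arc t := rp_dist_ge0 u1 v1.
rewrite ger0_norm // CE -(@ler_pXn2r _ 2) ?nnegrE //; last by lra.
by apply: le_trans h4 _; rewrite exprMn; nra.
Qed.

Lemma arc_inner k l : (k < K)%N -> (l + r < M)%N ->
  `|arc (k * (M + 2) + l.+1) - (G k (gleft k + l.+1%:R * gstep k) - G k (gleft k + l%:R * gstep k))|
    <= eps * gstep k.
Proof.
move=> kK lr; have kg := block_le kK; set x := gleft k + l%:R * gstep k.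
have xS : gleft k + l.+1%:R * gstep k = x + gstep k by rewrite -natr1 /x; ring.
have np i : (i + r <= M)%N ->
    window_nproj j P (k * (M + 2) + i.+1) = wnproj c j (gleft k + i%:R * gstep k, gstep k).
  move=> ir; have iM : (i <= M)%N by lia.
  have [f1 f2 _] := inner_window kK (inner_node kK iM).
  rewrite /window_nproj /wnproj /full /nproj; congr (_ - _).
    have [//|jN] := leqP N j.
    have sub := @fdmx_submx _ _ c e K M d d' K0 M1 d0 d'0 k j.+1 i kK.
    rewrite -rE in f1.
    by apply/esym/proj_eqspan; [move: f1; rewrite rN jN addn1 | apply: sub; move: rN; lia].
  have bE : gleft k + i%:R * gstep k + (j < N)%:R * gstep k = gleft k + (i + (j < N))%:R * gstep k.
    by rewrite natrD; ring.
  rewrite /= bE in f2 *; apply/esym/proj_eqspan => //.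
  have := @fdmx_submx _ _ c e K M d d' K0 M1 d0 d'0 k j (i + (j < N)) kK.
  by rewrite -addSn addnA; apply; move: rN; lia.
have lM : (l <= M)%N by lia.
have [_ _ h] := inner_window kK (inner_node kK lM).
have [|u1 u2] := NP (t := (k * (M + 2) + l.+1)%N); first by rewrite size_grid; lia.
have [|v1 v2] := NP (t := (k * (M + 2) + l.+1).+1); first by rewrite size_grid; lia.
rewrite xS /arc; apply: h => //; first by rewrite u2 np //; lia.
by rewrite v2 -addnS np; [rewrite xS | lia].
Qed.

(** The arcs that are not inside the gap are r + 2: the one at e k, and the last r + 1
   of the block, whose windows reach e (k + 1). The increments of G over the others
   telescope up to r steps before gright k. *)
Lemma block_length k : (k < K)%N ->
  `|\sum_(i < M + 2) arc (k * (M + 2) + i) - (G k (gright k) - G k (gleft k))|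
    <= eps * (D + 1) + r.+2%:R * C.
Proof.
move=> kK; have s0 := gstep0 kK; have C0 : 0 <= C by rewrite !mulr_ge0.
pose f i := arc (k * (M + 2) + i).
have ME : (M + 2 = (M - r).+1 + r.+1)%N by lia.
have -> : \sum_(i < M + 2) arc (k * (M + 2) + i) =
    f 0%N + \sum_(l < M - r) f l.+1 + \sum_(l < r.+1) f ((M - r).+1 + l)%N.
  rewrite -(big_mkord xpredT f) ME big_mkord big_split_ord big_ord_recl /=.
  by congr (_ + _ + _).
have b0 : `|f 0%N| <= C by apply: (@arc_near k); lia.
have b2 : `|\sum_(l < r.+1) f ((M - r).+1 + l)%N| <= r.+1%:R * C.
  apply: le_trans (ler_norm_sum _ _ _) _.
  rewrite mulr_natl -[X in C *+ X]card_ord -sumr_const; apply: ler_sum => l _.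
  have lr := ltn_ord l; have kE : (k.+1 * (M + 2) = k * (M + 2) + (M + 2))%N by rewrite mulSnr.
  by apply: (@arc_near k.+1) => //; lia.
pose x l := gleft k + l%:R * gstep k.
have b1 : `|\sum_(l < M - r) f l.+1 - (G k (x (M - r)%N) - G k (x 0%N))| <= eps * D.
  rewrite -(telescope_sumr (fun l => G k (x l))) // big_mkord -sumrB.
  apply: le_trans (ler_norm_sum _ _ _) _.
  apply: (@le_trans _ _ (\sum_(l < M - r) (eps * gstep k))).
    by apply: ler_sum => l _; apply: arc_inner => //; have := ltn_ord l; lia.
  rewrite sumr_const card_ord -mulr_natr -mulrA ler_wpM2l //.
  apply: le_trans (gap_le kK); rewrite (@gright_step _ e M d d') // addrAC subrr add0r mulrC.
  by rewrite ler_wpM2r ?ler_nat ?leq_subr // ltW.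
have x0 : x 0%N = gleft k by rewrite /x mul0r addr0.
have xM : x (M - r)%N = gright k - r%:R * gstep k.
  by rewrite /x (@gright_step _ e M d d') // natrB; [ring|lia].
have b3 := gap_end kK.
rewrite x0 xM in b1; rewrite -natr1 mulrDl mul1r -/C.
move: b0 b1 b2 b3; rewrite !ler_norml => /andP[? ?] /andP[? ?] /andP[? ?] /andP[? ?].
by apply/andP; split; lra.
Qed.

Lemma grid_length : exists2 L, discrete_normal_length j P = L%:E &
  `|L - \sum_(k < K) (G k (gright k) - G k (gleft k))| <= K%:R * (eps * (D + 1) + r.+2%:R * C).
Proof.
rewrite (discrete_normal_lengthE hN hj hr open rP grid_free); eexists; first by [].
have -> : \sum_(k < (nseg P).-1) rp_dist (normal_at j P k) (normal_at j P k.+1) =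
    \sum_(k < K) \sum_(i < M + 2) arc (k * (M + 2) + i).
  rewrite -sum_blocks -/ngrid -(size_grid c e K M d d').
  have n0 : (0 < nseg P)%N by move: rP hr; lia.
  rewrite -[in RHS](prednK n0) big_ord_recr /= arc_last ?addr0 //; move: hr; lia.
rewrite -sumrB; apply: le_trans (ler_norm_sum _ _ _) _.
rewrite mulr_natl -[X in _ *+ X]card_ord -sumr_const.
by apply: ler_sum => k _; exact: block_length.
Qed.

Lemma grid_polygonalP : polygonal P /\ has_discrete_normal j P.
Proof.
split; first exact: (polygonalP hN hj hr open rP grid_free).
exact: (has_normal hN hj hr open rP grid_free).
Qed.

End GridLength.

(** * The choice of the parameters *)

Section Gaps.
Context {R : realType} (N : nat) (a b : R) (hab : a < b) (c : R -> 'rV[R]_N.+1) (j : nat).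
Hypothesis hmild : mildly_smoothly_turning a b c j.
Hypothesis hj : (1 <= j <= N)%N.
Local Notation good := (good a b c j).
Local Notation nspeed := (nspeed a b c j).
Local Notation mu := (@lebesgue_measure R).

Lemma nspeed_continuous t : a < t < b -> good t -> {for t, continuous nspeed}.
Proof.
move=> tab gt; apply/cvgrPdist_le => eps e0.
have tab' : a <= t <= b by case/andP: tab => /ltW -> /ltW ->.
have [rho r0 h] := cwithin_interior tab (nspeed_cvg hab hmild hj tab' gt) e0.
move: (nspeed) h => f h.
by apply/near_nbhsP; exists rho => // u ut; rewrite distrC; exact: h.
Qed.

(** On a compact part of a gap, the discrete normal turns by the increments of an
   antiderivative of the speed, up to a small fraction of the step. *)
Lemma inner_uniform x0 y0 al be eps (r : nat) : a <= x0 -> y0 <= b -> x0 < al -> al < be -> be < y0 ->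
  (forall t, x0 < t < y0 -> good t) -> 0 < eps ->
  exists G : R -> R,
  [/\ (\int[mu]_(t in `[al, be]) (nspeed t)%:E = (G be - G al)%:E)%E,
      exists2 rho, 0 < rho & forall x h, al <= x <= be -> 0 < h < rho ->
      [/\ row_free (fdmx c (npk N j) (x, h)), row_free (fdmx c j (x + (j < N)%:R * h, h)) &
        forall u v : 'rV[R]_N.+1, dot u u = 1 -> dot v v = 1 ->
        u^T *m u = wnproj c j (x, h) -> v^T *m v = wnproj c j (x + h, h) ->
        `|rp_dist u v - (G (x + h) - G x)| <= eps * h] &
      exists2 rho, 0 < rho & forall h, 0 < h < rho -> `|G be - G (be - r%:R * h)| <= eps].
Proof.
move=> ax yb xa ab_ by_ hg e0.
have nj : (npk N j <= j.+2)%N by rewrite /npk; lia.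
have jj : (j <= j.+2)%N by lia.
have jn : (j <= npk N j)%N by rewrite /npk; lia.
have inab t : x0 < t < y0 -> a < t < b.
  by move=> /andP[t1 t2]; apply/andP; split; lra.
have cs t : x0 < t < y0 -> {for t, continuous nspeed}.
  by move=> ht; apply: nspeed_continuous; [exact: inab | exact: hg].
have [G [dG iG]] := antiderivative xa ab_ by_ cs.
exists G; split=> //.
  apply: uniform_step => t tab.
  have ht : x0 < t < y0 by case/andP: tab => t1 t2; apply/andP; split; lra.
  have gt := hg t ht; have tt := inab t ht.
  have tt' : a <= t <= b by case/andP: tt => /ltW -> /ltW ->.
  have e20 : 0 < eps / 2 by lra.
  have n1 : \forall z \near fdF t, row_free (fdmx c (npk N j) z).
    apply: (@near_row_free R _ (fdF t) _ _ _ _ (osc a b c (npk N j) t)) => //.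
    exact: (fdmx_cvg hab hmild tt nj).
  have n2 : \forall z \near fdF t, row_free (fdmx c j (z.1 + (j < N)%:R * z.2, z.2)).
    apply: (@fdF_shiftk R t (j < N)%:R (fun z => row_free (fdmx c j z))).
    apply: (@near_row_free R _ (fdF t) _ _ _ _ (osc a b c j t)) => //.
      exact: (fdmx_cvg hab hmild tt jj).
    exact: osc_free gt.
  have n3 := window_dist hab hmild hj tt gt e20.
  have [rho1 r1 h1] := cwithin_interior tt (nspeed_cvg hab hmild hj tt' gt) e20.
  have n12 : \forall z \near fdF t, row_free (fdmx c (npk N j) z) /\
      row_free (fdmx c j (z.1 + (j < N)%:R * z.2, z.2)) by apply: filterI.
  have /near_fdFP[rho2 r2 h2] : \forall z \near fdF t, (row_free (fdmx c (npk N j) z) /\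
      row_free (fdmx c j (z.1 + (j < N)%:R * z.2, z.2))) /\
      (forall x y : 'rV[R]_N.+1, dot x x = 1 -> dot y y = 1 ->
        x^T *m x = wnproj c j z -> y^T *m y = wnproj c j (z.1 + z.2, z.2) ->
        `|rp_dist x y - z.2 * nspeed t| <= eps / 2 * z.2).
    by apply: filterI.
  pose al' := (x0 + al) / 2; pose be' := (be + y0) / 2.
  have [a1 [b1 [a2 b2]]] : al' < al /\ be < be' /\ x0 < al' /\ be' < y0.
    by rewrite /al' /be'; split; [|split; [|split]]; lra.
  pose rho := Num.min (Num.min rho2 (rho1 / 2)) (Num.min ((al - al') / 2) ((be' - be) / 2)).
  exists rho; first by rewrite !lt_min r2 !divr_gt0 ?subr_gt0.
  move=> x h; rewrite !lt_min => /andP[/andP[x2 x1] /andP[x3 x4]].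
  move=> /andP[h0 /andP[/andP[hh2 hh1] /andP[h3 h4]]].
  have [[f1 f2] f3] := h2 x h x2 ltac:(by rewrite h0).
  split=> // u v u1 v1 uE vE.
  have [||z zx ->] := @is_derive_MVT R G nspeed x (x + h); first by rewrite ltrDl.
    move=> s /andP[s1 s2]; apply: dG; rewrite -/al' -/be'.
    move: tab x3 x4 s1 s2 h3 h4; rewrite !ltr_norml.
    clear => /andP[? ?] /andP[? ?] /andP[? ?] ? ? ? ?.
    by apply/andP; split; lra.
  have zt : `|z - t| < rho1.
    move: zx x1 hh1; rewrite !ltr_norml; clear => /andP[? ?] /andP[? ?] ?.
    by apply/andP; split; lra.
  have k3 := h1 z zt; have k1 := f3 u v u1 v1 uE vE.
  have xh : x + h - x = h by rewrite addrAC subrr add0r.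
  rewrite xh; move: k1 k3 h0; cbn [snd]; clear.
  move: (rp_dist u v) (nspeed z) (nspeed t) => p q w k1 k3 h0.
  move: k1 k3; rewrite !ler_norml => /andP[k1 k2] /andP[k3 k4].
  have k5 : (q - w) * h <= eps / 2 * h by rewrite ler_pM2r.
  have k6 : - (eps / 2) * h <= (q - w) * h by rewrite ler_pM2r.
  rewrite mulrBl in k5 k6; rewrite [h * _]mulrC in k1 k2.
  by apply/andP; split; lra.
have cG : {for be, continuous G}.
  have [|h _] := dG be; first by apply/andP; split; lra.
  by apply: differentiable_continuous; apply/derivable1_diffP.
have [rho r0 h] : exists2 rho, 0 < rho & forall x, `|x - be| < rho -> `|G be - G x| <= eps.
  by apply/near_nbhsP; have /cvgrPdist_le/(_ eps e0) := cG.
exists (rho / r.+1%:R); first by rewrite divr_gt0 // ltr0n.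
move=> k /andP[k0]; rewrite ltr_pdivlMr ?ltr0n // -natr1 => hk; apply: h.
have r_0 : 0 <= r%:R :> R by [].
rewrite addrAC subrr add0r normrN ger0_norm; last by rewrite mulr_ge0 // ltW.
by rewrite mulrDr mulr1 in hk; lra.
Qed.

End Gaps.

Lemma near_right0 (R : realType) (P : R -> Prop) :
  (exists2 rho, 0 < rho & forall d, 0 < d < rho -> P d) -> \forall d \near 0^'+, P d.
Proof.
move=> [rho r0 h].
suff : \forall d \near nbhs (0 : R), 0 < d -> P d by [].
apply/near_nbhsP; exists rho => // d.
by rewrite subr0 ltr_norml => /andP[_ dr] d0; apply: h; rewrite d0.
Qed.

Section Punctured.
Context {R : realType} (a b : R).
Variable P : R -> Prop.

Lemma near_right_of x : a <= x < b -> (\forall t \near within `[a, b] x^', P t) ->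
  \forall d \near 0^'+, P (x + d).
Proof.
move=> /andP[ax xb] /near_punctP[rho r0 h]; apply: near_right0.
exists (Num.min rho (b - x)); first by rewrite lt_min r0 subr_gt0.
move=> d /andP[d0]; rewrite lt_min => /andP[d1 d2]; apply: h.
- by apply/andP; split; lra.
- by rewrite gt_eqF // ltrDl.
- by rewrite addrAC subrr add0r gtr0_norm.
Qed.

Lemma near_left_of x : a < x <= b -> (\forall t \near within `[a, b] x^', P t) ->
  \forall d \near 0^'+, P (x - d).
Proof.
move=> /andP[ax xb] /near_punctP[rho r0 h]; apply: near_right0.
exists (Num.min rho (x - a)); first by rewrite lt_min r0 subr_gt0.
move=> d /andP[d0]; rewrite lt_min => /andP[d1 d2]; apply: h.
- by apply/andP; split; lra.
- by rewrite lt_eqF // gtrBl.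
- by rewrite addrAC subrr add0r normrN gtr0_norm.
Qed.

End Punctured.

Section Offsets.
Context {R : realType} (N : nat) (a b : R) (hab : a < b) (c : R -> 'rV[R]_N.+1) (j : nat).
Hypothesis hmild : mildly_smoothly_turning a b c j.
Variables (e : nat -> R) (K : nat).
Hypotheses (ea : e 0%N = a) (eb : e K = b) (elt : forall k, (k < K)%N -> e k < e k.+1).

Lemma node_range k : (k <= K)%N -> a <= e k <= b.
Proof.
have up i m : (i + m <= K)%N -> e i <= e (i + m)%N.
  elim: m => [|m IH] h; first by rewrite addn0.
  by rewrite addnS in h *; apply: le_trans (IH (ltnW h)) (ltW (elt h)).
move=> kK; apply/andP; split; first by have := up 0%N k; rewrite add0n ea; apply.
by have := up k (K - k)%N; rewrite subnKC // eb; apply.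
Qed.

Lemma node_gt_a k : (0 < k <= K)%N -> a < e k.
Proof.
case: k => [//|k] /= kK; have /andP[h _] := node_range (ltnW kK).
exact: le_lt_trans h (elt kK).
Qed.

Lemma node_lt_b k : (k < K)%N -> e k < b.
Proof.
by move=> kK; have /andP[_ h] := node_range kK; exact: lt_le_trans (elt kK) h.
Qed.

(** Where the polygonal enters and leaves the neighbourhood of e k; at the end
   points of the curve only one of the two sides exists, and the other one is
   replaced by an arbitrary point nearby. *)
Definition before d k := if k is 0 then a + d else e k - d.
Definition after d k := if (k < K)%N then e k + d else b - d.

Lemma near_before d0 k (P : R -> Prop) : 0 < d0 -> (k <= K)%N ->
  (\forall t \near within `[a, b] (e k)^', P t) ->
  \forall d \near 0^'+, [/\ 0 < d, d < d0, a < before d k < b & P (before d k)].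
Proof.
move=> d00 kK h.
have h2 : \forall d \near 0^'+, P (before d k).
  case: k kK h => [|k] kK h; rewrite /before.
    by rewrite ea in h; apply: near_right_of h; rewrite lexx.
  apply: near_left_of h; have /andP[_ ->] := node_range kK.
  by rewrite node_gt_a.
have h3 : \forall d \near 0^'+, [/\ 0 < d, d < d0 & a < before d k < b].
  apply: near_right0; exists (Num.min d0 (if k is 0 then b - a else e k - a)).
    by rewrite lt_min d00 /=; case: k kK {h h2} => [|k] kK; rewrite subr_gt0 // node_gt_a.
  move=> d /andP[d1]; rewrite lt_min => /andP[d2 d3]; split=> //.
  case: k kK d3 {h h2} => [|k] kK d3 /=; first by apply/andP; split; lra.
  by have /andP[_ ?] := node_range kK; apply/andP; split; lra.
by apply: filterS2 h2 h3 => d ? [].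
Qed.

Lemma near_after d0 k (P : R -> Prop) : 0 < d0 -> (k <= K)%N ->
  (\forall t \near within `[a, b] (e k)^', P t) ->
  \forall d \near 0^'+, [/\ 0 < d, d < d0, a < after d k < b & P (after d k)].
Proof.
move=> d00 kK h; rewrite /after.
have /andP[ak kb] := node_range kK.
have h2 : \forall d \near 0^'+, P (if (k < K)%N then e k + d else b - d).
  case: ltnP => kK'; first by apply: near_right_of h; rewrite ak node_lt_b.
  have kE : k = K by apply/eqP; rewrite eqn_leq kK.
  by rewrite kE eb in h; apply: near_left_of h; rewrite hab lexx.
have h3 : \forall d \near 0^'+, [/\ 0 < d, d < d0 & a < (if (k < K)%N then e k + d else b - d) < b].
  apply: near_right0; exists (Num.min d0 (if (k < K)%N then b - e k else b - a)).
    by rewrite lt_min d00 /=; case: ltnP => kK'; rewrite subr_gt0 // node_lt_b.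
  move=> d /andP[d1]; rewrite lt_min => /andP[d2 d3]; split=> //.
  by case: ltnP d3 => kK' d3; apply/andP; split; lra.
by apply: filterS2 h2 h3 => d ? [].
Qed.

Local Notation Q k := (oscproj a b c (e k)).
Local Notation osc := (osc a b c).
Local Notation jet := (jet a b c).

Lemma choose_offsets d0 eta : 0 < d0 -> 0 < eta -> exists d d',
  [/\ 0 < d < d0, 0 < d' < d0 &
  forall k, (k <= K)%N -> [/\ a < before d k < b, a < after d' k < b,
    forall p, (p <= j.+1)%N -> free_close eta (osc p (before d k)) (Q k p),
    forall p, (p <= j.+1)%N -> free_close eta (osc p (after d' k)) (Q k p) &
    forall p q, (q + p <= j.+1)%N ->
      free_close eta (col_mx (jet (e k) 0 q (after d' k)) (jet (e k) 0 p (before d k))) (Q k (q + p))]].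
Proof.
move=> d00 e0.
have h1 : \forall d \near 0^'+, forall k, (k <= K)%N -> [/\ 0 < d, d < d0, a < before d k < b &
    (forall p, (p <= j.+1)%N -> free_close eta (osc p (before d k)) (Q k p)) /\
    \forall t2 \near within `[a, b] (e k)^', forall p q, (q + p <= j.+1)%N ->
    free_close eta (col_mx (jet (e k) 0 q t2) (jet (e k) 0 p (before d k))) (Q k (q + p))].
  apply: near_allP => k kK; have ekab := node_range kK.
  apply: (near_before (P := fun t1 => (forall p, (p <= j.+1)%N -> free_close eta (osc p t1) (Q k p)) /\
    \forall t2 \near within `[a, b] (e k)^', forall p q, (q + p <= j.+1)%N ->
    free_close eta (col_mx (jet (e k) 0 q t2) (jet (e k) 0 p t1)) (Q k (q + p)))) => //.
  have n1 := near_osc hab hmild ekab e0; have n2 := near_jets hab hmild ekab e0.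
  by apply: filterS2 n1 n2 => t ? ?; split.
have [d hd] : exists d, forall k, (k <= K)%N -> [/\ 0 < d, d < d0, a < before d k < b &
    (forall p, (p <= j.+1)%N -> free_close eta (osc p (before d k)) (Q k p)) /\
    \forall t2 \near within `[a, b] (e k)^', forall p q, (q + p <= j.+1)%N ->
    free_close eta (col_mx (jet (e k) 0 q t2) (jet (e k) 0 p (before d k))) (Q k (q + p))].
  exact: filter_ex h1.
have h2 : \forall d' \near 0^'+, forall k, (k <= K)%N -> [/\ 0 < d', d' < d0, a < after d' k < b &
    (forall p, (p <= j.+1)%N -> free_close eta (osc p (after d' k)) (Q k p)) /\
    forall p q, (q + p <= j.+1)%N ->
    free_close eta (col_mx (jet (e k) 0 q (after d' k)) (jet (e k) 0 p (before d k))) (Q k (q + p))].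
  apply: near_allP => k kK; have ekab := node_range kK.
  apply: (near_after (P := fun t2 => (forall p, (p <= j.+1)%N -> free_close eta (osc p t2) (Q k p)) /\
    forall p q, (q + p <= j.+1)%N ->
    free_close eta (col_mx (jet (e k) 0 q t2) (jet (e k) 0 p (before d k))) (Q k (q + p)))) => //.
  have n1 := near_osc hab hmild ekab e0; have [_ _ _ [_ n2]] := hd k kK.
  by apply: filterS2 n1 n2 => t ? ?; split.
have [d' hd'] : exists d', forall k, (k <= K)%N -> [/\ 0 < d', d' < d0, a < after d' k < b &
    (forall p, (p <= j.+1)%N -> free_close eta (osc p (after d' k)) (Q k p)) /\
    forall p q, (q + p <= j.+1)%N ->
    free_close eta (col_mx (jet (e k) 0 q (after d' k)) (jet (e k) 0 p (before d k))) (Q k (q + p))].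
  exact: filter_ex h2.
exists d, d'; split.
- by have [-> ->] := hd 0%N isT.
- by have [-> ->] := hd' 0%N isT.
- by move=> k kK; have [_ _ ? [? _]] := hd k kK; have [_ _ ? [? ?]] := hd' k kK; split.
Qed.

End Offsets.

Lemma inscribed_open (R : realType) (N : nat) (a b : R) (c : R -> 'rV[R]_N.+1) P :
  c a != c b -> inscribed a b c P -> ~~ closed_polygonal P.
Proof.
move=> ab [s [_ /eqP sb] ->]; rewrite /closed_polygonal /= last_map.
by rewrite sb.
Qed.

Section Approximation.
Context {R : realType} (N : nat) (a b : R) (hab : a < b) (c : R -> 'rV[R]_N.+1) (j : nat).
Hypothesis hmild : mildly_smoothly_turning a b c j.
Hypothesis harc : arclength_parameterized a b c.
Hypotheses (hN : (3 <= N)%N) (hj : (1 <= j <= N)%N) (hopen : c a != c b).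
Variables (e : nat -> R) (K : nat).
Hypotheses (ea : e 0%N = a) (eb : e K = b) (elt : forall k, (k < K)%N -> e k < e k.+1).
Hypothesis hgood : forall k t, (k < K)%N -> e k < t < e k.+1 -> good a b c j t.
Local Notation mu := (@lebesgue_measure R).
Local Notation nspeed := (nspeed a b c j).

Let K0 : (0 < K)%N.
Proof. by rewrite lt0n; apply/eqP => k0; move: hab; rewrite -ea -eb k0 ltxx. Qed.

Lemma exists_offset eps : 0 < eps ->
  exists2 d, 0 < d < eps & forall k, (k < K)%N -> d < (e k.+1 - e k) / 4.
Proof.
move=> e0; have H : \forall d \near 0^'+, forall k, (k <= K)%N ->
    [/\ 0 < d, d < eps & (k < K)%N -> d < (e k.+1 - e k) / 4].
  apply: near_allP => k kK; apply: near_right0.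
  exists (Num.min eps (if (k < K)%N then (e k.+1 - e k) / 4 else eps)).
    by rewrite lt_min e0; case: ltnP => //= kK'; rewrite divr_gt0 // subr_gt0 elt.
  by move=> d /andP[d1]; rewrite lt_min => /andP[d2]; case: ltnP.
have [d hd] : exists d, forall k, (k <= K)%N ->
    [/\ 0 < d, d < eps & (k < K)%N -> d < (e k.+1 - e k) / 4] by exact: filter_ex H.
exists d => [|k kK]; first by have [-> ->] := hd 0%N isT.
by have [_ _] := hd k (ltnW kK); exact.
Qed.

(** The step is at most D / M. *)
Lemma near_gstep d d' D rho : (forall k, (k < K)%N -> gleft e d' k < gright e d k) ->
  (forall k, (k < K)%N -> gright e d k - gleft e d' k <= D) -> 0 < rho ->
  \forall M \near \oo, forall k, (k < K)%N -> 0 < gstep e M d d' k < rho.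
Proof.
move=> gap gD r0; exists (Num.truncn (D / rho)).+1 => // M /= hM k kK.
have M0 : (0 < M)%N by exact: leq_trans hM.
have hD : D < rho * M%:R.
  rewrite mulrC -ltr_pdivrMr //; apply: lt_le_trans (truncnS_gt _) _.
  by rewrite ler_nat.
apply/andP; split; first exact: (gstep_gt0 M0 gap).
by rewrite /gstep ltr_pdivrMr ?ltr0n //; exact: le_lt_trans (gD k kK) hD.
Qed.

Lemma exists_rate (A eps : R) : 0 <= A -> 0 < eps -> exists2 x, 0 < x & A * x <= eps.
Proof.
move=> A0 e0; have p0 : 0 < A + 1 by rewrite ltr_wpDl.
exists (eps / (A + 1)); first by rewrite divr_gt0.
by rewrite mulrA ler_pdivrMr // mulrC ler_pM2l // lerDl.
Qed.

(** The order of the choices matters: eta bounds the arcs near the exceptional points,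
   d and d' depend on it, and the number M of steps depends on all of them. *)
Lemma approximation eps : 0 < eps -> exists P L (al be S : nat -> R),
  [/\ polygonal P /\ inscribed a b c P, has_discrete_normal j P /\ mesh P <= eps,
    discrete_normal_length j P = L%:E, `|L - \sum_(k < K) S k| <= eps &
    forall k, (k < K)%N -> [/\ (\int[mu]_(t in `[al k, be k]) (nspeed t)%:E = (S k)%:E)%E,
      e k < al k < e k + eps & e k.+1 - eps < be k < e k.+1]].
Proof.
move=> eps0; pose r := (npicks N j).+1; pose D := b - a.
have D0 : 0 < D by rewrite subr_gt0.
pose C : R := K%:R * (r.+2%:R * (8 * N.+1%:R)).
have C0 : 0 <= C by rewrite !mulr_ge0.
have [eta eta0 [eta1 etaC]] : exists2 x, 0 < x & 4 * N.+1%:R * x <= 1 /\ C * x <= eps / 2.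
  have [|x1 x10 h1] := @exists_rate (4 * N.+1%:R) 1 _ ltr01; first by rewrite mulr_ge0.
  have [|x2 x20 h2] := @exists_rate C (eps / 2) C0; first by lra.
  exists (Num.min x1 x2); first by rewrite lt_min x10.
  split; first by apply: le_trans h1; rewrite ler_wpM2l ?mulr_ge0 // ge_min lexx.
  by apply: le_trans h2; rewrite ler_wpM2l // ge_min lexx orbT.
have KD0 : 0 <= K%:R * (D + 1) :> R by rewrite mulr_ge0 //; lra.
have [eps' eps'0 epsK] := @exists_rate (K%:R * (D + 1)) (eps / 2) KD0 ltac:(lra).
have eta20 : 0 < eta / 2 by lra.
have [d0 /andP[d00 d0eps] d0gap] := exists_offset eps0.
have [d [d' [/andP[dp dd] /andP[d'p dd'] hd]]] := choose_offsets hab hmild ea eb elt d00 eta20.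
pose gl := gleft e d'; pose gr := gright e d.
have gapk k : (k < K)%N -> gl k < gr k.
  by move=> kK; have := d0gap k kK; rewrite /gl /gr /gleft /gright; lra.
have inr k : (k <= K)%N -> a <= e k <= b by exact: (node_range ea eb elt).
have gD k : (k < K)%N -> gr k - gl k <= D.
  move=> kK; have /andP[h1 _] := inr k (ltnW kK); have /andP[_ h2] := inr k.+1 kK.
  by rewrite /gr /gl /gleft /gright /D; lra.
have alE k : (k < K)%N -> after b e K d' k = gl k by rewrite /after => ->.
have beE k : (0 < k)%N -> before a e d k = gr k.-1 by case: k.
have hG : forall k, exists G : R -> R, (k < K)%N ->
  [/\ (\int[mu]_(t in `[gl k, gr k]) (nspeed t)%:E = (G (gr k) - G (gl k))%:E)%E,
      exists2 rho, 0 < rho & forall x h, gl k <= x <= gr k -> 0 < h < rho ->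
      [/\ row_free (fdmx c (npk N j) (x, h)), row_free (fdmx c j (x + (j < N)%:R * h, h)) &
        forall u v : 'rV[R]_N.+1, dot u u = 1 -> dot v v = 1 ->
        u^T *m u = wnproj c j (x, h) -> v^T *m v = wnproj c j (x + h, h) ->
        `|rp_dist u v - (G (x + h) - G x)| <= eps' * h] &
      exists2 rho, 0 < rho & forall h, 0 < h < rho -> `|G (gr k) - G (gr k - r%:R * h)| <= eps'].
  move=> k; have [kK|kK] := ltnP k K; last by exists (fun=> 0).
  have /andP[h1 _] := inr k (ltnW kK); have /andP[_ h2] := inr k.+1 kK.
  have h3 : e k < gl k by rewrite /gl /gleft ltrDl.
  have h4 : gr k < e k.+1 by rewrite /gr /gright gtrBl.
  have [G hG] := inner_uniform hab hmild hj r h1 h2 h3 (gapk k kK) h4 (fun t => @hgood k t kK) eps'0.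
  by exists G.
have [G {}hG] := choice hG.
have small (X : nat -> Prop) : (exists2 rho, 0 < rho & forall M,
    (forall k, (k < K)%N -> 0 < gstep e M d d' k < rho) -> X M) -> \forall M \near \oo, X M.
  by move=> [rho r0 h]; apply: filterS (near_gstep gapk gD r0).
(* half of eta is spent on the step, the other half on the offsets *)
have half2 (p : nat) (M : 'M[R]_(p, N.+1)) X Y : free_close (eta / 2) M X ->
    mxclose (eta / 2) X Y -> free_close eta M Y.
  by move=> h1 h2; have := free_close_trans h1 h2; rewrite -splitr.
have n1 : \forall M \near \oo, forall k, (k <= K)%N -> forall p, (p <= j.+1)%N ->
    forall i, (i <= 1)%N -> (k < K)%N ->
    free_close eta (fdmx c p (gl k + i%:R * gstep e M d d' k, gstep e M d d' k)) (oscproj a b c (e k) p).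
  apply: near_allP => k kK; apply: near_allP => p pj; apply: near_allP => i i1; apply: small.
  have [kK'|kK'] := ltnP k K; last by exists 1.
  have [_ tab _ /(_ p pj)[f cl] _] := hd k kK; rewrite alE // in tab f cl.
  have [rho r0 hr] := window_uniform hab hmild i%:R tab pj f eta20.
  by exists rho => // M hM _; exact: half2 (hr _ (hM k kK')) cl.
have n2 : \forall M \near \oo, forall k, (k <= K)%N -> forall p, (p <= j.+1)%N -> (k < K)%N ->
    free_close eta (fdmx c p (gr k - p%:R * gstep e M d d' k, gstep e M d d' k))
      (oscproj a b c (e k.+1) p).
  apply: near_allP => k kK; apply: near_allP => p pj; apply: small.
  have [kK'|kK'] := ltnP k K; last by exists 1.
  have [tab _ /(_ p pj)[f cl] _ _] := hd k.+1 kK'; rewrite beE //= in tab f cl.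
  have [rho r0 hr] := window_uniform hab hmild (- p%:R) tab pj f eta20.
  by exists rho => // M hM _; have := hr _ (hM k kK'); rewrite mulNr => h; exact: half2 h cl.
have n3 : \forall M \near \oo, forall k, (k <= K)%N -> forall p, (p <= j.+1)%N ->
    forall q, (q <= j.+1)%N -> (q + p <= j.+1)%N -> (k = 0%N -> p = 0%N) -> (k = K -> q = 0%N) ->
    free_close eta (col_mx (jetfd c (e k) q (gl k, gstep e M d d' k))
      (jetfd c (e k) p (gr k.-1 - p.-1%:R * gstep e M d d' k.-1, gstep e M d d' k.-1)))
      (oscproj a b c (e k) (q + p)).
  apply: near_allP => k kK; apply: near_allP => p pj; apply: near_allP => q qj; apply: small.
  have [qp|qp] := leqP (q + p) j.+1; last by exists 1.
  have [tab1 tab2 _ _ /(_ p q qp)[f cl]] := hd k kK.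
  have [rho r0 hr] := window_straddle hab hmild tab1 tab2 pj qj f eta20.
  exists rho => // M hM _ p0 q0.
  have rho2 : 0 < rho / 2 < rho by apply/andP; split; lra.
  (* at a and b one of the two blocks has no row, and its step does not exist *)
  pose h1 := if k is 0 then rho / 2 else gstep e M d d' k.-1.
  pose h2 := if (k < K)%N then gstep e M d d' k else rho / 2.
  have h10 : 0 < h1 < rho.
    by rewrite /h1; move: kK; case: (k) => [|k'] kK' //=; exact: hM.
  have h20 : 0 < h2 < rho by rewrite /h2; case: ltnP => // kK'; exact: hM.
  have := half2 _ _ _ _ (hr h1 h2 h10 h20) cl; congr (free_close _ (col_mx _ _) _).
    rewrite /h2 /after; case: ltnP => // kK'.
    have q_0 : q = 0%N by apply: q0; apply/eqP; rewrite eqn_leq kK.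
    by rewrite q_0 [LHS]flatmx0 [RHS]flatmx0.
  rewrite /h1; move: p0; case: (k) => [|k'] p0 //=.
  by rewrite p0 // [LHS]flatmx0 [RHS]flatmx0.
have n4 : \forall M \near \oo, forall k, (k <= K)%N -> (k < K)%N -> forall x, gl k <= x <= gr k ->
    let h := gstep e M d d' k in
      [/\ row_free (fdmx c (npk N j) (x, h)), row_free (fdmx c j (x + (j < N)%:R * h, h)) &
        forall u v : 'rV[R]_N.+1, dot u u = 1 -> dot v v = 1 ->
        u^T *m u = wnproj c j (x, h) -> v^T *m v = wnproj c j (x + h, h) ->
        `|rp_dist u v - (G k (x + h) - G k x)| <= eps' * h].
  apply: near_allP => k kK; apply: small; have [kK'|kK'] := ltnP k K; last by exists 1.
  have [_ [rho r0 hr] _] := hG k kK'.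
  by exists rho => // M hM _ x xk h; apply: hr => //; exact: hM.
have n5 : \forall M \near \oo, forall k, (k <= K)%N -> (k < K)%N ->
    `|G k (gr k) - G k (gr k - r%:R * gstep e M d d' k)| <= eps'.
  apply: near_allP => k kK; apply: small; have [kK'|kK'] := ltnP k K; last by exists 1.
  have [_ _ [rho r0 hr]] := hG k kK'.
  by exists rho => // M hM _; apply: hr; exact: hM.
have n6 := near_gstep gapk gD eps0.
have n7 : \forall M \near \oo, (2 * (j + 4) <= M)%N by exact: nbhs_infty_ge.
have [M [[[m1 m2] [m3 m4]] [[m5 m6] m7]]] :=
  filter_ex (filterI (filterI (filterI n1 n2) (filterI n3 n4)) (filterI (filterI n5 n6) n7)).
have M0 : (0 < M)%N by apply: leq_trans m7; rewrite muln_gt0 addn_gt0 orbT.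
have deps : d <= eps by apply: ltW; exact: lt_trans dd d0eps.
have d'eps : d' <= eps by apply: ltW; exact: lt_trans dd' d0eps.
have ins := inscribed_grid c K0 M0 dp d'p gapk ea eb.
have open := inscribed_open hopen ins.
have H1 k : (k < K)%N -> forall p i, (p <= j.+1)%N -> (i <= 1)%N ->
    free_close eta (fdmx c p (gl k + i%:R * gstep e M d d' k, gstep e M d d' k)) (oscproj a b c (e k) p).
  by move=> kK p i pj i1; exact: m1 (ltnW kK) _ pj _ i1 kK.
have H2 k : (k < K)%N -> forall p, (p <= j.+1)%N ->
    free_close eta (fdmx c p (gr k - p%:R * gstep e M d d' k, gstep e M d d' k))
      (oscproj a b c (e k.+1) p).
  by move=> kK p pj; exact: m2 (ltnW kK) _ pj kK.
have H3 k : (k <= K)%N -> forall p q, (q + p <= j.+1)%N -> (k = 0%N -> p = 0%N) -> (k = K -> q = 0%N) ->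
    free_close eta (col_mx (jetfd c (e k) q (gl k, gstep e M d d' k))
      (jetfd c (e k) p (gr k.-1 - p.-1%:R * gstep e M d d' k.-1, gstep e M d d' k.-1)))
      (oscproj a b c (e k) (q + p)).
  move=> kK p q qp; apply: m3 => //.
    exact: leq_trans (leq_addl q p) qp.
  exact: leq_trans (leq_addr p q) qp.
have H4 k (kK : (k < K)%N) := m4 k (ltnW kK) kK.
have H5 k (kK : (k < K)%N) := m5 k (ltnW kK) kK.
have [L LE Lb] := grid_length hN hj erefl K0 m7 dp d'p gapk open (ltW eta0) eta1 (ltW eps'0)
  H1 H2 H3 H4 H5 gD.
have [pol hn] := grid_polygonalP hN hj erefl K0 m7 dp d'p gapk open (ltW eta0) eta1 (ltW eps'0)
  H1 H2 H3 H4.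
exists (grid_polygonal c e K M d d'), L, gl, gr, (fun k => G k (gr k) - G k (gl k)).
split=> //.
- split=> //; apply: (mesh_grid K0 M0 dp d'p gapk (chord_le harc) ea eb (ltW eps0) deps d'eps).
  by move=> k kK; apply: ltW; have /andP[] := m6 k kK.
- apply: le_trans Lb _; rewrite mulrDr -/r.
  have -> : K%:R * (eps' * (D + 1)) = K%:R * (D + 1) * eps' by ring.
  have -> : K%:R * (r.+2%:R * (8 * N.+1%:R * eta)) = C * eta by rewrite /C; ring.
  by rewrite [leRHS]splitr lerD.
- move=> k kK; have [hi _ _] := hG k kK; split=> //.
    by rewrite /gl /gleft ltrDl d'p ltrD2l (lt_trans dd').
  by rewrite /gr /gright gtrBl dp ltrD2l ltrN2 (lt_trans dd).
Qed.

End Approximation.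

Lemma mesh_ge0 (R : realType) (N : nat) (P : seq 'rV[R]_N.+1) : 0 <= mesh P.
Proof. exact: bigmax_ge_id. Qed.

Lemma cvg_harmonic_bound (R : realType) (u : nat -> R) :
  (forall n, `|u n| <= n.+1%:R^-1) -> u @ \oo --> (0 : R).
Proof.
move=> h; apply: norm_cvg0; apply: (@squeeze_cvgr _ _ _ _ (fun=> 0) (fun n => n.+1%:R^-1)).
- by apply: nearW => n; rewrite normr_ge0 h.
- exact: cvg_cst.
- exact: cvg_harmonic.
Qed.

Theorem proposition7p10 (R : realType) (N : nat) (hN : (3 <= N)%N)
    (a b : R) (hab : a < b) (c : R -> 'rV[R]_N.+1) (hopen : c a != c b)
    (harc : arclength_parameterized a b c)
    (j : nat) (hj : (1 <= j <= N)%N)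
    (hmild : mildly_smoothly_turning a b c j) :
  exists P : nat -> seq 'rV[R]_N.+1,
    [/\ forall n, polygonal (P n) /\ inscribed a b c (P n),
        forall n, has_discrete_normal j (P n),
        (fun n => mesh (P n)) @ \oo --> (0 : R)
      & (fun n => discrete_normal_length j (P n)) @ \oo -->
        (\int[lebesgue_measure]_(s in `[a, b])
           (enorm (deriv_itv a b (smooth_normal a b c j) s))%:E)%E].
Proof.
have [es [hp hg]] := good_partition hab hmild.
pose e k := nth b (a :: es) k; pose K := size es.
have eb : e K = b by exact: itv_partition_nth_size hp.
have elt k : (k < K)%N -> e k < e k.+1.
  by case: hp => /(pathP b) h _ kK; exact: h.
have n0 n : 0 < n.+1%:R^-1 :> R by rewrite invr_gt0.
have [P hP] := choice (fun n => approximation hab hmild harc hN hj hopen (erefl a : e 0%N = a) eb elt hg (n0 n)).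
have [L hL] := choice hP; have [al hal] := choice hL.
have [be hbe] := choice hal; have [S hS] := choice hbe.
exists P; split.
- by move=> n; have [? _ _ _ _] := hS n.
- by move=> n; have [_ [? _] _ _ _] := hS n.
- apply: cvg_harmonic_bound => n; rewrite ger0_norm ?mesh_ge0 //.
  by have [_ [_ ?] _ _ _] := hS n.
pose f t := (enorm (deriv_itv a b (smooth_normal a b c j) t))%:E.
have f0 t : (0 <= f t)%E by rewrite lee_fin enorm_ge0.
have inab k t : (k < K)%N -> e k < t < e k.+1 -> a < t < b.
  move=> kK /andP[t1 t2].
  have /andP[h1 _] := node_range (erefl a : e 0%N = a) eb elt (ltnW kK).
  have /andP[_ h2] := node_range (erefl a : e 0%N = a) eb elt kK.
  by rewrite (le_lt_trans h1) // (lt_le_trans t2).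
have fE k t : (k < K)%N -> e k < t < e k.+1 -> f t = (nspeed a b c j t)%:E.
  move=> kK tk; have /andP[/ltW t1 /ltW t2] := inab k t kK tk.
  by rewrite /f (smooth_normal_speed hab hmild harc hj) ?t1 //; exact: hg kK tk.
have mf k : (k < K)%N -> measurable_fun `]e k, e k.+1[ f.
  move=> kK; apply: (eq_measurable_fun (EFin \o nspeed a b c j)).
    by move=> t; rewrite inE /= in_itv /= => tk; rewrite (fE k).
  apply/measurable_EFinP; apply: open_continuous_measurable_fun; first exact: itv_open.
  move=> t; rewrite inE /= in_itv /= => tk.
  by apply: (nspeed_continuous hab hmild hj); [exact: inab tk | exact: hg kK tk].
have [_ ->] := partition_integral hp f0 mf.
rewrite big_mkord.
have cS : (fun n => (\sum_(k < K) (S n k)%:E)%E) @ \oo -->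
    (\sum_(k < K) \int[lebesgue_measure]_(x in `]e k, e k.+1[) f x)%E.
  have SE n k : (k < K)%N -> ((S n k)%:E = \int[lebesgue_measure]_(x in `[al n k, be n k]) f x)%E.
    move=> kK; have [_ _ _ _ /(_ k kK)[<- /andP[h1 _] /andP[_ h2]]] := hS n.
    apply: eq_integral => t; rewrite inE /= in_itv /= => /andP[t1 t2].
    by rewrite (fE k) // (lt_le_trans h1) // (le_lt_trans t2).
  apply: cvg_nnesum => k _.
    by apply: nearW => n; rewrite SE //; exact: integral_ge0.
  have h : (fun n => \int[lebesgue_measure]_(x in `[al n k, be n k]) f x)%E @ \oo -->
      (\int[lebesgue_measure]_(x in `]e k, e k.+1[) f x)%E.
    have kK := ltn_ord k; apply: gap_integral_cvg (elt k kK) f0 (mf k kK) _ _ => n;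
      by have [_ _ _ _ /(_ k kK)[_ /andP[? ?] /andP[? ?]]] := hS n.
  by apply: cvg_trans h; apply: near_eq_cvg; apply: nearW => n; rewrite SE.
(* the integral may be infinite, so the error is added to the sums of integrals rather
   than compared with their limit *)
have cD : (fun n => (L n - \sum_(k < K) S n k)%:E) @ \oo --> (0%:E : \bar R).
  apply/cvg_EFin; first exact: nearW.
  by apply: cvg_harmonic_bound => n; have [_ _ _ ? _] := hS n.
have -> : (fun n => discrete_normal_length j (P n)) =
    (fun n => \sum_(k < K) (S n k)%:E + (L n - \sum_(k < K) S n k)%:E)%E.
  by apply/funext => n; have [_ _ -> _ _] := hS n; rewrite sumEFin -EFinD addrC subrK.
rewrite -[X in _ --> X]adde0.
exact: (cvgeD (fin_num_adde_defl _ (isT : 0%:E \is a fin_num)) cS cD).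
Qed.
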